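(* For each $m\in\mathbb{N}$ there exists a universal constant $K_m<\infty$ (depending only on $m$) such that the following holds. Let $n\ge m$ and $p>2$, and suppose that for all $\mathbf{i}=(i_1,\dots,i_m)\in\{1,\dots,n\}^m$, $h_{\mathbf{i}}:S^m\to\mathbb{R}$ is measurable, $h_{\mathbf{i}}(X_{i_1}^{(1)},\dots,X_{i_m}^{(m)})$ is $p$-integrable and $E_jh_{\mathbf{i}}(X_{i_1}^{(1)},\dots,X_{i_m}^{(m)})=0$ a.s. for all $j=1,\dots,m$. Let $$t_0=\inf\Bigl[t\ge 0:\ \Pr\Bigl\{\Bigl|\sum_{\mathbf{i}}h_{\mathbf{i}}\Bigr|>t\Bigr\}\le\Bigl(\frac34\Bigr)^{p/(p-2)}\frac{1}{\bigl(2K_m^pp^{mp/2}\bigr)^{1/(p-2)}}\Bigr].$$ Then $$\frac{1}{(4K_mp^{m/2})^{p/(p-2)}}\,t_0^p\ \vee\ 2^{-mp}\max_{J\subseteq\{1,\dots,m\},\,J\ne\emptyset}\Bigl[E_J\max_{\mathbf{i}_J}\Bigl(\sum_{\mathbf{i}_{J^c}}E_{J^c}h_{\mathbf{i}}^2\Bigr)^{p/2}\Bigr]\le E\Bigl|\sum_{\mathbf{i}}h_{\mathbf{i}}\Bigr|^p$$ $$\le 2K_m^p\Bigl\{(2p^{m/2})^pt_0^p+\sum_{J\subseteq\{1,\dots,m\},\,J\ne\emptyset}\Bigl[p^{(m+|J|)p/2}E_J\max_{\mathbf{i}_J}\Bigl(\sum_{\mathbf{i}_{J^c}}E_{J^c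}h_{\mathbf{i}}^2\Bigr)^{p/2}\Bigr]\Bigr\}.$$
   Context: The random variables $X_i^{(j)}$, $1\le i\le n$, $1\le j\le m$, $m\le n$, are independent (not necessarily with the same distribution) and take values in a measurable space $(S,\mathcal{S})$. Inside expectations, probabilities and sums, $h_{\mathbf{i}}$ stands for the random variable $h_{i_1,\dots,i_m}(X_{i_1}^{(1)},\dots,X_{i_m}^{(m)})$, and $\sum_{\mathbf{i}}$ is the sum over all $\mathbf{i}\in\{1,\dots,n\}^m$. For $J\subseteq\{1,\dots,m\}$, $J^c$ is its complement in $\{1,\dots,m\}$; $\mathbf{i}_J\in\{1,\dots,n\}^{|J|}$ is obtained from $\mathbf{i}$ by deleting the coordinates in places not in $J$; $\sum_{\mathbf{i}_J}$ and $\max_{\mathbf{i}_J}$ are the sum and the maximum over $1\le i_j\le n$, $j\in J$ (the coordinates not in $J$ being fixed), with $\sum_{\mathbf{i}_\emptyset}a=a$. $E$ is expectation with respect to all variables; $E_J$ is expectation only with respect to the variables $X_i^{(j)}$ with $j\in J$, $1\le i\le n$ (the others being held fixed), with $E_\emptyset a=a$; $E_j=E_{\{j\}}$. $a\vee b=\max(a,b)$. *)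

(* Defs.v *)
From HB Require Import structures.
From mathcomp Require Import all_boot all_order all_algebra.
From mathcomp Require Import all_classical all_reals all_analysis.

Set Implicit Arguments.
Unset Strict Implicit.
Unset Printing Implicit Defensive.

Import Order.TTheory GRing.Theory Num.Theory.
Import numFieldNormedType.Exports.
Local Open Scope classical_set_scope.
Local Open Scope ring_scope.

Definition mutually_independent (d d' : measure_display)
    (Omega : measurableType d) (S : measurableType d') (R : realType)
    (P : probability Omega R) (I : finType) (X : I -> Omega -> S) : Prop :=
  forall (F : {set I}) (A : I -> set S), (forall i, measurable (A i)) ->
    (P (\bigcap_(i in [set` F]) (X i @^-1` A i)) =
     \prod_(i in F) P (X i @^-1` A i))%E.

(* The multi-index i = (i_1, ..., i_m) is the function j |-> i j.  The
   coordinates and indices are numbered from 0. *)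
Definition mindex (m n : nat) := {ffun 'I_m -> 'I_n}.

(* A value x of the whole array of variables; x j k is the value of
   X_k^(j). *)
Definition array (m n : nat) (S : Type) := 'I_m -> 'I_n -> S.

Definition coords (m n : nat) (S : Type) (i : mindex m n) (x : array m n S) :
  m.-tuple S := [tuple x j (i j) | j < m].

Definition sample (m n : nat) (Omega S : Type)
    (X : 'I_m -> 'I_n -> Omega -> S) (w : Omega) : array m n S :=
  fun j k => X j k w.

Definition glue (m n : nat) (S : Type) (J : {set 'I_m})
    (y x : array m n S) : array m n S :=
  fun j => if j \in J then y j else x j.

(* E_J: the variables X_k^(j) with j in J are integrated out, the others are
   held fixed, with the values given by x. *)
Definition expect_on (m n : nat) (d : measure_display)
    (Omega : measurableType d) (S : Type) (R : realType)
    (P : probability Omega R) (X : 'I_m -> 'I_n -> Omega -> S)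
    (J : {set 'I_m}) (G : array m n S -> \bar R) (x : array m n S) : \bar R :=
  (\int[P]_w G (glue J (sample X w) x))%E.

Definition agree_off (m n : nat) (J : {set 'I_m}) (i k : mindex m n) : bool :=
  [forall j, (j \notin J) ==> (k j == i j)].

(* The sum and the maximum over i_J, the coordinates outside J being those
   of i. *)
Definition sum_on (m n : nat) (R : realType) (J : {set 'I_m})
    (a : mindex m n -> \bar R) (i : mindex m n) : \bar R :=
  (\sum_(k : mindex m n | agree_off J i k) a k)%E.

Definition max_on (m n : nat) (R : realType) (J : {set 'I_m})
    (a : mindex m n -> \bar R) (i : mindex m n) : \bar R :=
  \big[maxe/-oo%E]_(k : mindex m n | agree_off J i k) a k.

Definition hsum (m n : nat) (S : Type) (R : realType)
    (h : mindex m n -> m.-tuple S -> R) (x : array m n S) : R :=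
  \sum_(i : mindex m n) h i (coords i x).

(* E_J max_{i_J} (sum_{i_{J^c}} E_{J^c} h_i^2)^(p/2).  Nothing is left free in
   it: its value does not depend on the arguments x and i, which are the fixed
   values, required by the operators, of the variables and coordinates outside
   J. *)
Definition mixed_term (m n : nat) (d : measure_display)
    (Omega : measurableType d) (S : Type) (R : realType)
    (P : probability Omega R) (X : 'I_m -> 'I_n -> Omega -> S)
    (h : mindex m n -> m.-tuple S -> R) (p : R) (J : {set 'I_m})
    (x : array m n S) (i : mindex m n) : \bar R :=
  expect_on P X J (fun y : array m n S =>
    max_on J (fun k : mindex m n =>
      poweR (sum_on (~: J)%SET (fun l : mindex m n =>
               expect_on P X (~: J)%SET
                 (fun z : array m n S => ((h l (coords l z)) ^+ 2)%:E) y) k)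
            (p / 2)) i) x.

Definition tail_quantile (d : measure_display) (Omega : measurableType d)
    (R : realType) (P : probability Omega R) (Z : Omega -> R) (c : R) : R :=
  inf [set t : R | 0 <= t /\ (P [set w | (t < `|Z w|)%R] <= c%:E)%E].

(* Main.v *)
Require Import Defs.
From HB Require Import structures.
From mathcomp Require Import all_boot all_order all_algebra.
From mathcomp Require Import all_classical all_reals all_analysis.
From mathcomp Require Import measurable_realfun.
From mathcomp Require Import ring lra.

Set Implicit Arguments.
Unset Strict Implicit.
Unset Printing Implicit Defensive.

Import Order.TTheory GRing.Theory Num.Theory.
Import numFieldNormedType.Exports.
Local Open Scope classical_set_scope.
Local Open Scope ring_scope.

(** The moment inequality behind the upper bound has the form
    [E|Z|^p <= C^p sum_J p^((m + |J|) p / 2) R_J], with [R_J] the mixed term of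
    [J].  By convexity and centering, inserting signs in one row of indices
    changes [E|Z|^p] by a factor at most [2^p], so Khinchine's inequality, used
    row by row, reduces it to a bound of [E (sum_i f_i)^q] for the nonnegative
    [f = h^2] and [q = p / 2].  That bound comes from two inequalities for one
    row of independent nonnegative variables,
    [E (sum xi)^q <= C^q ((sum E xi)^q + q^q sum E xi^q)] and, for every [a],
    [sum E xi^q <= C^q (E max xi^q + q^(- a q) (sum E xi)^q)]: iterating the
    first one over the rows gives sums over [i_J] in place of maxima, and in the
    conversion of the sums into maxima the error terms are moments with fewer
    integrated rows, which the free exponent [a] makes harmless.

    The term of the empty set is [(E Z^2)^(p/2)] up to constants.  If it does
    not exceed the other terms, it can be dropped.  Otherwise these terms are
    small for every exponent [r <= p], so that [E|Z|^r <= B^r (E Z^2)^(r/2)] for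
    [r = min(p, 4)] and [B] depending only on [m], and the Paley-Zygmund
    argument bounds [E Z^2] by a multiple of [t0^2].  The exponent [r] cannot be
    replaced by [p]: the probability which Paley-Zygmund yields at exponent [p]
    is [(3/4)^(p/(p-2)) / (2 K^p p^(mp/2))^(2/(p-2))], smaller than the level
    in the definition of [t0] by a power of [p].

    The lower bounds are Markov's inequality and
    [R_J <= E (sum_i h_i^2)^(p/2) <= 2^(mp) E|Z|^p], the last step again by
    averaging over signs. *)

(** Every constant must have the form [C^p] with [C] depending on [m] alone, beside the displayed
    powers of [p]. Polynomial factors in [q] are admissible because [q <= e^q]; a factor [q^q] must
    be paid for by a weight. Khinchine's inequality costs [p^(1/2)] per row in norm, hence
    [p^(m p / 2)]; each row whose sum is taken outside the power costs [q^q], hence [p^(|J| p / 2)].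
    An error term in the conversion to maxima lives on fewer rows and is bounded with weight 1 where
    [q^(|J| q)] is required; the factor [q^(- a q)] with [a] of order [m] makes up this deficit.

    No symmetrized copy of the variables occurs: the moment is compared for each fixed sign pattern,
    and the patterns are then averaged over a finite type, so that the proof stays on one
    probability space. Expectations are operators on functions of the whole array, and the functions
    are kept nonnegative in the extended reals, so that Tonelli's theorem applies freely; finiteness
    is proved mainly where a term has to be subtracted or cancelled. *)

(** * Integrating out blocks of coordinates *)

Definition rectangle (m n : nat) (d : measure_display) (S : measurableType d)
    (C : 'I_m * 'I_n -> set S) : set ('I_m -> 'I_n -> S) :=
  [set x | forall jk, C jk (x jk.1 jk.2)].

Definition rectangles (m n : nat) (d : measure_display) (S : measurableType d) :
    set (set ('I_m -> 'I_n -> S)) :=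
  [set U | exists2 C : 'I_m * 'I_n -> set S,
    (forall jk, measurable (C jk)) & U = rectangle C].

(** The product sigma-algebra, put on the same function type as [array m n S], so that the operators
    of the statement act on its points without any transport. *)
Definition marray (m n : nat) (d : measure_display) (S : measurableType d) :=
  g_sigma_algebraType (@rectangles m n d S).

HB.instance Definition _ (m n : nat) (d : measure_display)
    (S : measurableType d) := Measurable.on (marray m n S).

(** A version of [glue] for arbitrary sets of cells: separating one variable from the rest of its
    row requires sets that are not unions of rows. *)
Definition mix (m n : nat) (S : Type) (A : {set 'I_m * 'I_n})
    (y x : array m n S) : array m n S :=
  fun j k => if (j, k) \in A then y j k else x j k.

Definition rows (m n : nat) (J : {set 'I_m}) : {set 'I_m * 'I_n} :=
  [set jk | jk.1 \in J].

Lemma measurable_to_marray (m n : nat) (d d' : measure_display)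
    (U : measurableType d') (S : measurableType d) (f : U -> array m n S) :
  (forall j k, measurable_fun setT (fun u => f u j k)) ->
  measurable_fun setT (f : U -> marray m n S).
Proof.
move=> mf; apply: (@measurability _ _ U (marray m n S) setT f (@rectangles m n d S)) => //.
move=> _ [_ [C mC ->] <-]; rewrite setTI.
have -> : f @^-1` rectangle C =
    \bigcap_(jk in [set: 'I_m * 'I_n]) ((fun u => f u jk.1 jk.2) @^-1` C jk).
  by apply/seteqP; split=> u H jk; [move=> _|]; exact: H.
apply: fin_bigcap_measurable; first exact: finite_finset.
by move=> jk _; rewrite -[X in measurable X]setTI; exact: mf.
Qed.

Lemma measurable_coord (m n : nat) (d : measure_display) (S : measurableType d)
    (j : 'I_m) (k : 'I_n) :
  measurable_fun setT (fun x : marray m n S => x j k).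
Proof.
move=> _ B mB; rewrite setTI; apply: sub_sigma_algebra.
exists (fun jk => if jk == (j, k) then B else setT).
  by move=> jk; case: ifP.
apply/seteqP; split=> x /=.
  by move=> Bx [j' k'] /=; case: ifP => // /eqP [-> ->].
by move=> /(_ (j, k)) /=; rewrite eqxx.
Qed.

Section Expectation.
Context (R : realType) (m n : nat) (d d' : measure_display)
  (Omega : measurableType d) (P : probability Omega R) (S : measurableType d')
  (X : 'I_m -> 'I_n -> {RV P >-> S}).
Hypothesis indep : mutually_independent P (fun jk : 'I_m * 'I_n => X jk.1 jk.2).
Local Open Scope ereal_scope.

Local Notation T := (marray m n S).

Definition expect_cells (A : {set 'I_m * 'I_n}) (G : T -> \bar R) (x : T) : \bar R :=
  \int[P]_w G (mix A (sample X w) x).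

Local Notation EX := expect_cells.

Lemma expect_onE (J : {set 'I_m}) (G : T -> \bar R) (x : T) :
  expect_on P X J G x = EX (rows n J) G x.
Proof.
apply: eq_integral => w _; congr G.
apply/funext => j; apply/funext => k; rewrite /Defs.glue /mix inE /=.
by case: (j \in J).
Qed.

Lemma measurable_mix_pair (A : {set 'I_m * 'I_n}) :
  measurable_fun setT (fun z : T * Omega => mix A (sample X z.2) z.1 : T).
Proof.
apply: measurable_to_marray => j k; rewrite /mix; case: ((j, k) \in A).
  exact: (measurableT_comp (measurable_funPT (X j k)) measurable_snd).
exact: (measurableT_comp (measurable_coord j k) measurable_fst).
Qed.

Lemma measurable_mix (A : {set 'I_m * 'I_n}) (x : T) :
  measurable_fun setT (fun w => mix A (sample X w) x : T).
Proof.
by apply: measurable_to_marray => j k; rewrite /mix; case: ((j, k) \in A).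
Qed.

Lemma measurable_EX A (G : T -> \bar R) :
  measurable_fun setT G -> (forall x, 0 <= G x) -> measurable_fun setT (EX A G).
Proof.
move=> mG G0.
apply: (@measurable_fun_fubini_tonelli_F _ _ T Omega R P
  (fun z : T * Omega => G (mix A (sample X z.2) z.1))) => //.
exact: (measurableT_comp mG (measurable_mix_pair A)).
Qed.

Lemma EX_ge0 A (G : T -> \bar R) x : (forall x, 0 <= G x) -> 0 <= EX A G x.
Proof. by move=> G0; apply: integral_ge0. Qed.

Lemma independent_rectangle (F : {set 'I_m * 'I_n}) (C : 'I_m * 'I_n -> set S) :
  (forall jk, measurable (C jk)) ->
  P [set w | forall jk, jk \in F -> C jk (X jk.1 jk.2 w)] =
  \prod_(jk in F) P (X jk.1 jk.2 @^-1` C jk).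
Proof.
by move=> mC; rewrite -indep.
Qed.

Lemma measurable_rectangle_event (F : {set 'I_m * 'I_n})
    (C : 'I_m * 'I_n -> set S) :
  (forall jk, measurable (C jk)) ->
  measurable [set w | forall jk, jk \in F -> C jk (X jk.1 jk.2 w)].
Proof.
move=> mC.
have -> : [set w | forall jk, jk \in F -> C jk (X jk.1 jk.2 w)] =
   \bigcap_(jk in [set` F]) (X jk.1 jk.2 @^-1` C jk).
  by apply/seteqP; split=> w /= H jk; exact: H.
apply: fin_bigcap_measurable; first exact: finite_finset.
by move=> jk _; rewrite -[X in measurable X]setTI; exact: measurable_funPT.
Qed.

(* Both sides integrate [G] against probabilities on the array space, which agree
   on rectangles by independence; [A] and [B] need not be disjoint. *)
Lemma EX_EX A B (G : T -> \bar R) x :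
  measurable_fun setT G -> (forall x, 0 <= G x) ->
  EX A (EX B G) x = EX (A :|: B) G x.
Proof.
move=> mG G0.
pose f1 (z : Omega * Omega) : T := mix B (sample X z.2) (mix A (sample X z.1) x).
pose f2 (w : Omega) : T := mix (A :|: B) (sample X w) x.
have mf1 : measurable_fun setT f1.
  apply: measurable_to_marray => j k; rewrite /f1 /mix.
  case: ((j, k) \in B).
    exact: (measurableT_comp (measurable_funPT (X j k)) measurable_snd).
  case: ((j, k) \in A); last exact: measurable_cst.
  exact: (measurableT_comp (measurable_funPT (X j k)) measurable_fst).
have mf2 : measurable_fun setT f2 by exact: measurable_mix.
pose mu1 := measure_function_pushforward__canonical__measure_function_Measure
  (P \x P) mf1.
pose mu2 := measure_function_pushforward__canonical__measure_function_Measure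
  P mf2.
have mu12 U : measurable U -> mu1 U = mu2 U.
  have mR : @measurable _ T = <<s @rectangles m n _ S >> by [].
  apply: (@measure_unique _ R T (@rectangles m n _ S) (fun=> setT)) => //.
  - move=> _ _ [C mC ->] [C' mC' ->].
    exists (fun jk => C jk `&` C' jk); first by move=> jk; exact: measurableI.
    apply/seteqP; split => y /=; first by move=> [yC yC'] jk; split.
    by move=> yCC'; split=> jk; have [] := yCC' jk.
  - by move=> _; exists (fun=> setT) => //; apply/seteqP; split.
  - by rewrite bigcup_const.
  - move=> _ [C mC ->].
    change ((P \x P) (f1 @^-1` rectangle C) = P (f2 @^-1` rectangle C)).
    (* The cells outside [A :|: B] carry the fixed values of [x]: if one of these violates its
       condition, both preimages are empty. Otherwise only [A :\: B] constrains the first point,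
       since the second one overwrites the cells of [B]. *)
    have [Cx|Cx] := pselect (forall jk, jk \notin A :|: B -> C jk (x jk.1 jk.2)).
      have -> : f1 @^-1` rectangle C =
          [set w | forall jk, jk \in A :\: B -> C jk (X jk.1 jk.2 w)] `*`
          [set w | forall jk, jk \in B -> C jk (X jk.1 jk.2 w)].
        apply/seteqP; split => -[w w'].
          move=> H; split => jk; have := H jk; rewrite /f1 /mix -surjective_pairing.
            by move=> /[swap]; rewrite finset.inE => /andP[/negbTE -> ->].
          by move=> /[swap] ->.
        move=> [H H'] jk; rewrite /f1 /mix -surjective_pairing.
        have [/H'//|jkB] := boolP (jk \in B).
        have [jkA|jkA] := boolP (jk \in A).
          by apply: H; rewrite finset.inE jkA jkB.
        by apply: Cx; rewrite finset.inE negb_or jkA jkB.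
      rewrite product_measure1E; [|exact: measurable_rectangle_event..].
      transitivity ((\prod_(jk in A :\: B) P (X jk.1 jk.2 @^-1` C jk)) *
                    (\prod_(jk in B) P (X jk.1 jk.2 @^-1` C jk))).
        by congr (_ * _); exact: independent_rectangle.
      have -> : f2 @^-1` rectangle C =
          [set w | forall jk, jk \in A :|: B -> C jk (X jk.1 jk.2 w)].
        apply/seteqP; split => w.
          by move=> H jk jkAB; have := H jk; rewrite /f2 /mix -surjective_pairing jkAB.
        move=> H jk; rewrite /f2 /mix -surjective_pairing.
        by case: ifPn => [/H//|/Cx].
      rewrite independent_rectangle // [RHS](big_setID B) /= muleC.
      by congr (_ * _); apply: eq_bigl => jk; rewrite !finset.inE;
        case: (jk \in A); case: (jk \in B).
    have [jk0 /not_implyP[jk0AB jk0C]] := (existsNP _).2 Cx.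
    have [jk0A jk0B] : jk0 \notin A /\ jk0 \notin B.
      by move: jk0AB; rewrite finset.inE negb_or => /andP.
    have -> : f1 @^-1` rectangle C = set0.
      apply/seteqP; split => // -[w w'] /(_ jk0).
      by rewrite /f1 /mix -surjective_pairing (negbTE jk0A) (negbTE jk0B).
    have -> : f2 @^-1` rectangle C = set0.
      apply/seteqP; split => // w /(_ jk0).
      by rewrite /f2 /mix -surjective_pairing (negbTE jk0AB).
    by rewrite !measure0.
  - move=> _; apply: (@le_lt_trans _ _ 1); last by rewrite ltry.
    change ((P \x P) setT <= 1).
    rewrite -setXTT product_measure1E //.
    change (P setT * P setT <= 1).
    by rewrite probability_setT mul1e.
transitivity (\int[mu1]_y G y).
  rewrite (ge0_integral_pushforward mf1) // preimage_setT.
  rewrite fubini_tonelli1 //; first exact: (measurableT_comp mG mf1).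
  by move=> z; exact: G0.
transitivity (\int[mu2]_y G y).
  apply: eq_measure_integral => U mU _; exact: mu12.
by rewrite (ge0_integral_pushforward mf2).
Qed.
End Expectation.

(** The hypotheses of Tonelli's theorem in one predicate, stable under all the operations used
    below; no integrability has to be carried along. *)
Definition nnmeasurable (d : measure_display) (U : measurableType d)
    (R : realType) (f : U -> \bar R) : Prop :=
  measurable_fun setT f /\ forall x, (0 <= f x)%E.

Section NonnegativeMeasurable.
Context (R : realType) (d : measure_display) (U : measurableType d).
Local Open Scope ereal_scope.
Implicit Types f g : U -> \bar R.

Lemma nnmeasurable_cst (c : \bar R) : 0 <= c -> nnmeasurable (fun _ : U => c).
Proof. by move=> c0; split=> //; exact: measurable_cst. Qed.

Lemma nnmeasurableD f g : nnmeasurable f -> nnmeasurable g ->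
  nnmeasurable (fun x => f x + g x).
Proof.
move=> [mf f0] [mg g0]; split=> [|x]; last exact: adde_ge0.
exact: emeasurable_funD.
Qed.

Lemma nnmeasurableM f g : nnmeasurable f -> nnmeasurable g ->
  nnmeasurable (fun x => f x * g x).
Proof.
move=> [mf f0] [mg g0]; split=> [|x]; last exact: mule_ge0.
exact: emeasurable_funM.
Qed.

Lemma nnmeasurable_sum (I : Type) (s : seq I) (Q : pred I) (f : I -> U -> \bar R) :
  (forall i, nnmeasurable (f i)) ->
  nnmeasurable (fun x => \sum_(i <- s | Q i) f i x).
Proof.
move=> nf; elim: s => [|i s IH].
  by under eq_fun do rewrite big_nil; exact: nnmeasurable_cst.
under eq_fun do rewrite big_cons.
by case: (Q i) => //; apply: nnmeasurableD.
Qed.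

Lemma nnmeasurable_poweR f (q : R) : nnmeasurable f ->
  nnmeasurable (fun x => f x `^ q).
Proof.
move=> [mf f0]; split=> [|x]; last exact: poweR_ge0.
exact: (measurableT_comp (measurable_poweR q) mf).
Qed.

Lemma nnmeasurable_bigmaxe (I : Type) (s : seq I) (Q : pred I)
    (f : I -> U -> \bar R) :
  has Q s -> (forall i, nnmeasurable (f i)) ->
  nnmeasurable (fun x => \big[maxe/-oo]_(i <- s | Q i) f i x).
Proof.
move=> Qs nf; split=> [|x].
  elim: s {Qs} => [|i s IH].
    by under eq_fun do rewrite big_nil; exact: measurable_cst.
  under eq_fun do rewrite big_cons.
  by case: (Q i) => //; apply: measurable_maxe => //; exact: (nf i).1.
elim: s Qs => [//|i s IH] /=; rewrite big_cons; case: (Q i) => //= _.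
by rewrite le_max (nf i).2.
Qed.

Lemma nnmeasurable_if (b : U -> bool) f g : measurable_fun setT b ->
  nnmeasurable f -> nnmeasurable g ->
  nnmeasurable (fun x => if b x then f x else g x).
Proof.
move=> mb [mf f0] [mg g0]; split=> [|x]; last by case: (b x).
by apply: measurable_fun_if => //; exact: measurable_funTS.
Qed.

Lemma measurable_fun_forall (I : finType) (Q : pred I) (b : I -> U -> bool) :
  (forall i, measurable_fun setT (b i)) ->
  measurable_fun setT (fun x => [forall i, Q i ==> b i x]).
Proof.
move=> mb.
under eq_fun do rewrite -big_andE.
elim: (index_enum I) => [|a s IH].
  by under eq_fun do rewrite big_nil; exact: measurable_cst.
under eq_fun do rewrite big_cons.
by case: (Q a) => //; exact: measurable_and.
Qed.

End NonnegativeMeasurable.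

(** * Algebra of partial expectations *)

Section ExpectationAlgebra.
Context (R : realType) (m n : nat) (d d' : measure_display)
  (Omega : measurableType d) (P : probability Omega R) (S : measurableType d')
  (X : 'I_m -> 'I_n -> {RV P >-> S}).
Local Open Scope ereal_scope.

Local Notation T := (marray m n S).
Local Notation EX := (expect_cells X).
Implicit Types (A B C : {set 'I_m * 'I_n}) (F G : T -> \bar R) (x y : T).

(** A pointwise notion: [G] does not read the cells of [A]. Probabilistic independence is derived
    from it in [EXM_split]. *)
Definition independent_of A G := forall x y, G (mix A y x) = G x.

Lemma nnmeasurable_EX A G : nnmeasurable G -> nnmeasurable (EX A G).
Proof.
move=> [mG G0]; split; first exact: measurable_EX.
by move=> x; exact: EX_ge0.
Qed.

Lemma nnmeasurable_mix A G x : nnmeasurable G ->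
  nnmeasurable (fun w => G (mix A (sample X w) x)).
Proof. by move=> [mG G0]; split=> //; exact: (measurableT_comp mG (measurable_mix _ _ _)). Qed.

Lemma le_EX A F G x : nnmeasurable F -> nnmeasurable G ->
  (forall y, F y <= G y) -> EX A F x <= EX A G x.
Proof.
move=> /(nnmeasurable_mix A x)[mF F0] /(nnmeasurable_mix A x)[mG G0] FG.
by apply: ge0_le_integral => // w _; exact: FG.
Qed.

Lemma EX_sum A (I : Type) (s : seq I) (Q : pred I) (F : I -> T -> \bar R) x :
  (forall i, nnmeasurable (F i)) ->
  EX A (fun y => \sum_(i <- s | Q i) F i y) x = \sum_(i <- s | Q i) EX A (F i) x.
Proof.
move=> nF; rewrite /expect_cells -[RHS]big_filter -ge0_integral_sum //.
- by apply: eq_integral => w _; rewrite big_filter.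
- by move=> i; have [] := nnmeasurable_mix A x (nF i).
- by move=> i w _; exact: (nF i).2.
Qed.

Lemma EXD A F G x : nnmeasurable F -> nnmeasurable G ->
  EX A (fun y => F y + G y) x = EX A F x + EX A G x.
Proof.
move=> /(nnmeasurable_mix A x)[mF F0] /(nnmeasurable_mix A x)[mG G0].
exact: ge0_integralD.
Qed.

Lemma EXZl A G (c : \bar R) x : nnmeasurable G -> 0 <= c ->
  EX A (fun y => c * G y) x = c * EX A G x.
Proof.
by move=> /(nnmeasurable_mix A x)[mG G0] c0; exact: ge0_integralZl.
Qed.

Lemma EX_cst A (c : \bar R) x : EX A (fun=> c) x = c.
Proof.
transitivity (c * P setT); first exact: integral_cst.
by rewrite probability_setT mule1.
Qed.

Lemma EX_independent A G x : independent_of A G -> EX A G x = G x.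
Proof.
move=> iG; rewrite -[RHS](EX_cst A _ x).
by apply: eq_integral => w _; rewrite iG.
Qed.

Lemma EXMl A F G x : nnmeasurable F -> nnmeasurable G -> independent_of A F ->
  EX A (fun y => F y * G y) x = F x * EX A G x.
Proof.
move=> [_ F0] nG iF; rewrite -EXZl //.
by apply: eq_integral => w _; rewrite iF.
Qed.

Lemma mix_mix A B y z x :
  mix A z (mix B y x) = mix B (mix A z y) (mix A z x).
Proof.
apply/funext => j; apply/funext => k; rewrite /mix.
by case: ((j, k) \in A); case: ((j, k) \in B).
Qed.

Lemma independent_EX A B G : independent_of B G -> independent_of B (EX A G).
Proof.
move=> iG x y; apply: eq_integral => w _.
by rewrite mix_mix iG.
Qed.

Lemma independent_EX_same A G : independent_of A (EX A G).
Proof.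
move=> x y; apply: eq_integral => w _; congr G.
apply/funext => j; apply/funext => k; rewrite /mix.
by case: ((j, k) \in A).
Qed.

Lemma independentS A B G : A \subset B -> independent_of B G ->
  independent_of A G.
Proof.
move=> /fintype.subsetP AB iG x y; rewrite -[RHS](iG _ (mix A y x)); congr G.
apply/funext => j; apply/funext => k; rewrite /mix.
case: ifPn => [/AB ->//|]; by case: ((j, k) \in B).
Qed.

Lemma EX_setT G x : EX [set: _]%SET G x = \int[P]_w G (sample X w).
Proof.
apply: eq_integral => w _; congr G.
by apply/funext => j; apply/funext => k; rewrite /mix finset.inE.
Qed.

Hypothesis indep : mutually_independent P (fun jk : 'I_m * 'I_n => X jk.1 jk.2).

Lemma EX_EXU A B G x : nnmeasurable G -> EX A (EX B G) x = EX (A :|: B) G x.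
Proof. by move=> [mG G0]; exact: EX_EX. Qed.

Lemma EXU_independent A B G x : nnmeasurable G -> independent_of B G ->
  EX (A :|: B) G x = EX A G x.
Proof.
move=> nG iG; rewrite -EX_EXU //; congr (EX A _ x).
by apply/funext => y; exact: EX_independent.
Qed.

(** Integrating first over [C], where [G] is constant, replaces [F] by [EX C F]. This equals
    [EX A F], since [F] does not read the rest of [A], and is constant in the remaining integration
    of [G]. *)
Lemma EXM_split A C F G x : nnmeasurable F -> nnmeasurable G ->
  C \subset A -> independent_of (A :\: C) F -> independent_of C G ->
  EX A (fun y => F y * G y) x = EX A F x * EX A G x.
Proof.
move=> nF nG CA iF iG.
have AC : A :|: C = A by apply/finset.setUidPl.
transitivity (EX A (fun y => EX A F y * G y) x).
  rewrite -{1}AC -EX_EXU; last exact: nnmeasurableM.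
  congr (EX A _ x); apply/funext => y.
  have -> : (fun z => F z * G z) = (fun z => G z * F z).
    by apply/funext => z; rewrite muleC.
  rewrite EXMl // muleC; congr (_ * _).
  rewrite -[in LHS](finset.setIidPr CA) -(@EXU_independent _ (A :\: C)) //.
  by rewrite finset.setID.
rewrite EXMl //; first exact: nnmeasurable_EX.
exact: independent_EX_same.
Qed.

End ExpectationAlgebra.

Arguments nnmeasurable_EX {R m n d d' Omega P S X} A {G}.
Arguments le_EX {R m n d d' Omega P S X} A {F G}.
Arguments EX_sum {R m n d d' Omega P S X} A {I} s Q {F}.
Arguments EXD {R m n d d' Omega P S X} A {F G}.
Arguments EXZl {R m n d d' Omega P S X} A {G}.
Arguments EX_cst {R m n d d' Omega P S X}.
Arguments EX_independent {R m n d d' Omega P S X} A {G}.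
Arguments EXMl {R m n d d' Omega P S X} A {F G}.

(** * One row of independent nonnegative variables *)

Section PowerInequalities.
Context (R : realType).
Implicit Types (a b c q r s D : R).

Lemma le_powR_base a b r : 0 <= r -> 0 <= a -> a <= b -> a `^ r <= b `^ r.
Proof.
move=> r0 a0 ab; apply: ge0_ler_powR => //; rewrite nnegrE //.
exact: le_trans ab.
Qed.

(** The asymmetry is the point: with the threshold [a = q * b], the coefficient of [a] stays bounded
    because [(1 + 1/q)^(q - 1) <= e], and the growth in [q] falls on [b], which will be the single
    summand [xi k]. *)
Lemma powR_split a b q : 1 < q -> 0 <= a -> 0 <= b ->
  (a + b) `^ (q - 1) <=
  expR 1 * a `^ (q - 1) + (1 + q) `^ (q - 1) * b `^ (q - 1).
Proof.
move=> q1 a0 b0; have q0 : 0 < q by exact: lt_trans q1.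
have r0 : 0 <= q - 1 by rewrite subr_ge0 ltW.
have [ba|ab] := leP (q * b) a.
  rewrite -[leLHS]addr0 lerD //; last by rewrite mulr_ge0 ?powR_ge0.
  apply: (@le_trans _ _ (((1 + q^-1) * a) `^ (q - 1))).
    apply: le_powR_base => //; first exact: addr_ge0.
    by rewrite mulrDl mul1r lerD2l mulrC ler_pdivlMr // mulrC.
  rewrite powRM ?addr_ge0 ?invr_ge0 ?(ltW q0) //.
  rewrite ler_wpM2r ?powR_ge0 //.
  apply: (@le_trans _ _ (expR q^-1 `^ (q - 1))).
    apply: le_powR_base => //; last exact: expR_ge1Dx.
    by rewrite addr_ge0 ?invr_ge0 ?ltW.
  rewrite -expRM ler_expR mulrBr mulVf ?gt_eqF // mulr1 gerBl.
  by rewrite invr_ge0 ltW.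
rewrite -[leLHS]add0r lerD //; first by rewrite mulr_ge0 ?powR_ge0 ?expR_ge0.
rewrite -powRM ?addr_ge0 ?(ltW q0) //.
apply: le_powR_base => //; first exact: addr_ge0.
by rewrite mulrDl mul1r addrC lerD2l ltW.
Qed.

(** The coefficient one half allows the term in [s^q] to be absorbed into the left side of a moment
    inequality. *)
Lemma powR_young c s q : 1 < q -> 0 <= c -> 0 <= s ->
  c * s `^ (q - 1) <= 2^-1 * s `^ q + 2^-1 * (2 * c) `^ q.
Proof.
move=> q1 c0 s0; have q0 : 0 < q by exact: lt_trans q1.
have r0 : 0 <= q - 1 by rewrite subr_ge0 ltW.
have [cs|sc] := leP (2 * c) s.
  rewrite -[leLHS]addr0 lerD ?mulr_ge0 ?powR_ge0 //.
  rewrite -(mulr_powRB1 s0 q0) mulrA ler_wpM2r ?powR_ge0 //.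
  by rewrite ler_pdivlMl.
rewrite -[leLHS]add0r lerD ?mulr_ge0 ?powR_ge0 //.
rewrite -(@mulr_powRB1 _ (2 * c)) ?mulr_ge0 // !mulrA mulVf // mul1r.
by rewrite ler_wpM2l // le_powR_base // ltW.
Qed.

(** [D] becomes the free parameter of the conversion of sums into maxima: a loss linear in [D] in
    front of the maximum buys the gain [D^(1 - q)] in front of the means. *)
Lemma powR_young_scaled a b q D : 1 < q -> 0 < D -> 0 <= a -> 0 <= b ->
  a `^ (q - 1) * b <= D * a `^ q + D `^ (1 - q) * b `^ q.
Proof.
move=> q1 D0 a0 b0; have q0 : 0 < q by exact: lt_trans q1.
have r0 : 0 <= q - 1 by rewrite subr_ge0 ltW.
have [ba|ab] := leP b (D * a).
  rewrite -[leLHS]addr0 lerD ?mulr_ge0 ?powR_ge0 //.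
  by rewrite -(mulr_powRB1 a0 q0) mulrC mulrA ler_wpM2r ?powR_ge0.
rewrite -[leLHS]add0r lerD ?mulr_ge0 ?powR_ge0 ?(ltW D0) //.
have -> : D `^ (1 - q) = D^-1 `^ (q - 1).
  by rewrite -(powR_inv1 (ltW D0)) -powRrM mulN1r opprB.
rewrite -(mulr_powRB1 b0 q0) mulrC mulrCA ler_wpM2l //.
rewrite -powRM ?invr_ge0 ?(ltW D0) //.
by apply: le_powR_base => //; rewrite ler_pdivlMl // ltW.
Qed.

Local Open Scope ereal_scope.
Implicit Types (x y z : \bar R).

Lemma ge0_neqNy x : 0 <= x -> x != -oo. Proof. by case: x. Qed.

Lemma le_poweR x y r : (0 <= r)%R -> 0 <= x -> x <= y -> x `^ r <= y `^ r.
Proof.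
move=> r0 x0 xy; apply: gt0_ler_poweR => //; rewrite in_itv /= ?x0 ?leey //.
by rewrite (le_trans x0 xy).
Qed.

Lemma poweRS x q : (1 < q)%R -> 0 <= x -> x `^ q = x * x `^ (q - 1).
Proof.
move=> q1; have q0 : (0 < q)%R by exact: lt_trans q1.
case: x => [a a0| _|//].
  by rewrite !poweR_EFin -EFinM mulr_powRB1.
by rewrite !poweRyr ?gt_eqF ?subr_gt0 // mulyy.
Qed.

Lemma poweR_split x y q : (1 < q)%R -> 0 <= x -> 0 <= y ->
  (x + y) `^ (q - 1) <=
  (expR 1)%:E * x `^ (q - 1) + ((1 + q) `^ (q - 1))%:E * y `^ (q - 1).
Proof.
move=> q1; have q0 : (0 < q)%R by exact: lt_trans q1.
have rn : (q - 1 != 0)%R by rewrite gt_eqF ?subr_gt0.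
have c0 : (0 < (1 + q) `^ (q - 1))%R by rewrite powR_gt0 // addr_gt0.
case: x => [a a0|_ y0|//]; last first.
  rewrite [in leRHS]poweRyr // gt0_muley ?lte_fin ?expR_gt0 //.
  by rewrite [leRHS]addye ?leey // ge0_neqNy // mule_ge0 ?poweR_ge0 // lee_fin ltW.
case: y => [b b0|_|//]; first by rewrite !poweR_EFin -!EFinM -EFinD lee_fin powR_split.
rewrite [in leRHS]poweRyr // gt0_muley ?lte_fin // [leRHS]addey ?leey //.
Qed.

Lemma poweR_young (c : \bar R) x q : (1 < q)%R -> 0 <= c -> 0 <= x ->
  c * x `^ (q - 1) <= 2^-1%:E * x `^ q + 2^-1%:E * (2%:E * c) `^ q.
Proof.
move=> q1; have q0 : (0 < q)%R by exact: lt_trans q1.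
have rn : (q != 0)%R by rewrite gt_eqF.
have nny y : 0 <= y -> 2^-1%:E * y `^ q != -oo.
  by move=> y0; rewrite ge0_neqNy // mule_ge0 ?poweR_ge0.
case: c => [c c0 x0|_ x0|//]; last first.
  by rewrite gt0_muley ?lte_fin // poweRyr // gt0_muley ?lte_fin // [leRHS]addey ?leey ?nny.
case: x x0 => [b b0|_|//].
  by rewrite !poweR_EFin -!EFinM -EFinD lee_fin powR_young.
by rewrite [in leRHS]poweRyr // gt0_muley ?lte_fin // [leRHS]addye ?leey ?nny // mule_ge0.
Qed.

Lemma le_sum_poweR (I : Type) (s : seq I) (Q : pred I) (f : I -> \bar R) q :
  (1 < q)%R -> (forall i, 0 <= f i) ->
  \sum_(i <- s | Q i) f i `^ q <= (\sum_(i <- s | Q i) f i) `^ q.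
Proof.
move=> q1 f0; have q0 : (0 < q)%R by exact: lt_trans q1.
rewrite [leRHS]poweRS ?sume_ge0 //.
rewrite ge0_sume_distrl //; elim: s => [|i s IH]; rewrite ?big_nil //.
rewrite !big_cons; case: (Q i) => //.
have le1 : forall z, 0 <= z -> z `^ (q - 1) <= (f i + z) `^ (q - 1).
  by move=> z z0; apply: le_poweR; rewrite ?subr_ge0 ?(ltW q1) // leeDr.
apply: leeD.
  rewrite poweRS // lee_wpmul2l // le_poweR ?subr_ge0 ?(ltW q1) //.
  by rewrite leeDl // sume_ge0.
apply: (le_trans IH); apply: lee_sum => k _; rewrite lee_wpmul2l // le1 //.
exact: sume_ge0.
Qed.

Lemma poweRMl (c : R) x q : (0 <= c)%R -> 0 <= x ->
  (c%:E * x) `^ q = (c `^ q)%:E * x `^ q.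
Proof. by move=> c0 x0; rewrite poweRM // poweR_EFin. Qed.

End PowerInequalities.

Section OneRow.
Context (R : realType) (m n : nat) (d d' : measure_display)
  (Omega : measurableType d) (P : probability Omega R) (S : measurableType d')
  (X : 'I_m -> 'I_n -> {RV P >-> S}).
Hypothesis indep : mutually_independent P (fun jk : 'I_m * 'I_n => X jk.1 jk.2).
Local Open Scope ereal_scope.

Local Notation T := (marray m n S).
Local Notation EX := (expect_cells X).

Variables (K : finType) (A : {set 'I_m * 'I_n}) (C : K -> {set 'I_m * 'I_n}).
Hypothesis CA : forall k, C k \subset A.
Variable xi : K -> T -> \bar R.
Hypothesis nxi : forall k, nnmeasurable (xi k).
Hypothesis own : forall k, independent_of (A :\: C k) (xi k).
Hypothesis others : forall k l, l != k -> independent_of (C k) (xi l).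
Variables (q : R) (q1 : (1 < q)%R).

Let q0 : (0 < q)%R. Proof. exact: lt_trans q1. Qed.
Let r0 : (0 <= q - 1)%R. Proof. by rewrite subr_ge0 ltW. Qed.

Let nS : nnmeasurable (fun y => \sum_k xi k y).
Proof. exact: nnmeasurable_sum. Qed.

Let nxiq k : nnmeasurable (fun y => xi k y `^ q).
Proof. exact: nnmeasurable_poweR. Qed.

(** Only finiteness matters here, not the constant [#|K|^q]: it permits subtracting half of the
    moment in [EX_sum_poweR_le]. *)
Lemma EX_sum_poweR_lty x : \sum_k EX A (fun y => xi k y `^ q) x < +oo ->
  EX A (fun y => (\sum_k xi k y) `^ q) x < +oo.
Proof.
move=> fin.
pose c := ((#|K|%:R : R) `^ q)%:E.
have c0 : 0 <= c by rewrite lee_fin powR_ge0.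
apply: (@le_lt_trans _ _ (c * \sum_k EX A (fun y => xi k y `^ q) x)); last first.
  by rewrite lte_mul_pinfty // sume_ge0 // => k _; exact: (nnmeasurable_EX A (nxiq k)).2.
rewrite -EX_sum // -EXZl //; last exact: nnmeasurable_sum.
apply: le_EX => [||y].
- exact: nnmeasurable_poweR.
- by apply: nnmeasurableM; [exact: nnmeasurable_cst|exact: nnmeasurable_sum].
(* [t] is the [l^q] norm of the summands, which dominates each of them. *)
- pose t := (\sum_k xi k y `^ q) `^ q^-1.
  have t0 : 0 <= t by exact: poweR_ge0.
  have -> : \sum_k xi k y `^ q = t `^ q.
    rewrite /t -poweRrM mulVf ?gt_eqF // poweRe1 // sume_ge0 // => k _.
    exact: poweR_ge0.
  rewrite /c -poweRMl //; apply: le_poweR; [exact: ltW|exact: nS.2|].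
  have -> : #|K|%:R%:E * t = \sum_(k : K) t.
    rewrite -sum1_card natr_sum -sumEFin ge0_sume_distrl //.
    by apply: eq_bigr => k _; rewrite mul1e.
  apply: lee_sum => k _.
  rewrite -[leLHS]poweRe1 ?(nxi k).2 // -(mulfV (lt0r_neq0 q0)) poweRrM.
  apply: le_poweR; rewrite ?invr_ge0 ?(ltW q0) ?poweR_ge0 //.
  rewrite (bigD1 k) //= leeDl // sume_ge0 // => l _; exact: poweR_ge0.
Qed.

(* With [S = sum_k xi k] and [S_k = S - xi k], expand [S^q = sum_k xi k * S^(q-1)]
   and split [S^(q-1)] between [S_k] and [xi k]; [xi k] is independent of [S_k]. *)
Lemma EX_sum_poweR_le x :
  EX A (fun y => (\sum_k xi k y) `^ q) x <=
  ((2 * expR 1) `^ q)%:E * (\sum_k EX A (xi k) x) `^ q +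
  (2 * (1 + q) `^ (q - 1))%:E * \sum_k EX A (fun y => xi k y `^ q) x.
Proof.
set V := EX A (fun y => (\sum_k xi k y) `^ q) x.
set M := \sum_k EX A (xi k) x.
set B := \sum_k EX A (fun y => xi k y `^ q) x.
pose e2 := ((1 + q) `^ (q - 1))%R.
have e20 : (0 < e2)%R by rewrite powR_gt0 // addr_gt0.
have M0 : 0 <= M by rewrite sume_ge0 // => k _; exact: (nnmeasurable_EX A (nxi k)).2.
have B0 : 0 <= B by rewrite sume_ge0 // => k _; exact: (nnmeasurable_EX A (nxiq k)).2.
have [Boo|Bfin] := eqVneq B +oo.
  rewrite Boo gt0_muley ?lte_fin ?mulr_gt0 //.
  by rewrite [leRHS]addey ?leey // ge0_neqNy // mule_ge0 ?lee_fin ?powR_ge0 ?poweR_ge0.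
have V0 : 0 <= V by apply: EX_ge0 => y; exact: poweR_ge0.
have Vfin : V \is a fin_num.
  by rewrite ge0_fin_numE // EX_sum_poweR_lty // ltey.
pose Sk k y := \sum_(l | l != k) xi l y.
have nSk k : nnmeasurable (fun y => Sk k y `^ (q - 1)).
  by apply: nnmeasurable_poweR; exact: nnmeasurable_sum.
have nSr : nnmeasurable (fun y => (\sum_k xi k y) `^ (q - 1)).
  exact: nnmeasurable_poweR.
have step1 : V <= (expR 1)%:E * (M * EX A (fun y => (\sum_k xi k y) `^ (q - 1)) x)
                  + e2%:E * B.
  apply: (@le_trans _ _ (EX A (fun y => \sum_k ((expR 1)%:E * (xi k y * Sk k y `^ (q - 1)) +
      e2%:E * xi k y `^ q)) x)).
    apply: le_EX => [||y].
    - exact: nnmeasurable_poweR.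
    - apply: nnmeasurable_sum => k; apply: nnmeasurableD.
        apply: nnmeasurableM; first by apply: nnmeasurable_cst; rewrite lee_fin expR_ge0.
        exact: nnmeasurableM.
      by apply: nnmeasurableM => //; apply: nnmeasurable_cst; rewrite lee_fin ltW.
    - rewrite poweRS ?nS.2 // ge0_sume_distrl; last by move=> k _; exact: (nxi k).2.
      apply: lee_sum => k _; rewrite {1}(bigD1 k) //= addeC.
      apply: (@le_trans _ _ (xi k y * ((expR 1)%:E * Sk k y `^ (q - 1) +
                                      e2%:E * xi k y `^ (q - 1)))).
        rewrite lee_wpmul2l ?(nxi k).2 // poweR_split ?(nxi k).2 //.
        by rewrite sume_ge0 // => l _; exact: (nxi l).2.
      rewrite ge0_muleDr ?mule_ge0 ?poweR_ge0 ?lee_fin ?expR_ge0 ?(ltW e20) //.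
      by rewrite (poweRS q1 ((nxi k).2 y)) !(muleCA (xi k y)).
  rewrite EX_sum; last first.
    move=> k; apply: nnmeasurableD.
      apply: nnmeasurableM; first by apply: nnmeasurable_cst; rewrite lee_fin expR_ge0.
      exact: nnmeasurableM.
    by apply: nnmeasurableM => //; apply: nnmeasurable_cst; rewrite lee_fin ltW.
  have -> : (expR 1)%:E * (M * EX A (fun y => (\sum_k xi k y) `^ (q - 1)) x) + e2%:E * B =
    \sum_k ((expR 1)%:E * (EX A (xi k) x * EX A (fun y => (\sum_k xi k y) `^ (q - 1)) x) +
       e2%:E * EX A (fun y => xi k y `^ q) x).
    rewrite big_split /= -!ge0_sume_distrr.
    - by rewrite ge0_sume_distrl // => k _; exact: (nnmeasurable_EX A (nxi k)).2.
    - by move=> k _; exact: (nnmeasurable_EX A (nxiq k)).2.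
    - move=> k _; rewrite mule_ge0 //; first exact: (nnmeasurable_EX A (nxi k)).2.
      exact: (nnmeasurable_EX A nSr).2.
  apply: lee_sum => k _; rewrite EXD; first last.
  - by apply: nnmeasurableM => //; apply: nnmeasurable_cst; rewrite lee_fin ltW.
  - apply: nnmeasurableM; first by apply: nnmeasurable_cst; rewrite lee_fin expR_ge0.
    exact: nnmeasurableM.
  rewrite !EXZl ?lee_fin ?expR_ge0 ?(ltW e20) //; last exact: nnmeasurableM.
  rewrite leeD2r // lee_wpmul2l ?lee_fin ?expR_ge0 //.
  rewrite (@EXM_split _ _ _ _ _ _ _ _ X indep A (C k)) //.
    rewrite lee_wpmul2l ?(nnmeasurable_EX A (nxi k)).2 //.
    apply: le_EX => // y; apply: le_poweR => //.
      by rewrite sume_ge0 // => l _; exact: (nxi l).2.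
    rewrite [leRHS](bigD1 k) //= leeDr //; exact: (nxi k).2.
  move=> y z; congr (_ `^ _); apply: eq_bigr => l lk; exact: others.
(* Young's inequality under the expectation, with the number [e * M] as coefficient. It leaves half
   of [V], which is finite and is moved to the left at the end; this doubles the other two
   constants. *)
have step2 : (expR 1)%:E * (M * EX A (fun y => (\sum_k xi k y) `^ (q - 1)) x) <=
    2^-1%:E * V + 2^-1%:E * (2%:E * ((expR 1)%:E * M)) `^ q.
  have c0 : 0 <= (expR 1)%:E * M by rewrite mule_ge0 // lee_fin expR_ge0.
  rewrite muleA -EXZl //.
  rewrite -[X in 2^-1%:E * V + X](@EX_cst _ _ _ _ _ _ _ _ X A _ x).
  rewrite -EXZl; last 2 first.
  - exact: nnmeasurable_poweR.
  - by [].
  rewrite -EXD.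
  - apply: le_EX => [||y].
    + by apply: nnmeasurableM => //; exact: nnmeasurable_cst.
    + apply: nnmeasurableD.
        apply: nnmeasurableM; first exact: nnmeasurable_cst.
        exact: nnmeasurable_poweR.
      by apply: nnmeasurable_cst; rewrite mule_ge0 ?poweR_ge0.
    + by apply: poweR_young => //; exact: nS.2.
  - by apply: nnmeasurableM; [exact: nnmeasurable_cst|exact: nnmeasurable_poweR].
  - by apply: nnmeasurable_cst; rewrite mule_ge0 ?poweR_ge0.
have step3 : V <= 2^-1%:E * V + (2^-1%:E * (2%:E * ((expR 1)%:E * M)) `^ q + e2%:E * B).
  by rewrite addeA; apply: (le_trans step1); rewrite leeD2r.
have -> : ((2 * expR 1) `^ q)%:E * M `^ q + (2 * e2)%:E * B =
   2%:E * (2^-1%:E * (2%:E * ((expR 1)%:E * M)) `^ q + e2%:E * B).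
  rewrite ge0_muleDr ?mule_ge0 ?poweR_ge0 ?lee_fin ?(ltW e20) //.
  by rewrite !muleA -!EFinM mulfV // mul1e poweRMl // mulr_ge0 ?expR_ge0.
move: step3; rewrite -(fineK Vfin).
set U := (_ + e2%:E * B).
case: U => [u|_|].
- rewrite -!EFinM -EFinD !lee_fin; lra.
- by rewrite gt0_muley ?lte_fin // leey.
- by rewrite addeNy leeNy_eq.
Qed.

End OneRow.

(** * From sums of moments to the moment of the maximum *)

Section SumToMax.
Context (R : realType) (m n : nat) (d d' : measure_display)
  (Omega : measurableType d) (P : probability Omega R) (S : measurableType d')
  (X : 'I_m -> 'I_n -> {RV P >-> S}).
Hypothesis indep : mutually_independent P (fun jk : 'I_m * 'I_n => X jk.1 jk.2).
Local Open Scope ereal_scope.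

Local Notation T := (marray m n S).
Local Notation EX := (expect_cells X).

Variables (K : finType) (A : {set 'I_m * 'I_n}) (C : K -> {set 'I_m * 'I_n}).
Hypothesis CA : forall k, C k \subset A.
Variable xi : K -> T -> \bar R.
Hypothesis nxi : forall k, nnmeasurable (xi k).
Hypothesis own : forall k, independent_of (A :\: C k) (xi k).
Hypothesis others : forall k l, l != k -> independent_of (C k) (xi l).
Variables (q : R) (q1 : (1 < q)%R).

Let q0 : (0 < q)%R. Proof. exact: lt_trans q1. Qed.
Let r0 : (0 <= q - 1)%R. Proof. by rewrite subr_ge0 ltW. Qed.

Let Mx y := \big[maxe/-oo]_k xi k y.

Let nxiq k : nnmeasurable (fun y => xi k y `^ q).
Proof. exact: nnmeasurable_poweR. Qed.

(* With [de^q = 2 E max xi^q], with probability at least 1/2 no [xi l] exceeds [de];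
   by independence the part of [sum_k E xi_k^q] above [de] is then at most twice the
   part where [xi k] alone exceeds [de], that is at most [2 E max xi^q]. *)
Lemma le_EX_sum_max (k0 : K) (D : R) x : (0 < D)%R ->
  \sum_k EX A (fun y => xi k y `^ q) x <=
  (2 + 2 * D)%:E * EX A (fun y => (\big[maxe/-oo]_k xi k y) `^ q) x +
  (D `^ (1 - q))%:E * (\sum_k EX A (xi k) x) `^ q.
Proof.
move=> D0; rewrite -/(Mx _).
have nM : nnmeasurable Mx.
  by apply: nnmeasurable_bigmaxe => //; apply/hasP; exists k0; rewrite ?mem_index_enum.
have nMq : nnmeasurable (fun y => Mx y `^ q) by exact: nnmeasurable_poweR.
have xiM k y : xi k y <= Mx y by exact: le_bigmax.
have B0 k : 0 <= EX A (xi k) x by exact: (nnmeasurable_EX A (nxi k)).2.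
have D20 : (0 < 2 + 2 * D)%R by rewrite addr_gt0 ?mulr_gt0.
set B := \sum_k EX A (xi k) x.
have BB : 0 <= B by exact: sume_ge0.
have tail0 : 0 <= (D `^ (1 - q))%:E * B `^ q by rewrite mule_ge0 ?poweR_ge0 ?lee_fin ?powR_ge0.
have le_l k : EX A (fun y => xi k y `^ q) x <= EX A (fun y => Mx y `^ q) x.
  by apply: le_EX => // y; apply: le_poweR (xiM k y); [exact: ltW|exact: (nxi k).2].
have : 0 <= EX A (fun y => Mx y `^ q) x by exact: (nnmeasurable_EX A nMq).2.
move El : (EX A (fun y => Mx y `^ q) x) le_l => L le_l L0.
case: L L0 => [l l0|_|//] in El le_l *; last first.
  by rewrite gt0_muley ?lte_fin // [leRHS]addye ?leey // ge0_neqNy.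
have [l0'|lpos] := leP l 0%R.
  rewrite big1 => [|k _]; first by rewrite adde_ge0 // mule_ge0 // lee_fin ltW.
  apply/eqP; rewrite eq_le (nnmeasurable_EX A (nxiq k)).2 andbT.
  by apply: (le_trans (le_l k)); rewrite lee_fin.
pose de := ((2 * l) `^ q^-1)%R.
have de0 : (0 < de)%R by rewrite powR_gt0 // mulr_gt0.
have deq : (de `^ q = 2 * l)%R.
  by rewrite /de -powRrM mulVf ?gt_eqF // powRr1 // mulr_ge0.
pose f k y := if de%:E < xi k y then xi k y `^ q else 0.
pose g k y := if [forall l, (l != k) ==> ~~ (de%:E < xi l y)] then 1 else 0 : \bar R.
have mlt k : measurable_fun setT (fun y => de%:E < xi k y).
  by apply: measurable_fun_lte => //; exact: (nxi k).1.
have nf k : nnmeasurable (f k) by apply: nnmeasurable_if => //; exact: nnmeasurable_cst.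
have ng k : nnmeasurable (g k).
  apply: nnmeasurable_if; [|exact: nnmeasurable_cst..].
  by apply: measurable_fun_forall => a; exact: measurable_neg.
have half k : 2^-1%:E <= EX A (g k) x.
  have : EX A (fun=> 1) x <= EX A (g k) x + ((de `^ q)^-1)%:E * l%:E.
    rewrite -El -EXZl //; last by rewrite lee_fin invr_ge0 powR_ge0.
    have nZ : nnmeasurable (fun y => ((de `^ q)^-1)%:E * Mx y `^ q).
      by apply: nnmeasurableM => //; apply: nnmeasurable_cst; rewrite lee_fin invr_ge0 powR_ge0.
    rewrite -EXD //; apply: le_EX => [||y].
    - exact: nnmeasurable_cst.
    - exact: nnmeasurableD.
    - rewrite /g; case: ifPn => [_|].
        by rewrite leeDl // nZ.2.
      rewrite negb_forall => /existsP[a]; rewrite negb_imply negbK => /andP[_ da].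
      rewrite add0e.
      apply: (@le_trans _ _ (((de `^ q)^-1)%:E * de%:E `^ q)).
        by rewrite poweR_EFin -EFinM mulVf // gt_eqF // powR_gt0.
      rewrite lee_wpmul2l ?lee_fin ?invr_ge0 ?powR_ge0 //.
      apply: le_poweR; rewrite ?(ltW q0) ?lee_fin ?(ltW de0) //.
      exact: (le_trans (ltW da) (xiM a y)).
  rewrite EX_cst deq -EFinM invfM -mulrA mulVf ?gt_eqF // mulr1.
  have := (nnmeasurable_EX (X := X) A (ng k)).2 x.
  case: (EX A (g k) x) => [u _|_ _|//]; last by rewrite leey.
  by rewrite -EFinD !lee_fin => ?; lra.
have ff k : EX A (f k) x <= 2%:E * EX A (fun y => f k y * g k y) x.
  rewrite (@EXM_split _ _ _ _ _ _ _ _ X indep A (C k)) //.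
  - have f0 : 0 <= EX A (f k) x by exact: (nnmeasurable_EX A (nf k)).2.
    rewrite muleCA; apply: (@le_trans _ _ (EX A (f k) x * 1)); first by rewrite mule1.
    rewrite lee_wpmul2l //; apply: (@le_trans _ _ (2%:E * 2^-1%:E)).
      by rewrite -EFinM mulfV.
    by rewrite lee_wpmul2l.
  - by move=> y z; rewrite /f own.
  - move=> y z; rewrite /g; congr (if _ then _ else _); apply: eq_forallb => a.
    by case: eqVneq => //= ak; rewrite others.
have disj y : \sum_k f k y * g k y <= Mx y `^ q.
  have [[k fk]|no] := pselect (exists k, de%:E < xi k y).
    rewrite (bigD1 k) //= big1 => [|a ak].
      rewrite adde0 /f fk; apply: (@le_trans _ _ (xi k y `^ q * 1)).
        by rewrite lee_wpmul2l ?poweR_ge0 // /g; case: ifP.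
      by rewrite mule1 le_poweR ?(ltW q0) ?(nxi k).2.
    rewrite /g; case: ifPn => [/forallP /(_ k)|_]; last by rewrite mule0.
    by rewrite eq_sym ak /= fk.
  rewrite big1 ?poweR_ge0 // => k _; rewrite /f; case: ifPn => [fk|_]; last by rewrite mul0e.
  by case: no; exists k.
have sumf : \sum_k EX A (f k) x <= (2 * l)%:E.
  apply: (@le_trans _ _ (\sum_k 2%:E * EX A (fun y => f k y * g k y) x)).
    by apply: lee_sum => k _; exact: ff.
  have nfg k : nnmeasurable (fun y => f k y * g k y) by exact: nnmeasurableM.
  rewrite -ge0_sume_distrr; last by move=> k _; exact: (nnmeasurable_EX A (nfg k)).2.
  rewrite EFinM lee_wpmul2l // -El -EX_sum //.
  by apply: le_EX => //; exact: nnmeasurable_sum.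
(* Where [xi k <= de], one has [xi k ^ q <= de^(q - 1) * xi k]. The resulting [de^(q - 1) * B] is
   split by Young's inequality with parameter [D]; since [de^q = 2 l], this adds [2 D] to the [2]
   coming from the part above [de]. *)
have low : \sum_k EX A (fun y => xi k y `^ q) x <=
    \sum_k EX A (f k) x + (de `^ (q - 1))%:E * B.
  rewrite ge0_sume_distrr // -big_split /=; apply: lee_sum => k _.
  have nz : nnmeasurable (fun y => (de `^ (q - 1))%:E * xi k y).
    by apply: nnmeasurableM => //; apply: nnmeasurable_cst; rewrite lee_fin powR_ge0.
  rewrite -EXZl ?lee_fin ?powR_ge0 // -EXD //.
  apply: le_EX => [//||y]; first exact: nnmeasurableD.
  rewrite /f; case: ifPn => [_|].
    by rewrite leeDl // nz.2.
  rewrite -leNgt add0e => xd.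
  rewrite poweRS ?(nxi k).2 // muleC lee_wpmul2r ?(nxi k).2 //.
  by rewrite -poweR_EFin le_poweR ?(nxi k).2.
apply: (le_trans low).
case: B BB {tail0 low} => [b b0|_|//]; last first.
  rewrite poweRyr ?gt_eqF // [X in _ <= _ + X]gt0_muley ?lte_fin ?powR_gt0 //.
  by rewrite [leRHS]addey ?leey.
case: (\sum_k EX A (f k) x) sumf => [u|//|_].
  rewrite poweR_EFin -!EFinM -!EFinD !lee_fin => ul.
  have := powR_young_scaled q1 D0 (ltW de0) b0; rewrite deq; lra.
by rewrite addNye leNye.
Qed.

End SumToMax.

(** * Several rows: sums, maxima and expectations over blocks of indices *)

Section Indices.
Context (m n : nat).
Implicit Types (i k l : mindex m n) (j : 'I_m) (c : 'I_n) (A B : {set 'I_m}).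

Definition update i j c : mindex m n := [ffun l => if l == j then c else i l].

Definition merge A k i : mindex m n := [ffun j => if j \in A then k j else i j].

Lemma agree_offP A i k :
  reflect (forall j, j \notin A -> k j = i j) (agree_off A i k).
Proof.
apply: (iffP forallP) => H j; last by apply/implyP => jA; rewrite H.
by move=> jA; apply/eqP; move: (H j); rewrite jA.
Qed.

Lemma agree_off_refl A i : agree_off A i i.
Proof. exact/agree_offP. Qed.

Lemma agree_off0 i k : agree_off finset.set0 i k = (k == i).
Proof.
apply/agree_offP/eqP => [H|-> //].
by apply/ffunP => j; rewrite H // finset.inE.
Qed.

Lemma big_agree_offU (U : Type) (idx : U) (op : Monoid.com_law idx) A B i
    (a : mindex m n -> U) :
  {in A, forall j, j \notin B} ->
  \big[op/idx]_(k | agree_off (A :|: B) i k) a k =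
  \big[op/idx]_(l | agree_off A i l) \big[op/idx]_(k | agree_off B l k) a k.
Proof.
move=> AB.
rewrite (partition_big (fun k => merge A k i) (agree_off A i)) /=; last first.
  by move=> k _; apply/agree_offP => j jA; rewrite ffunE (negbTE jA).
apply: eq_bigr => l /agree_offP li; apply: eq_bigl => k.
apply/andP/agree_offP => [[/agree_offP H /eqP <-] j jB|H].
  by rewrite ffunE; case: ifPn => // jA; rewrite H // finset.inE negb_or jA.
split.
  by apply/agree_offP => j; rewrite finset.inE negb_or => /andP[/li <- /H].
apply/eqP/ffunP => j; rewrite ffunE; case: ifPn => [jA|/li //].
by rewrite H // AB.
Qed.

Lemma big_agree_off1 (U : Type) (idx : U) (op : Monoid.com_law idx) j i
    (a : mindex m n -> U) :
  \big[op/idx]_(k | agree_off [set j]%SET i k) a k =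
  \big[op/idx]_c a (update i j c).
Proof.
rewrite (reindex_onto (update i j) (fun k => k j)) /=; last first.
  move=> k /agree_offP H; apply/ffunP => l; rewrite ffunE.
  by case: eqVneq => [-> //|lj]; rewrite H // finset.inE.
apply: eq_bigl => c; rewrite ffunE !eqxx andbT.
by apply/agree_offP => l; rewrite finset.inE ffunE => /negbTE ->.
Qed.

End Indices.

Section Families.
Context (R : realType) (m n : nat) (d d' : measure_display)
  (Omega : measurableType d) (P : probability Omega R) (S : measurableType d')
  (X : 'I_m -> 'I_n -> {RV P >-> S}).
Local Open Scope ereal_scope.

Local Notation T := (marray m n S).
Local Notation EX := (expect_cells X).
Local Notation family := (mindex m n -> T -> \bar R).
Implicit Types (F G : family) (A B J : {set 'I_m}) (i k l : mindex m n) (x : T)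
  (q : R).

(** The operators keep both the multi-index and the array as arguments, even where the result no
    longer depends on some of them, so that sums, maxima and expectations over different rows
    compose in any order. *)
Definition fsum A F : family := fun i x => sum_on A (fun k => F k x) i.
Definition fmax A F : family := fun i x => max_on A (fun k => F k x) i.
Definition fexp A F : family := fun i => EX (rows n A) (F i).
Definition fpow q F : family := fun i x => F i x `^ q.

Definition nnfamily F := forall i, nnmeasurable (F i).
(** This makes the functions [F (update i j c)], for varying [c], independent variables once the
    other rows are fixed: each of them reads a different cell of row [j]. *)
Definition local_in j F :=
  forall i, independent_of (rows n [set j] :\ (j, i j)) (F i).

Lemma nnfamily_fsum A F : nnfamily F -> nnfamily (fsum A F).
Proof. by move=> gF i; exact: nnmeasurable_sum. Qed.

Lemma nnfamily_fmax A F : nnfamily F -> nnfamily (fmax A F).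
Proof.
move=> gF i; apply: nnmeasurable_bigmaxe => //.
by apply/hasP; exists i; rewrite ?mem_index_enum // agree_off_refl.
Qed.

Lemma nnfamily_fexp A F : nnfamily F -> nnfamily (fexp A F).
Proof. by move=> gF i; exact: nnmeasurable_EX. Qed.

Lemma nnfamily_fpow q F : nnfamily F -> nnfamily (fpow q F).
Proof. by move=> gF i; exact: nnmeasurable_poweR. Qed.

Lemma nnfamily_ge0 F i x : nnfamily F -> 0 <= F i x.
Proof. by move=> gF; exact: (gF i).2. Qed.

Lemma local_fsum j A F : j \notin A -> local_in j F -> local_in j (fsum A F).
Proof.
move=> jA lF i x y; apply: eq_bigr => k /agree_offP ki.
by have := lF k; rewrite ki // => ->.
Qed.

Lemma local_fmax j A F : j \notin A -> local_in j F -> local_in j (fmax A F).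
Proof.
move=> jA lF i x y; apply: eq_bigr => k /agree_offP ki.
by have := lF k; rewrite ki // => ->.
Qed.

Lemma local_fexp j A F : local_in j F -> local_in j (fexp A F).
Proof. by move=> lF i; apply: independent_EX; exact: lF. Qed.

Lemma fsumU A B F : {in A, forall j, j \notin B} -> fsum (A :|: B) F = fsum A (fsum B F).
Proof.
move=> AB; apply/funext => i; apply/funext => x.
by rewrite /fsum /sum_on big_agree_offU.
Qed.

Lemma fmaxU A B F : {in A, forall j, j \notin B} -> fmax (A :|: B) F = fmax A (fmax B F).
Proof.
move=> AB; apply/funext => i; apply/funext => x.
by rewrite /fmax /max_on big_agree_offU.
Qed.

Lemma fsum0 F : fsum finset.set0 F = F.
Proof.
apply/funext => i; apply/funext => x; rewrite /fsum /sum_on.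
by under eq_bigl do rewrite agree_off0; rewrite big_pred1_eq.
Qed.

Lemma fmax0 F : fmax finset.set0 F = F.
Proof.
apply/funext => i; apply/funext => x; rewrite /fmax /max_on.
by under eq_bigl do rewrite agree_off0; rewrite big_pred1_eq.
Qed.

Lemma fsum1 j F i x : fsum [set j] F i x = \sum_c F (update i j c) x.
Proof. exact: big_agree_off1. Qed.

Lemma fmax1 j F i x : fmax [set j] F i x = \big[maxe/-oo]_c F (update i j c) x.
Proof. by rewrite /fmax /max_on big_agree_off1. Qed.

Lemma fexp_fsum A B F : nnfamily F -> fexp A (fsum B F) = fsum B (fexp A F).
Proof.
move=> gF; apply/funext => i; apply/funext => x.
by rewrite /fexp /fsum /sum_on EX_sum.
Qed.

Lemma le_fsum A F G i x : (forall k, F k x <= G k x) ->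
  fsum A F i x <= fsum A G i x.
Proof. by move=> FG; apply: lee_sum => k _; exact: FG. Qed.

Lemma le_fexp A F G i x : nnfamily F -> nnfamily G -> (forall y, F i y <= G i y) ->
  fexp A F i x <= fexp A G i x.
Proof. by move=> gF gG FG; exact: le_EX. Qed.

Lemma le_fpow q F G i x : (0 <= q)%R -> nnfamily F -> F i x <= G i x ->
  fpow q F i x <= fpow q G i x.
Proof. by move=> q0 gF FG; apply: le_poweR => //; exact: nnfamily_ge0. Qed.

Lemma fmax_le_fsum A F i x : nnfamily F -> fmax A F i x <= fsum A F i x.
Proof.
move=> gF; apply: bigmax_le; first by rewrite leNye.
move=> k ki; rewrite /fsum /sum_on (bigD1 k) //= leeDl // sume_ge0 // => l _.
exact: nnfamily_ge0.
Qed.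

Lemma fsum_fpow_le A q F i x : (1 < q)%R -> nnfamily F ->
  fsum A (fpow q F) i x <= fpow q (fsum A F) i x.
Proof. by move=> q1 gF; apply: le_sum_poweR => // k; exact: nnfamily_ge0. Qed.

Lemma fpow_fmax_le A q F i x : (0 < q)%R -> nnfamily F ->
  fpow q (fmax A F) i x <= fmax A (fpow q F) i x.
Proof.
move=> q0 gF; have gM := nnfamily_fmax A (nnfamily_fpow q gF).
rewrite -[leRHS]poweRe1 ?nnfamily_ge0 // -(mulVf (lt0r_neq0 q0)) poweRrM.
apply: le_poweR; [exact: ltW|exact: (nnfamily_ge0 _ _ (nnfamily_fmax A gF))|].
apply: bigmax_le; first by rewrite leNye.
move=> k ki; rewrite -[leLHS]poweRe1 ?nnfamily_ge0 // -(mulfV (lt0r_neq0 q0)) poweRrM.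
apply: le_poweR; rewrite ?invr_ge0 ?(ltW q0) ?poweR_ge0 //.
exact: (@le_bigmax_cond _ _ _ _ _ _ (fun k => F k x `^ q)).
Qed.

Hypothesis indep : mutually_independent P (fun jk : 'I_m * 'I_n => X jk.1 jk.2).

Lemma rowsU A B : rows n (A :|: B) = rows n A :|: rows n B.
Proof. by apply/setP => jk; rewrite !finset.inE. Qed.

Lemma fexp_fexp A B F : nnfamily F -> fexp A (fexp B F) = fexp (A :|: B) F.
Proof.
move=> gF; apply/funext => i; apply/funext => x.
by rewrite /fexp rowsU -EX_EXU.
Qed.

Lemma fexp_sumR A F G (c : R) i x : nnfamily F -> nnfamily G -> (0 <= c)%R ->
  fexp A (fun i x => F i x + c%:E * G i x) i x =
  fexp A F i x + c%:E * fexp A G i x.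
Proof.
move=> gF gG c0; rewrite /fexp EXD ?EXZl //.
by apply: nnmeasurableM => //; exact: nnmeasurable_cst.
Qed.

Lemma fsum_sumR A F G (c : R) i x : nnfamily G ->
  fsum A (fun i x => F i x + c%:E * G i x) i x =
  fsum A F i x + c%:E * fsum A G i x.
Proof.
move=> gG; rewrite /fsum /sum_on big_split /= ge0_sume_distrr // => k _.
exact: nnfamily_ge0.
Qed.

Section OneRowFamily.
Variables (j : 'I_m) (q : R) (G : family).
Hypotheses (q1 : (1 < q)%R) (gG : nnfamily G) (lG : local_in j G).

Let C (c : 'I_n) : {set 'I_m * 'I_n} := [set (j, c)]%SET.

Let CA c : C c \subset rows n [set j].
Proof. by rewrite finset.sub1set !finset.inE. Qed.

Let own i c : independent_of (rows n [set j] :\: C c) (G (update i j c)).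
Proof. by have := lG (update i j c); rewrite ffunE eqxx. Qed.

Let others i c c' : c' != c -> independent_of (C c) (G (update i j c')).
Proof.
move=> cc'; apply: independentS (own i c').
by rewrite finset.sub1set !finset.inE /= eqxx xpair_eqE eqxx /= eq_sym cc'.
Qed.

Lemma fexp_fpow_fsum1_le i x :
  fexp [set j] (fpow q (fsum [set j] G)) i x <=
  ((2 * expR 1) `^ q)%:E * fpow q (fsum [set j] (fexp [set j] G)) i x +
  (2 * (1 + q) `^ (q - 1))%:E * fsum [set j] (fexp [set j] (fpow q G)) i x.
Proof.
have := @EX_sum_poweR_le _ _ _ _ _ _ _ _ X indep 'I_n _ C CA
  (fun c => G (update i j c)) (fun c => gG _) (own i) (@others i) q q1 x.
rewrite [X in _ -> X <= _](_ : _ =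
    EX (rows n [set j]) (fun y => (\sum_c G (update i j c) y) `^ q) x).
  by rewrite /fpow !fsum1.
by congr (EX _ _ x); apply/funext => y; rewrite -fsum1.
Qed.

Lemma fsum1_fexp_fpow_le (D : R) i x : (0 < D)%R ->
  fsum [set j] (fexp [set j] (fpow q G)) i x <=
  (2 + 2 * D)%:E * fexp [set j] (fpow q (fmax [set j] G)) i x +
  (D `^ (1 - q))%:E * fpow q (fsum [set j] (fexp [set j] G)) i x.
Proof.
move=> D0.
have := @le_EX_sum_max _ _ _ _ _ _ _ _ X indep 'I_n _ C CA
  (fun c => G (update i j c)) (fun c => gG _) (own i) (@others i) q q1 (i j) D x D0.
rewrite [X in _ -> _ <= _ * X + _](_ : _ = EX (rows n [set j])
    (fun y => (\big[maxe/-oo]_c G (update i j c) y) `^ q) x).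
  by rewrite /fpow !fsum1.
by congr (EX _ _ x); apply/funext => y; rewrite -fmax1.
Qed.

End OneRowFamily.
End Families.

(** * Recursions for moments with sums, maxima and expectations in different rows *)

Section MixedMoments.
Context (R : realType) (m n : nat) (d d' : measure_display)
  (Omega : measurableType d) (P : probability Omega R) (S : measurableType d')
  (X : 'I_m -> 'I_n -> {RV P >-> S}).
Hypothesis indep : mutually_independent P (fun jk : 'I_m * 'I_n => X jk.1 jk.2).
Local Open Scope ereal_scope.

Local Notation T := (marray m n S).
Local Notation family := (mindex m n -> T -> \bar R).
Local Notation fE := (fexp X).
Implicit Types (A B I J : {set 'I_m}) (j : 'I_m).

Variables (q : R) (f : family).
Hypotheses (q1 : (1 < q)%R) (gf : nnfamily f) (lf : forall j, local_in j f).

Let q0 : (0 < q)%R. Proof. exact: lt_trans q1. Qed.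

Definition marginal J : family := fsum (~: J)%SET (fE (~: J)%SET f).

(* [sum_{i_A} E_{A u B} (sum_{i_{A^c}} E_{(A u B)^c} f)^q]: increasing [B] by one
   row and then moving that row into [A] interpolates between [(sum E f)^q] and
   the sums over [i_J]. *)
Definition sum_moment A B : family :=
  fsum A (fE (A :|: B) (fpow q (fsum (~: A)%SET (fE (~: (A :|: B))%SET f)))).

(* For [J = A u B], the rows of [B] have been converted from sums to maxima. *)
Definition max_moment J A B : family :=
  fsum A (fE J (fpow q (fmax B (marginal J)))).

Lemma nnfamily_marginal J : nnfamily (marginal J).
Proof. exact/nnfamily_fsum/nnfamily_fexp. Qed.

Lemma local_marginal j J : j \in J -> local_in j (marginal J).
Proof.
by move=> jJ; apply: local_fsum; [rewrite finset.inE jJ|exact: local_fexp].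
Qed.

Lemma nnfamily_sum_moment A B : nnfamily (sum_moment A B).
Proof. exact/nnfamily_fsum/nnfamily_fexp/nnfamily_fpow/nnfamily_fsum/nnfamily_fexp. Qed.

Let e1 := ((2 * expR 1) `^ q)%R.
Let e2 := (2 * (1 + q) `^ (q - 1))%R.

Let e10 : (0 <= e1)%R. Proof. exact: powR_ge0. Qed.
Let e20 : (0 <= e2)%R. Proof. by rewrite mulr_ge0 ?powR_ge0. Qed.

(** The one-row inequality in row [j]. Its first term has [E_j] inside the power, so [j] leaves the
    outer expectation; its second term has the sum over [i_j] outside the power, so [j] joins
    [A]. *)
Lemma sum_momentU A B j i x : j \notin A -> j \notin B ->
  {in A, forall j, j \notin B} ->
  sum_moment A (j |: B) i x <=
  e1%:E * sum_moment A B i x + e2%:E * sum_moment (j |: A) B i x.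
Proof.
move=> jA jB AB; rewrite /sum_moment.
pose D := A :|: B.
have jD : j \notin D by rewrite finset.inE negb_or jA.
have -> : A :|: (j |: B) = j |: D by rewrite finset.setUCA.
have -> : (j |: A) :|: B = j |: D by rewrite finset.setUA.
rewrite -/D.
pose H := fE (~: (j |: D))%SET f.
have gH : nnfamily H by exact: nnfamily_fexp.
pose G := fsum (~: (j |: A))%SET H.
have gG : nnfamily G by exact: nnfamily_fsum.
have lG : local_in j G.
  apply: local_fsum; last exact: local_fexp.
  by rewrite !finset.inE eqxx.
have cA : (~: A)%SET = [set j]%SET :|: (~: (j |: A))%SET.
  by apply/setP => k; rewrite !finset.inE; case: eqVneq => [->|] //=; rewrite jA.
have dj : {in [set j]%SET, forall k, k \notin (~: (j |: A))%SET}.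
  by move=> k; rewrite !finset.inE => /eqP ->; rewrite eqxx.
have dD : D :|: [set j]%SET = j |: D by rewrite finset.setUC.
have -> : fsum (~: A)%SET H = fsum [set j] G by rewrite cA fsumU.
have gP : nnfamily (fpow q (fsum [set j] G)) by exact/nnfamily_fpow/nnfamily_fsum.
rewrite -dD -fexp_fexp //.
have gL1 : nnfamily (fpow q (fsum [set j] (fE [set j] G))) by exact/nnfamily_fpow/nnfamily_fsum/nnfamily_fexp.
have gL2 : nnfamily (fsum [set j] (fE [set j] (fpow q G))) by exact/nnfamily_fsum/nnfamily_fexp/nnfamily_fpow.
apply: (@le_trans _ _ (fsum A (fE D (fun i x =>
   e1%:E * fpow q (fsum [set j] (fE [set j] G)) i x +
   e2%:E * fsum [set j] (fE [set j] (fpow q G)) i x)) i x)).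
  apply: le_fsum => k; apply: le_fexp => [|k'|y].
  - exact: nnfamily_fexp.
  - apply: nnmeasurableD; apply: nnmeasurableM => //; exact: nnmeasurable_cst.
  - exact: fexp_fpow_fsum1_le.
have gc (c : R) F : (0 <= c)%R -> nnfamily F -> nnfamily (fun i x => c%:E * F i x).
  by move=> c0 gF k; apply: nnmeasurableM => //; exact: nnmeasurable_cst.
have -> : fE D (fun i x =>
   e1%:E * fpow q (fsum [set j] (fE [set j] G)) i x +
   e2%:E * fsum [set j] (fE [set j] (fpow q G)) i x) =
   (fun i x => e1%:E * fE D (fpow q (fsum [set j] (fE [set j] G))) i x +
   e2%:E * fE D (fsum [set j] (fE [set j] (fpow q G))) i x).
  apply/funext => k; apply/funext => y; rewrite fexp_sumR //; last exact: gc.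
  congr (_ + _); exact: EXZl.
rewrite fsum_sumR; last exact: nnfamily_fexp.
have -> : fsum A (fun i x => e1%:E * fE D (fpow q (fsum [set j] (fE [set j] G))) i x) i x =
   e1%:E * fsum A (fE D (fpow q (fsum [set j] (fE [set j] G)))) i x.
  by rewrite /fsum /sum_on ge0_sume_distrr // => k _; exact/nnfamily_ge0/nnfamily_fexp.
have -> : fsum [set j] (fE [set j] G) = fsum (~: A)%SET (fE (~: D)%SET f).
  rewrite fexp_fsum // /H fexp_fexp // -fsumU // -cA.
  rewrite (_ : (_ :|: ~: (j |: D))%SET = (~: D)%SET) //.
  by apply/setP => k; rewrite !finset.inE; case: eqVneq => [->|] //=; rewrite (negbTE jA) (negbTE jB).
have -> : fE D (fsum [set j] (fE [set j] (fpow q G))) =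
    fsum [set j] (fE (D :|: [set j]) (fpow q G)).
  rewrite fexp_fsum; last exact/nnfamily_fexp/nnfamily_fpow.
  rewrite fexp_fexp //; exact: nnfamily_fpow.
rewrite -fsumU; last by move=> k kA; rewrite finset.inE; apply: contraNneq jA => <-.
by rewrite [A :|: _]finset.setUC /G /H dD.
Qed.

(** Moving a row into [A] costs at most [C * q^q], and the weight [q^(#|A| q)] pays for [q^q]. The
    factor [2 ^ #|B|] accounts for the subsets [I] of rows at which the recursion can end. *)
Lemma sum_moment_bound A B (C : R) (N : \bar R) i x :
  (1 <= C)%R -> (e1 <= C)%R -> (e2 <= C * q `^ q)%R ->
  {in A, forall j, j \notin B} -> 0 <= N ->
  (forall I, I \subset B ->
    (q `^ (#|A :|: I|%:R * q))%:E * sum_moment (A :|: I) finset.set0 i x <= N) ->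
  (q `^ (#|A|%:R * q))%:E * sum_moment A B i x <= ((2 * C) ^+ #|B|)%:E * N.
Proof.
move=> C1 e1C e2C; move: {2}#|B| (erefl #|B|) => b.
elim: b A B => [|b IH] A B cB AB N0 H.
  move/eqP: cB; rewrite cards_eq0 => /eqP B0; rewrite {B}B0 in AB H *.
  rewrite cards0 expr0 mul1e.
  by have := H finset.set0 (finset.sub0set _); rewrite finset.setU0.
have /set0Pn[j jB] : B != finset.set0 by rewrite -cards_eq0 cB.
have jA : j \notin A by apply/negP => /AB; rewrite jB.
have cB' : #|B :\ j| = b by move: cB; rewrite (cardsD1 j) jB => -[].
have := @sum_momentU A (B :\ j) j i x jA _ _; rewrite finset.setD1K //.
have AB' : {in A, forall k, k \notin B :\ j}.
  by move=> k kA; rewrite finset.inE (negbTE (AB k kA)) andbF.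
move=> /(_ _ AB'); rewrite !finset.inE eqxx /= => /(_ isT) step.
set N' := ((2 * C) ^+ b)%:E * N.
have N'0 : 0 <= N' by rewrite mule_ge0 // lee_fin exprn_ge0 // mulr_ge0 // (le_trans _ C1).
have h1 : (q `^ (#|A|%:R * q))%:E * sum_moment A (B :\ j) i x <= N'.
  rewrite /N' -cB'; apply: IH => // I IB; apply: H.
  exact: (fintype.subset_trans IB (finset.subD1set _ _)).
have h2 : (q `^ (#|j |: A|%:R * q))%:E * sum_moment (j |: A) (B :\ j) i x <= N'.
  rewrite /N' -cB'; apply: IH => //.
    by move=> k; rewrite !finset.inE => /orP[/eqP ->|/AB kB]; rewrite ?eqxx ?(negbTE kB) ?andbF.
  move=> I IB; have -> : (j |: A) :|: I = A :|: (j |: I) by rewrite -finset.setUA finset.setUCA.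
  apply: H; apply/fintype.subsetP => k; rewrite !finset.inE => /orP[/eqP ->//|/(fintype.subsetP IB)].
  by rewrite finset.inE => /andP[].
have C0 : (0 <= C)%R by exact: le_trans C1.
move: h2.
have a0 : (0 <= q `^ (#|A|%:R * q))%R by exact: powR_ge0.
have -> : (#|j |: A|%:R * q = #|A|%:R * q + q :> R)%R.
  by rewrite cardsU1 jA add1n -natr1 mulrDl mul1r.
rewrite powRD ?(gt_eqF q0) ?implybT // => h2.
apply: (@le_trans _ _ (C%:E * N' + C%:E * N')); last first.
  rewrite cB exprS -ge0_muleDl ?lee_fin // -EFinD /N' muleA -EFinM.
  by rewrite (_ : (C + C) = 2 * C)%R //; ring.
apply: (@le_trans _ _ ((q `^ (#|A|%:R * q))%:E *
   (e1%:E * sum_moment A (B :\ j) i x + e2%:E * sum_moment (j |: A) (B :\ j) i x))).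
  by rewrite lee_wpmul2l ?lee_fin.
have := nnfamily_ge0 i x (nnfamily_sum_moment A (B :\ j)).
have := nnfamily_ge0 i x (nnfamily_sum_moment (j |: A) (B :\ j)).
move: h1 h2; move: (sum_moment (j |: A) (B :\ j) i x) => v.
move: (sum_moment A (B :\ j) i x) => u h1 h2 v0 u0.
move: e1C e2C a0 h1 h2 e10 e20; move: (q `^ (_ * q))%R (q `^ q)%R e1 e2 => a a' a1 a2.
move=> e1C e2C a0 h1 h2 a10 a20.
rewrite ge0_muleDr ?mule_ge0 ?lee_fin //; apply: leeD.
  by rewrite muleCA; apply: lee_pmul; rewrite ?mule_ge0 ?lee_fin.
apply: (@le_trans _ _ (C%:E * ((a * a')%:E * v))); last by rewrite lee_wpmul2l ?lee_fin.
rewrite !muleA -!EFinM lee_wpmul2r // lee_fin.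
by rewrite mulrCA ler_wpM2l // mulrC.
Qed.

(** The conversion of row [j] produces the first term. In the error term the maxima over [B] are
    bounded by sums and the sum over [i_A] is taken inside the power; what remains is the moment of
    the complete sum with row [j] averaged, a quantity over the smaller set [J :\ j]. *)
Lemma max_momentU J A B j (D : R) i x : (0 < D)%R ->
  j \in J -> J = (j |: A) :|: B -> j \notin A -> j \notin B ->
  {in A, forall j, j \notin B} ->
  max_moment J (j |: A) B i x <=
  (2 + 2 * D)%:E * max_moment J A (j |: B) i x +
  (D `^ (1 - q))%:E * sum_moment finset.set0 (J :\ j) i x.
Proof.
move=> D0 jJ JE jA jB AB; rewrite /max_moment.
set g := marginal J.
have gg : nnfamily g by exact: nnfamily_marginal.
have gM : nnfamily (fmax B g) by exact: nnfamily_fmax.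
have lM : local_in j (fmax B g) by apply: local_fmax => //; exact: local_marginal.
pose L := J :\ j.
have LE : L :|: [set j] = J by rewrite finset.setUC finset.setD1K.
have Ajd : {in A, forall k, k \notin [set j]%SET}.
  by move=> k kA; rewrite finset.inE; apply: contraNneq jA => <-.
have gP : nnfamily (fpow q (fmax B g)) by exact: nnfamily_fpow.
have gPE : nnfamily (fE [set j] (fpow q (fmax B g))) by exact: nnfamily_fexp.
rewrite (finset.setUC [set j]%SET A) fsumU // -[in leLHS]LE -fexp_fexp //.
rewrite -fexp_fsum //.
have g1 : nnfamily (fE [set j] (fpow q (fmax [set j] (fmax B g)))).
  exact/nnfamily_fexp/nnfamily_fpow/nnfamily_fmax.
have g2 : nnfamily (fpow q (fsum [set j] (fE [set j] (fmax B g)))).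
  exact/nnfamily_fpow/nnfamily_fsum/nnfamily_fexp.
apply: (@le_trans _ _ (fsum A (fE L (fun i x =>
   (2 + 2 * D)%:E * fE [set j] (fpow q (fmax [set j] (fmax B g))) i x +
   (D `^ (1 - q))%:E * fpow q (fsum [set j] (fE [set j] (fmax B g))) i x)) i x)).
  apply: le_fsum => k; apply: le_fexp => [|k'|y].
  - exact/nnfamily_fsum.
  - apply: nnmeasurableD; apply: nnmeasurableM => //; apply: nnmeasurable_cst.
      by rewrite lee_fin addr_ge0 // mulr_ge0 // ltW.
    by rewrite lee_fin powR_ge0.
  - exact: fsum1_fexp_fpow_le.
have D20 : (0 <= 2 + 2 * D)%R by rewrite addr_ge0 // mulr_ge0 // ltW.
have gc (c : R) F : (0 <= c)%R -> nnfamily F -> nnfamily (fun i x => c%:E * F i x).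
  by move=> c0 gF k; apply: nnmeasurableM => //; exact: nnmeasurable_cst.
have -> : fE L (fun i x =>
   (2 + 2 * D)%:E * fE [set j] (fpow q (fmax [set j] (fmax B g))) i x +
   (D `^ (1 - q))%:E * fpow q (fsum [set j] (fE [set j] (fmax B g))) i x) =
   (fun i x => (2 + 2 * D)%:E * fE L (fE [set j] (fpow q (fmax [set j] (fmax B g)))) i x +
   (D `^ (1 - q))%:E * fE L (fpow q (fsum [set j] (fE [set j] (fmax B g)))) i x).
  apply/funext => k; apply/funext => y; rewrite fexp_sumR ?powR_ge0 //; last exact: gc.
  congr (_ + _); exact: EXZl.
rewrite fsum_sumR; last exact: nnfamily_fexp.
have -> : fsum A (fun i x => (2 + 2 * D)%:E *
     fE L (fE [set j] (fpow q (fmax [set j] (fmax B g)))) i x) i x =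
   (2 + 2 * D)%:E * fsum A (fE L (fE [set j] (fpow q (fmax [set j] (fmax B g))))) i x.
  by rewrite /fsum /sum_on ge0_sume_distrr // => k _; exact/nnfamily_ge0/nnfamily_fexp.
have jBd : {in [set j]%SET, forall k, k \notin B} by move=> k; rewrite finset.inE => /eqP ->.
have -> : fE L (fE [set j] (fpow q (fmax [set j] (fmax B g)))) =
   fE J (fpow q (fmax (j |: B) g)).
  by rewrite -fmaxU // fexp_fexp ?LE //; exact/nnfamily_fpow/nnfamily_fmax.
apply: leeD; first exact: lexx.
apply: lee_wpmul2l; first by rewrite lee_fin powR_ge0.
rewrite /sum_moment fsum0 finset.set0U -/L.
have gj : nnfamily (fE [set j] g) by exact: nnfamily_fexp.
apply: (@le_trans _ _ (fsum A (fE L (fpow q (fsum (j |: B) (fE [set j] g)))) i x)).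
  apply: le_fsum => k; apply: le_fexp => //; first exact/nnfamily_fpow/nnfamily_fsum.
  move=> y; apply: le_fpow => //; [exact: ltW|exact/nnfamily_fsum/nnfamily_fexp|].
  rewrite fsumU //; apply: le_fsum => l.
  rewrite -fexp_fsum //; apply: le_fexp => //; first exact: nnfamily_fsum.
  by move=> z; exact: fmax_le_fsum.
rewrite -fexp_fsum; last exact/nnfamily_fpow/nnfamily_fsum.
apply: le_fexp => [||y]; [exact/nnfamily_fsum/nnfamily_fpow/nnfamily_fsum|exact/nnfamily_fpow/nnfamily_fsum/nnfamily_fexp|].
apply: (le_trans (fsum_fpow_le _ _ _ q1 _)); first exact: nnfamily_fsum.
rewrite -fsumU; last first.
  by move=> k kA; rewrite !finset.inE negb_or AB // andbT; apply: contraNneq jA => <-.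
rewrite /g /marginal fexp_fsum; last exact: nnfamily_fexp.
rewrite fexp_fexp // -fsumU; last first.
  by move=> k; rewrite !finset.inE JE !finset.inE negbK orbCA orbA.
rewrite (_ : (_ :|: _ :|: _)%SET = (~: finset.set0)%SET); last first.
  by apply/setP => k; rewrite !finset.inE JE !finset.inE;
    case: (k == j); case: (k \in A); case: (k \in B).
rewrite (_ : (_ :|: _)%SET = (~: L)%SET) //.
by apply/setP => k; rewrite !finset.inE; case: eqVneq => [->|].
Qed.

End MixedMoments.

(** * Constants for the nonnegative moments *)

Section PowerConstants.
Context (R : realType).
Implicit Types (a b q : R).

Lemma powR_exprn a q (k : nat) : 0 <= a -> (a `^ q) ^+ k = (a ^+ k) `^ q.
Proof.
by move=> a0; rewrite -powR_mulrn ?powR_ge0 // powRAC powR_mulrn.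
Qed.

(** This turns polynomial factors in [q] into [q]-th powers of constants. *)
Lemma le_powR_expR1 q : q <= expR 1 `^ q.
Proof.
rewrite -expRM mul1r; apply: le_trans (expR_ge1Dx q); by rewrite lerDr.
Qed.

Lemma expR1_ge2 : 2 <= expR 1 :> R.
Proof. by rewrite (le_trans _ (expR_ge1Dx 1)). Qed.

Definition row_const : R := 4 * expR 1.

(** Its [q]-th power bounds the factor [L] of one induction step in [level_bound], where
    [D = q^m <= (e^m)^q]: the first factor is for [2 (2 + 2 D) <= 8 D], the second for
    [1 + D (2 C)^m], which is at most twice its last summand. *)
Definition level_const (m : nat) : R :=
  (8 * expR 1 ^+ m) ^+ m * (2 * expR 1 ^+ m * (2 * row_const) ^+ m).

(** The first factor comes from the recursion over all [m] rows, the second from the [m + 1]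
    possible sizes of [J] in [level_bound]. *)
Definition nonneg_const (m : nat) : R :=
  (2 * row_const) ^+ m * level_const m ^+ m.+1.

Lemma row_const_ge1 : 1 <= row_const.
Proof. have := expR1_ge2; rewrite /row_const; lra. Qed.

Lemma level_const_ge1 m : 1 <= level_const m.
Proof.
have e1 : 1 <= expR 1 :> R by apply: le_trans expR1_ge2; lra.
have em : 1 <= expR 1 ^+ m :> R by exact: exprn_ege1.
have r1 := row_const_ge1.
rewrite /level_const !mulr_ege1 ?exprn_ege1 ?mulr_ege1 //; lra.
Qed.

Lemma nonneg_const_ge1 m : 1 <= nonneg_const m.
Proof.
have r1 := row_const_ge1.
rewrite /nonneg_const mulr_ege1 ?exprn_ege1 ?level_const_ge1 // mulr_ege1 //; lra.
Qed.

Lemma le1_powR a q : 1 <= a -> 0 <= q -> 1 <= a `^ q.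
Proof. by move=> a1 q0; rewrite -(powRr0 a) ler_powR. Qed.

Lemma row_const_ge q : 1 < q ->
  [/\ 1 <= row_const `^ q, (2 * expR 1) `^ q <= row_const `^ q &
      2 * (1 + q) `^ (q - 1) <= row_const `^ q * q `^ q].
Proof.
move=> q1; have q0 : 0 < q by exact: lt_trans q1.
have e2 := expR1_ge2; split.
- by rewrite le1_powR ?row_const_ge1 // ltW.
- apply: le_powR_base; rewrite ?(ltW q0) ?mulr_ge0 ?expR_ge0 // /row_const; lra.
- rewrite -powRM ?(ltW q0) ?mulr_ge0 ?expR_ge0 //.
  apply: (@le_trans _ _ (2 `^ q * (1 + q) `^ q)).
    apply: ler_pM; rewrite ?powR_ge0 //.
      by apply: le1r_powR; [lra|exact: ltW].
    by apply: ler_powR; lra.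
  rewrite -powRM //; last by lra.
  apply: le_powR_base; rewrite ?(ltW q0) //; first by lra.
  rewrite /row_const; nra.
Qed.

End PowerConstants.

Section NonnegativeMoments.
Context (R : realType) (m n : nat) (d d' : measure_display)
  (Omega : measurableType d) (P : probability Omega R) (S : measurableType d')
  (X : 'I_m -> 'I_n -> {RV P >-> S}).
Hypothesis indep : mutually_independent P (fun jk : 'I_m * 'I_n => X jk.1 jk.2).
Local Open Scope ereal_scope.

Local Notation T := (marray m n S).
Local Notation family := (mindex m n -> T -> \bar R).
Local Notation fE := (fexp X).
Implicit Types (A B I J : {set 'I_m}) (j : 'I_m).

Variables (q : R) (f : family).
Hypotheses (q1 : (1 < q)%R) (gf : nnfamily f) (lf : forall j, local_in j f).

Let q0 : (0 < q)%R. Proof. exact: lt_trans q1. Qed.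

Local Notation mrg := (marginal X f).
Local Notation smom := (sum_moment X q f).
Local Notation mmom := (max_moment X q f).

(** The rows of [A] are converted one at a time. Each conversion multiplies the bound by [2 + 2 D],
    and adding the error term, at most [N], at most doubles the result. *)
Lemma max_moment_bound J A B (D : R) (N : \bar R) i x :
  (0 < D)%R -> 0 <= N -> J = A :|: B -> {in A, forall j, j \notin B} ->
  mmom J finset.set0 J i x <= N ->
  (forall j, j \in J ->
    (D `^ (1 - q))%:E * smom finset.set0 (J :\ j) i x <= N) ->
  mmom J A B i x <= ((2 * (2 + 2 * D)) ^+ #|A|)%:E * N.
Proof.
move=> D0 N0 JE AB HR HW; move: {2}#|A| (erefl #|A|) => a.
elim: a A B JE AB => [|a IH] A B JE AB cA.
  move/eqP: cA; rewrite cards_eq0 => /eqP A0; rewrite {A}A0 in JE AB *.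
  by rewrite cards0 expr0 mul1e -[B in X in X <= _]finset.set0U -JE.
have /set0Pn[j jA] : A != finset.set0 by rewrite -cards_eq0 cA.
have cA' : #|A :\ j| = a by move: cA; rewrite (cardsD1 j) jA => -[].
have jJ : j \in J by rewrite JE finset.inE jA.
have jA' : j \notin A :\ j by rewrite !finset.inE eqxx.
have AB' : {in A :\ j, forall k, k \notin B}.
  by move=> k; rewrite !finset.inE => /andP[_ /AB].
have := @max_momentU _ _ _ _ _ _ _ _ X indep q f q1 gf lf J (A :\ j) B j D i x D0 jJ.
rewrite finset.setD1K // => /(_ JE jA' (AB j jA) AB') step.
set N' := ((2 * (2 + 2 * D)) ^+ a)%:E * N.
have c1 : (1 <= 2 + 2 * D)%R by rewrite -[leLHS]addr0 lerD ?mulr_ge0 ?(ltW D0) // ler1n.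
have NN' : N <= (2 + 2 * D)%:E * N'.
  rewrite /N' muleA -EFinM -[leLHS]mul1e lee_wpmul2r // lee_fin mulr_ege1 //.
  by rewrite exprn_ege1 // mulr_ege1 // ler1n.
apply: (le_trans step).
apply: (@le_trans _ _ ((2 + 2 * D)%:E * N' + (2 + 2 * D)%:E * N')).
  apply: leeD; last exact: (le_trans (HW j jJ) NN').
  rewrite lee_wpmul2l ?lee_fin ?(le_trans _ c1) // /N' -cA'.
  apply: IH => // [|k].
    rewrite JE; apply/setP => k; rewrite !finset.inE.
    by case: eqVneq => [->|]; rewrite ?jA ?orbT.
  rewrite !finset.inE => /andP[kj kA].
  by rewrite negb_or kj AB.
rewrite cA exprS /N' muleA -EFinM -ge0_muleDl; last 2 first.
- by rewrite lee_fin mulr_ge0 ?exprn_ge0 ?mulr_ge0 ?(le_trans _ c1).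
- by rewrite lee_fin mulr_ge0 ?exprn_ge0 ?mulr_ge0 ?(le_trans _ c1).
rewrite -EFinD; have -> // : forall u v : R, (u * v + u * v = 2 * u * v)%R.
by move=> u v; ring.
Qed.

Let D := (q `^ m%:R)%R.
Let c1 := (2 * (2 + 2 * D))%R.
Let C := (row_const R `^ q)%R.
Let L := (c1 ^+ m * (1 + D * (2 * C) ^+ m))%R.

Lemma sum_moment_self J i x :
  smom J finset.set0 i x = mmom J J finset.set0 i x.
Proof.
by rewrite /sum_moment /max_moment finset.setU0 fmax0.
Qed.

(* Induction on [#|J|]: the error terms of the conversion are moments over [J :\ j],
   and the factor [D^(1-q) = q^m q^(-mq)] absorbs [q^(#|J| q)]. *)
Lemma level_bound s J (N : \bar R) i x : 0 <= N ->
  (forall I, (q `^ (#|I|%:R * q))%:E * mmom I finset.set0 I i x <= N) ->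
  (#|J| < s)%N ->
  (q `^ (#|J|%:R * q))%:E * smom J finset.set0 i x <= (L ^+ s)%:E * N.
Proof.
move=> N0 HN; have [C1 e1C e2C] := row_const_ge q1.
have D1 : (1 <= D)%R by rewrite le1_powR // ltW.
have D0 : (0 < D)%R by exact: lt_le_trans D1.
have C0 : (0 <= C)%R by exact: powR_ge0.
have c11 : (1 <= c1)%R by rewrite /c1; lra.
have cm1 : (1 <= (2 * C) ^+ m)%R by rewrite exprn_ege1 // mulr_ege1 // ler1n.
have F1 : (1 <= 1 + D * (2 * C) ^+ m)%R by rewrite lerDl mulr_ge0 ?(ltW D0) // (le_trans _ cm1).
have L1 : (1 <= L)%R by rewrite mulr_ege1 // exprn_ege1.
elim: s J => [//|s IH] J; rewrite ltnS => Js.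
rewrite sum_moment_self.
pose Q := (q `^ (#|J|%:R * q))%R.
have Q0 : (0 < Q)%R by rewrite powR_gt0.
(* A common bound for the main term and for all error terms of the conversion, stated without the
   weight [Q], which is multiplied back afterwards. *)
pose N1 := (Q^-1 * ((1 + D * (2 * C) ^+ m) * L ^+ s))%:E * N.
have Ls : (1 <= L ^+ s)%R by exact: exprn_ege1.
have N10 : 0 <= N1.
  by rewrite mule_ge0 // lee_fin !mulr_ge0 ?invr_ge0 ?(ltW Q0) ?(le_trans _ F1) ?(le_trans _ Ls).
apply: (@le_trans _ _ (Q%:E * ((c1 ^+ #|J|)%:E * N1))).
  rewrite lee_wpmul2l ?lee_fin ?(ltW Q0) //.
  apply: max_moment_bound; rewrite ?finset.setU0 //.
  - by move=> j; rewrite finset.inE.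
  - have := HN J; rewrite -/Q => HJ.
    have := @lee_wpmul2l _ Q^-1%:E _ _ _ HJ; rewrite lee_fin invr_ge0 (ltW Q0) => /(_ isT).
    rewrite muleA -EFinM mulVf ?gt_eqF // mul1e => /le_trans; apply.
    rewrite /N1 lee_wpmul2r // lee_fin ler_peMr ?invr_ge0 ?(ltW Q0) //.
    by rewrite mulr_ege1.
  - move=> j jJ.
    have W : smom finset.set0 (J :\ j) i x <= ((2 * C) ^+ #|J :\ j|)%:E * ((L ^+ s)%:E * N).
      have := @sum_moment_bound _ _ _ _ _ _ _ _ X indep q f q1 gf lf finset.set0
        (J :\ j) C ((L ^+ s)%:E * N) i x C1 e1C e2C.
      rewrite cards0 mul0r powRr0 mul1e; apply.
      + by move=> k; rewrite finset.inE.
      + by rewrite mule_ge0 // lee_fin (le_trans _ Ls).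
      + move=> I IJ; rewrite finset.set0U; apply: IH.
        apply: leq_trans Js; rewrite (cardsD1 j J) jJ add1n ltnS.
        exact: subset_leq_card.
    apply: (@le_trans _ _ ((D `^ (1 - q))%:E * (((2 * C) ^+ m)%:E * ((L ^+ s)%:E * N)))).
      rewrite lee_wpmul2l ?lee_fin ?powR_ge0 //; apply: (le_trans W).
      rewrite lee_wpmul2r ?mule_ge0 ?lee_fin ?(le_trans _ Ls) //.
      rewrite ler_weXn2l //; first by rewrite mulr_ege1 // ler1n.
      by rewrite -[X in (_ <= X)%N](card_ord m) max_card.
    rewrite !muleA -!EFinM /N1 lee_wpmul2r // lee_fin -!mulrA.
    have -> : (D `^ (1 - q) = D * (q `^ (m%:R * q))^-1)%R.
      rewrite powRB; last by rewrite (gt_eqF D0) implybT.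
      by rewrite (powRr1 (ltW D0)) -powRrM.
    have M0 : (0 <= (2 * C) ^+ m)%R by rewrite (le_trans _ cm1).
    have Ls0 : (0 <= L ^+ s)%R by rewrite (le_trans _ Ls).
    rewrite -mulrA [leLHS]mulrCA; apply: ler_pM.
    + by rewrite invr_ge0 powR_ge0.
    + by rewrite !mulr_ge0 // ltW.
    + rewrite lef_pV2 ?posrE ?powR_gt0 // ler_powR ?(ltW q1) //.
      rewrite ler_wpM2r ?(ltW q0) // ler_nat.
      by rewrite -[X in (_ <= X)%N](card_ord m) max_card.
    + by rewrite mulrA ler_wpM2r // lerDr.
rewrite /N1 !muleA -!EFinM lee_wpmul2r // lee_fin.
rewrite mulrACA mulfV ?gt_eqF // mul1r exprS mulrA.
rewrite ler_wpM2r ?(le_trans _ Ls) // /L ler_wpM2r ?(le_trans _ F1) //.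
rewrite ler_weXn2l //.
by rewrite -[X in (_ <= X)%N](card_ord m) max_card.
Qed.

Lemma nonneg_moment_bound (N : \bar R) i x : 0 <= N ->
  (forall J, (q `^ (#|J|%:R * q))%:E *
    fE J (fmax J (fpow q (mrg J))) i x <= N) ->
  fE [set: _]%SET (fpow q (fsum [set: _]%SET f)) i x <=
  (nonneg_const R m `^ q)%:E * N.
Proof.
move=> N0 HN; have [C1 e1C e2C] := row_const_ge q1.
(* The mixed terms contain the maximum of the powers, [max_moment] the power of the maximum. *)
have HN' I : (q `^ (#|I|%:R * q))%:E * mmom I finset.set0 I i x <= N.
  apply: le_trans (HN I); rewrite lee_wpmul2l ?lee_fin ?powR_ge0 //.
  rewrite /max_moment fsum0.
  have gm : nnfamily (mrg I) by exact: nnfamily_marginal.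
  apply: le_fexp => [||y]; first exact/nnfamily_fpow/nnfamily_fmax.
    exact/nnfamily_fmax/nnfamily_fpow.
  exact: fpow_fmax_le.
have := @sum_moment_bound _ _ _ _ _ _ _ _ X indep q f q1 gf lf finset.set0
  [set: _]%SET C ((L ^+ m.+1)%:E * N) i x C1 e1C e2C.
rewrite cards0 mul0r powRr0 mul1e cardsT card_ord.
have e1 : (1 <= expR 1 :> R)%R by apply: le_trans (expR1_ge2 R); rewrite ler1n.
have D0 : (0 <= D)%R by exact: powR_ge0.
have C0 : (0 <= C)%R by exact: powR_ge0.
have L0 : (0 <= L)%R.
  rewrite /L mulr_ge0 ?exprn_ge0 //; first by rewrite /c1; lra.
  by rewrite addr_ge0 // mulr_ge0 // exprn_ge0 // mulr_ge0.
have r0 : (0 <= row_const R)%R by rewrite (le_trans _ (row_const_ge1 R)).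
have em0 : (0 <= expR 1 ^+ m :> R)%R by rewrite exprn_ge0 ?expR_ge0.
have C2 : (2 * C <= (2 * row_const R) `^ q)%R.
  by rewrite powRM // ler_wpM2r // le1r_powR ?ler1n // ltW.
have DE : (D <= (expR 1 ^+ m) `^ q)%R.
  rewrite /D powR_mulrn ?(ltW q0) // -powR_exprn ?expR_ge0 //.
  by rewrite lerXn2r ?nnegrE ?(ltW q0) ?powR_ge0 // le_powR_expR1.
have D1 : (1 <= D)%R by rewrite le1_powR // ltW.
have LL : (L <= level_const R m `^ q)%R.
  rewrite /level_const powRM ?exprn_ge0 ?mulr_ge0 ?exprn_ge0 ?mulr_ge0 //.
  rewrite -powR_exprn ?mulr_ge0 // ler_pM ?exprn_ge0 //.
  - by rewrite /c1; lra.
  - by rewrite addr_ge0 ?mulr_ge0 ?exprn_ge0 ?mulr_ge0.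
  - rewrite lerXn2r ?nnegrE ?powR_ge0 //; first by rewrite /c1; lra.
    rewrite powRM //; apply: (@le_trans _ _ (8 * D)%R); first by rewrite /c1; lra.
    by rewrite ler_pM // le1r_powR ?ler1n // ltW.
  - have H1 : (D * (2 * C) ^+ m <= (expR 1 ^+ m) `^ q * ((2 * row_const R) ^+ m) `^ q)%R.
      rewrite -[(((2 * row_const R) ^+ m) `^ q)%R]powR_exprn ?mulr_ge0 //.
      by rewrite ler_pM ?exprn_ge0 ?mulr_ge0 // lerXn2r ?nnegrE ?powR_ge0 ?mulr_ge0.
    have H2 : (1 <= D * (2 * C) ^+ m)%R.
      by rewrite mulr_ege1 // exprn_ege1 // mulr_ege1 // ler1n.
    have H3 : (2 <= 2 `^ q :> R)%R by rewrite le1r_powR ?ler1n // ltW.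
    rewrite !powRM ?exprn_ge0 ?mulr_ge0 //.
    rewrite -mulrA; apply: (@le_trans _ _ (2 * (D * (2 * C) ^+ m))%R); first by lra.
    by rewrite ler_pM ?(le_trans _ H2).
move=> H; apply: (@le_trans _ _ (((2 * C) ^+ m)%:E * ((L ^+ m.+1)%:E * N))).
  (* With [A] empty and [B] the set of all rows, no sum stands outside the power and no expectation
     inside it. *)
  have -> : fE [set: _]%SET (fpow q (fsum [set: _]%SET f)) i x =
     smom finset.set0 [set: _]%SET i x.
    rewrite /sum_moment fsum0 finset.set0U finset.setC0 finset.setCT.
    congr (fE _ (fpow q (fsum _ _)) i x).
    apply/funext => k; apply/funext => y; rewrite /fexp EX_independent //.
    by move=> z w; congr (f k _); apply/funext => a; apply/funext => b;
      rewrite /mix !finset.inE.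
  apply: H.
  - by move=> k; rewrite finset.inE.
  - by rewrite mule_ge0 // lee_fin exprn_ge0.
  - move=> I _; rewrite finset.set0U; apply: level_bound => //.
    by rewrite ltnS -[X in (_ <= X)%N](card_ord m) max_card.
rewrite muleA -EFinM lee_wpmul2r // lee_fin /nonneg_const.
have rr0 : (0 <= 2 * row_const R)%R by exact: mulr_ge0.
have l0 : (0 <= level_const R m)%R by rewrite (le_trans _ (level_const_ge1 R m)).
rewrite powRM ?exprn_ge0 // -!powR_exprn //.
have C20 : (0 <= 2 * C)%R by exact: mulr_ge0.
apply: ler_pM; [exact: exprn_ge0|exact: exprn_ge0| |].
  by rewrite lerXn2r ?nnegrE ?powR_ge0.
by rewrite lerXn2r ?nnegrE ?powR_ge0.
Qed.

End NonnegativeMoments.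

(** * Averages over signs *)

Section Averages.
Context (R : realType).
Implicit Types (a b t u p q : R).

Definition average (E : finType) (F : E -> R) : R :=
  (#|E|%:R)^-1 * \sum_e F e.

Lemma average_ge0 (E : finType) (F : E -> R) :
  (forall e, 0 <= F e) -> 0 <= average F.
Proof. by move=> F0; rewrite mulr_ge0 ?invr_ge0 ?sumr_ge0. Qed.

Lemma le_average (E : finType) (F G : E -> R) :
  (forall e, F e <= G e) -> average F <= average G.
Proof. by move=> FG; rewrite ler_wpM2l ?invr_ge0 ?ler_sum. Qed.

Lemma average_sum (E I : finType) (Q : pred I) (F : I -> E -> R) :
  average (fun e => \sum_(i | Q i) F i e) = \sum_(i | Q i) average (F i).
Proof. by rewrite /average exchange_big /= big_distrr. Qed.

Lemma averageZl (E : finType) (c : R) (F : E -> R) :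
  average (fun e => c * F e) = c * average F.
Proof. by rewrite /average -big_distrr /= mulrCA. Qed.

Lemma averageD (E : finType) (F G : E -> R) :
  average (fun e => F e + G e) = average F + average G.
Proof. by rewrite /average big_split mulrDr. Qed.

Lemma average_cst (E : finType) (e0 : E) (c : R) : average (fun _ : E => c) = c.
Proof.
rewrite /average big_const iter_addr_0 -[c *+ _]mulr_natl mulrA mulVf ?mul1r //.
by rewrite pnatr_eq0 -lt0n; apply/card_gt0P; exists e0.
Qed.

Lemma average_exchange (E E' : finType) (F : E -> E' -> R) :
  average (fun e => average (F e)) = average (fun e' => average (F^~ e')).
Proof.
rewrite /average -!big_distrr /= exchange_big /=.
by rewrite mulrCA.
Qed.

(** The power lies above its tangent at [u]. Written without division, this is Young's inequality
    with exponents [q] and [q / (q - 1)] for [t] and [u^(q - 1)]; the Jensen and Minkowski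
    inequalities below all rest on it. *)
Lemma powR_tangent t u q : 1 <= q -> 0 <= t -> 0 <= u ->
  q * u `^ (q - 1) * t <= t `^ q + (q - 1) * u `^ q.
Proof.
rewrite le_eqVlt => /predU1P[<-|q1] t0 u0.
  by rewrite subrr powRr0 mul0r addr0 !mul1r powRr1.
have q0 : 0 < q by exact: lt_trans q1.
have r0 : 0 < q - 1 by rewrite subr_gt0.
have := @conjugate_powR _ t (u `^ (q - 1)) q (q / (q - 1)) t0 (powR_ge0 _ _) q0.
rewrite divr_gt0 // invf_div => /(_ isT).
have -> : q^-1 + (q - 1) / q = 1 by field; exact: lt0r_neq0.
have E : (q - 1) * (q / (q - 1)) = q by field; exact: lt0r_neq0.
move=> /(_ erefl); rewrite -powRrM E => H.
have := ler_wpM2l (ltW q0) H.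
have -> : q * (t `^ q / q + u `^ q * ((q - 1) / q)) = t `^ q + (q - 1) * u `^ q.
  by field; exact: lt0r_neq0.
by move=> H'; rewrite -mulrA (mulrC (u `^ _)).
Qed.

(* Minkowski's inequality in [L^q], from [S^q C^(1-q) <= sum_k c_k^(1-q) g_k^q],
   the convexity of the power at the points [g_k / c_k] with weights [c_k]. *)
Lemma average_minkowski (E K : finType) (g : K -> E -> R) (c : K -> R) q :
  1 <= q -> (forall k e, 0 <= g k e) -> (forall k, 0 <= c k) ->
  (forall k, average (fun e => g k e `^ q) <= c k `^ q) ->
  average (fun e => (\sum_k g k e) `^ q) <= (\sum_k c k) `^ q.
Proof.
move=> q1 g0 c0 H; have q0 : 0 < q by exact: lt_le_trans q1.
have [e0|noE] := pickP (fun _ : E => true); last first.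
  by rewrite /average big_pred0 ?mulr0 ?powR_ge0 // => e; have := noE e.
move=> _.
pose C := \sum_k c k; have C0 : 0 <= C by exact: sumr_ge0.
(* A vanishing weight forces its function to vanish, so the quotients [g k e / c k] are needed only
   for positive weights. *)
have gz k : c k = 0 -> forall e, g k e = 0.
  move=> ck e; move: (H k); rewrite ck powR0 ?gt_eqF // /average.
  have N0 : 0 < #|E|%:R :> R by rewrite ltr0n; apply/card_gt0P; exists e.
  rewrite pmulr_rle0 ?invr_gt0 // => S0.
  have /eqP : \sum_e g k e `^ q = 0.
    by apply/eqP; rewrite eq_le S0 sumr_ge0 // => *; exact: powR_ge0.
  rewrite psumr_eq0; last by move=> *; exact: powR_ge0.
  by move=> /allP /(_ e); rewrite mem_index_enum => /(_ isT)/eqP /powR_eq0_eq0.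
have [C0'|Cpos] := leP C 0.
  have Cz : C = 0 by apply/eqP; rewrite eq_le C0' C0.
  have cz k : c k = 0.
    move/eqP: Cz; rewrite psumr_eq0 // => /allP /(_ k).
    by rewrite mem_index_enum => /(_ isT)/eqP.
  rewrite -/C Cz powR0 ?gt_eqF // /average big1 ?mulr0 // => e _.
  by rewrite big1 ?powR0 ?gt_eqF // => k _; rewrite gz.
have pw e : C `^ (1 - q) * (\sum_k g k e) `^ q <= \sum_k c k `^ (1 - q) * g k e `^ q.
  set s := \sum_k g k e; pose u := s / C.
  have s0 : 0 <= s by exact: sumr_ge0.
  have u0 : 0 <= u by rewrite divr_ge0.
  (* The tangents are taken at the common point [u = s / C]; weighted by the [c k] and summed, they
     add up to [C * u^q], which is the left side. *)
  apply: (@le_trans _ _ (\sum_k (q * u `^ (q - 1) * g k e - c k * ((q - 1) * u `^ q)))).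
    rewrite sumrB -!big_distrr -big_distrl /= -/s -/C.
    rewrite powRB ?powRr1 ?(ltW Cpos) //; last by rewrite (gt_eqF Cpos) implybT.
    have -> : s = C * u by rewrite /u mulrCA mulfV ?mulr1 // gt_eqF.
    rewrite powRM ?(ltW Cpos) // mulrA mulfVK ?gt_eqF ?powR_gt0 //.
    have -> : q * u `^ (q - 1) * (C * u) = C * (q * (u * u `^ (q - 1))) by ring.
    rewrite mulr_powRB1 //.
    by have -> : C * (q * u `^ q) - C * ((q - 1) * u `^ q) = C * u `^ q by ring.
  apply: ler_sum => k _; have [ck|ck] := eqVneq (c k) 0.
    by rewrite gz // mulr0 ck mul0r subr0 mulr_ge0 ?powR_ge0.
  have ckp : 0 < c k by rewrite lt_neqAle eq_sym ck c0.
  have gc0 : 0 <= g k e / c k by rewrite divr_ge0 // ltW.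
  have T := powR_tangent q1 gc0 u0.
  have {T}T := ler_wpM2l (ltW ckp) T.
  rewrite lerBlDr.
  have -> : q * u `^ (q - 1) * g k e = c k * (q * u `^ (q - 1) * (g k e / c k)).
    by field.
  apply: (le_trans T); rewrite mulrDr lerD2r.
  rewrite powRB ?powRr1 ?(ltW ckp) //; last by rewrite ck implybT.
  rewrite powRM ?invr_ge0 ?(ltW ckp) // -(powR_inv1 (ltW ckp)) -powRrM mulN1r powRN.
  by rewrite [g k e `^ q * _]mulrC mulrA.
have AV : C `^ (1 - q) * average (fun e => (\sum_k g k e) `^ q) <= C.
  rewrite -averageZl.
  apply: (@le_trans _ _ (average (fun e => \sum_k c k `^ (1 - q) * g k e `^ q))).
    exact: le_average.
  rewrite average_sum; apply: ler_sum => k _; rewrite averageZl.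
  have [ck|ck] := eqVneq (c k) 0.
    apply: (@le_trans _ _ 0); last exact: c0.
    rewrite mulr_ge0_le0 ?powR_ge0 //; apply: (le_trans (H k)).
    by rewrite ck powR0 // gt_eqF.
  apply: (@le_trans _ _ (c k `^ (1 - q) * c k `^ q)); first by rewrite ler_wpM2l ?powR_ge0.
  by rewrite -powRD ?subrK ?powRr1 // ck implybT.
have := ler_wpM2l (powR_ge0 C (q - 1)) AV.
rewrite mulrA -powRD; last by rewrite (gt_eqF Cpos) implybT.
rewrite addrA subrK subrr powRr0 mul1r => /le_trans; apply.
by rewrite mulrC mulr_powRB1.
Qed.

Lemma average_jensen (E : finType) (e0 : E) (g : E -> R) q :
  1 <= q -> (forall e, 0 <= g e) ->
  average g `^ q <= average (fun e => g e `^ q).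
Proof.
move=> q1 g0; have q0 : 0 < q by exact: lt_le_trans q1.
pose u := average g; have u0 : 0 <= u by exact: average_ge0.
have : average (fun e => q * u `^ (q - 1) * g e) <=
       average (fun e => g e `^ q + (q - 1) * u `^ q).
  by apply: le_average => e; exact: powR_tangent.
rewrite averageZl averageD average_cst // -/u.
have -> : q * u `^ (q - 1) * u = q * (u * u `^ (q - 1)) by ring.
rewrite mulr_powRB1 //; lra.
Qed.

End Averages.

(** * Khinchine's inequality with explicit growth in the exponent *)

Section Khinchine.
Context (R : realType).
Implicit Types (p x y : R).

(** The exponent [2 x^2], weaker than the optimal [x^2 / 2], has an elementary proof:
    [e^y <= 1 / (1 - y)] for small [|x|], and [|x| <= 2 x^2] as soon as [|x| > 1/2]. *)
Lemma cosh_le x : (expR x + expR (- x)) / 2 <= expR (2 * x ^+ 2).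
Proof.
have key y : `|y| <= 2^-1 -> expR y <= 1 + y + 2 * y ^+ 2.
  rewrite ler_norml => /andP[y1 y2].
  have y3 : 0 < 1 - y by lra.
  have h : expR y <= (1 - y)^-1.
    rewrite -[y in expR y]opprK expRN lef_pV2 ?posrE ?expR_gt0 //.
    exact: expR_ge1Dx.
  apply: (le_trans h); rewrite -[(1 - y)^-1]mul1r ler_pdivrMr //.
  have -> : (1 + y + 2 * y ^+ 2) * (1 - y) = 1 + y ^+ 2 * (1 - 2 * y) by ring.
  by rewrite lerDl mulr_ge0 ?sqr_ge0 //; lra.
have [x2|x2] := leP `|x| 2^-1.
  have := key x x2; have := key (- x); rewrite normrN => /(_ x2).
  have := expR_ge1Dx (2 * x ^+ 2); rewrite sqrrN; lra.
have xx : `|x| <= 2 * x ^+ 2.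
  rewrite -[x ^+ 2]real_normK ?num_real // expr2 mulrA ler_peMl //.
  lra.
have h1 : expR x <= expR (2 * x ^+ 2) by rewrite ler_expR (le_trans (ler_norm x)).
have h2 : expR (- x) <= expR (2 * x ^+ 2).
  by rewrite ler_expR (le_trans _ xx) // -normrN ler_norm.
lra.
Qed.

Definition sign (b : bool) : R := (-1) ^+ b.

Lemma signK (b : bool) : sign b * sign b = 1.
Proof. by rewrite /sign -expr2 sqrr_sign. Qed.

Lemma sign_addb (b c : bool) : sign (b (+) c) = sign b * sign c.
Proof. by rewrite /sign signr_addb. Qed.

(** Independence of the signs is the distributivity of the product over the sums: the exponential
    moment factors over [k], and [cosh_le] bounds each factor. *)
Lemma average_sign_exp (K : finType) (b : K -> R) :
  average (fun e : {ffun K -> bool} => expR (\sum_k sign (e k) * b k)) <=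
  expR (2 * \sum_k b k ^+ 2).
Proof.
have -> : average (fun e : {ffun K -> bool} => expR (\sum_k sign (e k) * b k)) =
    \prod_k ((expR (b k) + expR (- b k)) / 2).
  rewrite /average (eq_bigr (fun e : {ffun K -> bool} =>
    \prod_k expR (sign (e k) * b k))); last by move=> e _; exact: expR_sum.
  rewrite -(bigA_distr_bigA (fun k (c : bool) => expR (sign c * b k))) /=.
  rewrite card_ffun card_bool natrX -exprVn -prodr_const -big_split /=.
  apply: eq_bigr => k _; rewrite big_bool /sign /= expr0 expr1 mul1r mulN1r.
  by rewrite mulrC addrC.
rewrite big_distrr /= expR_sum; apply: ler_prod => k _.
by rewrite cosh_le divr_ge0 ?addr_ge0 ?expR_ge0.
Qed.

Definition khinchine_const (p : R) : R := (2 * expR 2) ^+ 2 * p.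

Lemma khinchine (K : finType) (b : K -> R) p : 2 <= p ->
  average (fun e : {ffun K -> bool} => `|\sum_k sign (e k) * b k| `^ p) <=
  (khinchine_const p * \sum_k b k ^+ 2) `^ (p / 2).
Proof.
move=> p2; have p0 : 0 < p by lra.
set v := \sum_k b k ^+ 2.
have v0 : 0 <= v by apply: sumr_ge0 => k _; exact: sqr_ge0.
have [v00|vpos] := leP v 0.
  have bz k : b k = 0.
    have /eqP : v = 0 by lra.
    rewrite psumr_eq0; last by move=> *; exact: sqr_ge0.
    move=> /allP /(_ k); rewrite mem_index_enum => /(_ isT).
    by rewrite sqrf_eq0 => /eqP.
  rewrite /average big1 ?mulr0 ?powR_ge0 // => e _.
  rewrite big1 ?normr0 ?powR0 ?gt_eqF // => k _; by rewrite bz mulr0.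
(* With [la^2 = p / v] the exponential moment is at most [e^(2 p)], a constant to the power [p], and
   the prefactor [(p / la)^p] of the pointwise bound equals [(p v)^(p / 2)]. *)
pose la := (p / v) `^ 2^-1.
have la0 : 0 < la by rewrite powR_gt0 // divr_gt0.
have la2 : la ^+ 2 = p / v.
  by rewrite -powR_mulrn ?(ltW la0) // -powRrM mulVf // powRr1 // divr_ge0 ?(ltW p0).
pose Sm (e : {ffun K -> bool}) := \sum_k sign (e k) * b k.
have pw e : `|Sm e| `^ p <= (p / la) `^ p * (expR (la * Sm e) + expR (- (la * Sm e))).
  have h : la * `|Sm e| <= p * expR (la * `|Sm e| / p).
    rewrite -ler_pdivrMl // mulrC; apply: le_trans (expR_ge1Dx _); by rewrite lerDr.
  have h2 : `|Sm e| <= p / la * expR (la * `|Sm e| / p).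
    by rewrite -ler_pdivlMl // in h; rewrite -mulrA mulrCA.
  apply: (@le_trans _ _ ((p / la * expR (la * `|Sm e| / p)) `^ p)).
    by apply: le_powR_base; rewrite ?(ltW p0).
  rewrite powRM ?expR_ge0 ?divr_ge0 ?(ltW p0) ?(ltW la0) // -expRM mulfVK ?gt_eqF //.
  rewrite ler_wpM2l ?powR_ge0 //.
  have [S0|S0] := leP 0 (Sm e); first by rewrite ger0_norm // lerDl expR_ge0.
  by rewrite ltr0_norm // mulrN lerDr expR_ge0.
apply: (le_trans (le_average pw)).
rewrite averageZl averageD.
have ex (t : R) : t ^+ 2 = p / v -> average (fun e => expR (t * Sm e)) <= expR (2 * p).
  move=> t2.
  have -> : (fun e => expR (t * Sm e)) = (fun e => expR (\sum_k sign (e k) * (t * b k))).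
    apply/funext => e; rewrite /Sm big_distrr /=; congr expR; apply: eq_bigr => k _.
    by rewrite mulrCA.
  apply: (le_trans (average_sign_exp _)); rewrite ler_expR.
  under eq_bigr do rewrite exprMn.
  by rewrite -big_distrr /= -/v t2 mulfVK // gt_eqF.
have ex1 := ex la la2.
have ex2 : average (fun e => expR (- (la * Sm e))) <= expR (2 * p).
  have := ex (- la); rewrite sqrrN => /(_ la2).
  by under eq_fun do rewrite mulNr.
apply: (@le_trans _ _ ((p / la) `^ p * (2 * expR (2 * p)))).
  by rewrite ler_wpM2l ?powR_ge0 // mulr_natl mulr2n lerD.
have pla : (p / la) `^ p = (p * v) `^ (p / 2).
  have pv : ((p * v) `^ 2^-1) ^+ 2 = p * v.
    by rewrite -powR_mulrn ?powR_ge0 // -powRrM mulVf // powRr1 // mulr_ge0 // ltW.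
  have -> : p / la = (p * v) `^ 2^-1.
    apply/eqP; rewrite -(@eqrXn2 _ 2) ?powR_ge0 ?divr_ge0 ?(ltW p0) ?(ltW la0) //.
    rewrite expr_div_n la2 pv.
    by apply/eqP; field; rewrite !gt_eqF.
  by rewrite -powRrM (mulrC 2^-1).
rewrite pla /khinchine_const -mulrA [leRHS]powRM ?sqr_ge0 ?mulr_ge0 ?(ltW p0) //.
rewrite mulrC ler_wpM2r ?powR_ge0 //.
rewrite -[(2 * expR 2) ^+ 2]powR_mulrn ?mulr_ge0 ?expR_ge0 // -powRrM.
have -> : 2 * (p / 2) = p by field.
rewrite powRM ?expR_ge0 // -expRM ler_pM ?expR_ge0 //.
by apply: le1r_powR; lra.
Qed.

End Khinchine.

(** * Products of signs over the rows *)

Section RowSigns.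
Context (R : realType) (m n : nat).
Implicit Types (s : seq 'I_m) (i k l : mindex m n) (j : 'I_m) (a : mindex m n -> R)
  (p q : R).

Local Notation signs := {ffun 'I_m * 'I_n -> bool}.
Local Notation sgn := (sign R).
Local Notation kc := (@khinchine_const R).
Implicit Types (e : signs) (de : {ffun 'I_n -> bool}).

Definition row_sign s e i : R := \prod_(j <- s) sgn (e (j, i j)).

Definition flip j de e : signs :=
  [ffun jk => if jk.1 == j then de jk.2 (+) e jk else e jk].

Lemma flipK j de : involutive (flip j de).
Proof.
by move=> e; apply/ffunP => jk; rewrite !ffunE; case: ifP => H; rewrite ?H ?addKb.
Qed.

(** Invariance under a fixed change of signs in row [j]; averaging over the change then supplies
    fresh signs for that row alone. *)
Lemma average_flip j de (F : signs -> R) : average (fun e => F (flip j de e)) = average F.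
Proof.
rewrite /average; congr (_ * _).
by rewrite [RHS](reindex_inj (inv_inj (flipK j de))).
Qed.

Lemma row_sign_flip_notin s j de e i : j \notin s ->
  row_sign s (flip j de e) i = row_sign s e i.
Proof.
move=> js; rewrite /row_sign; apply: eq_big_seq => l ls; rewrite ffunE /=.
by case: eqVneq => // lj; rewrite -lj ls in js.
Qed.

Lemma row_sign_flip s j de e i : j \notin s ->
  row_sign (j :: s) (flip j de e) i =
  sgn (de (i j)) * (sgn (e (j, i j)) * row_sign s e i).
Proof.
move=> js; rewrite {1}/row_sign big_cons -/(row_sign s _ i) row_sign_flip_notin //.
by rewrite ffunE /= eqxx sign_addb mulrA.
Qed.

Lemma row_sign_sq s e i : row_sign s e i * row_sign s e i = 1.
Proof.
by rewrite /row_sign -big_split big1 //= => j _; rewrite signK.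
Qed.

Lemma khinchine_const_ge0 p : 0 <= p -> 0 <= kc p.
Proof. by move=> p0; rewrite mulr_ge0 ?sqr_ge0. Qed.

(* Injectivity of [i |-> (i j)_{j in s}] on [Q] leaves one term in each block once
   all rows of [s] are treated. *)
Lemma khinchine_rows s (Q : pred (mindex m n)) a p : 2 <= p -> uniq s ->
  (forall i k, Q i -> Q k -> (forall j, j \in s -> i j = k j) -> i = k) ->
  average (fun e => `|\sum_(i | Q i) a i * row_sign s e i| `^ p) <=
  (kc p ^+ size s * \sum_(i | Q i) a i ^+ 2) `^ (p / 2).
Proof.
move=> p2; have p0 : 0 < p by lra.
have e0 : signs := [ffun=> true].
have k0 : 0 <= kc p by rewrite khinchine_const_ge0 // ltW.
elim: s Q => [|j s IH] Q; last move=> /= /andP[js us].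
  move=> _ inj; rewrite expr0 mul1r.
  have [i0 Qi0|Q0] := pickP Q; last first.
    rewrite /average big1 ?mulr0 ?powR_ge0 // => e _.
    by rewrite big_pred0 // normr0 powR0 ?gt_eqF.
  have Q1 : Q =1 pred1 i0.
    by move=> i /=; apply/idP/eqP => [Qi|-> //]; exact: inj.
  have -> : (fun e => `|\sum_(i | Q i) a i * row_sign [::] e i| `^ p) =
     (fun _ : signs => `|a i0| `^ p).
    apply/funext => e; rewrite (eq_bigl _ _ Q1) big_pred1_eq /row_sign big_nil.
    by rewrite mulr1.
  rewrite average_cst // (eq_bigl _ _ Q1) big_pred1_eq -real_normK ?num_real //.
  rewrite -powR_mulrn // -powRrM; have -> // : 2 * (p / 2) = p by field.
move=> inj.
pose b c e := \sum_(i | Q i && (i j == c)) a i * row_sign s e i.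
(* Fresh signs [de] are inserted in row [j] and the indices are grouped by their coordinate [c] in
   that row; for fixed [e] this is a sum to which Khinchine's inequality applies. *)
have -> : average (fun e => `|\sum_(i | Q i) a i * row_sign (j :: s) e i| `^ p) =
   average (fun e => average (fun de : {ffun 'I_n -> bool} =>
     `|\sum_c sgn (de c) * (sgn (e (j, c)) * b c e)| `^ p)).
  rewrite average_exchange -[LHS](average_cst ([ffun=> true] : {ffun 'I_n -> bool})).
  congr average; apply/funext => de; rewrite -(average_flip j de).
  congr average; apply/funext => e; congr (`|_| `^ p).
  rewrite (partition_big (fun i => i j) predT) //=; apply: eq_bigr => c _.
  rewrite /b !big_distrr /=; apply: eq_bigr => i /andP[_ /eqP <-].
  by rewrite row_sign_flip //; ring.
apply: (@le_trans _ _ (average (fun e => (\sum_c kc p * b c e ^+ 2) `^ (p / 2)))).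
  apply: le_average => e; apply: (le_trans (khinchine _ p2)).
  rewrite -big_distrr /=; under eq_bigr do rewrite exprMn expr2 signK mul1r.
  by [].
(* Minkowski's inequality in [L^(p/2)], which requires [p >= 2], reduces the bound to one block of
   indices with [i j = c]; the induction hypothesis applies to each block. *)
apply: (le_trans (average_minkowski (c := fun c => kc p ^+ (size s).+1 *
    \sum_(i | Q i && (i j == c)) a i ^+ 2) _ _ _ _)).
- by rewrite ler_pdivlMr // mul1r.
- by move=> c e; rewrite mulr_ge0 ?sqr_ge0.
- by move=> c; rewrite mulr_ge0 ?exprn_ge0 // sumr_ge0 // => i _; exact: sqr_ge0.
- move=> c; rewrite exprS -mulrA powRM //; last first.
    by rewrite mulr_ge0 ?exprn_ge0 ?sumr_ge0 // => i _; exact: sqr_ge0.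
  rewrite [X in average X](_ : _ = (fun e => kc p `^ (p / 2) * `|b c e| `^ p)); last first.
    apply/funext => e; rewrite powRM ?sqr_ge0 // -real_normK ?num_real //.
    by rewrite -powR_mulrn // -powRrM; have -> // : 2 * (p / 2) = p by field.
  rewrite averageZl ler_wpM2l ?powR_ge0 //; apply: IH => // i k.
  move=> /andP[Qi /eqP ij] /andP[Qk /eqP kj] H; apply: inj => // l.
  by rewrite inE => /predU1P[->|]; [rewrite ij kj|exact: H].
rewrite -big_distrr /= [in leRHS](partition_big (fun i => i j) predT) //=.
Qed.

(** At a coordinate [j] where [i] and [k] differ, flipping the single sign at [(j, i j)] preserves
    the average but changes the sign of the product. *)
Lemma average_row_sign_neq i k : i != k ->
  average (fun e => row_sign (enum 'I_m) e i * row_sign (enum 'I_m) e k) = 0.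
Proof.
move=> ik.
have [j ijk] : exists j, i j != k j.
  apply/existsP; rewrite -negb_forall; apply: contra ik => /forallP H.
  by apply/eqP/ffunP => j; apply/eqP.
set s := enum 'I_m.
have splits e l : row_sign s e l = sgn (e (j, l j)) * row_sign (rem j s) e l.
  rewrite /row_sign (perm_big _ (perm_to_rem (mem_enum _ j : j \in s))) /=.
  by rewrite big_cons.
have js : j \notin rem j s by rewrite mem_rem_uniqF // enum_uniq.
set A := average _.
suff : A = - A by lra.
rewrite {1}/A -(average_flip j [ffun c => c == i j]) -mulN1r -averageZl.
congr average; apply/funext => e.
rewrite !splits !row_sign_flip_notin // !ffunE /= eqxx !sign_addb eqxx.
by rewrite [k j == _]eq_sym (negbTE ijk) /sign expr1 expr0; ring.
Qed.

(** By orthogonality of the row signs the sum of squares is a second moment over the signs, and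
    Jensen's inequality raises it to the power [q]. *)
Lemma rows_ge_l2 a q : 1 <= q ->
  (\sum_i a i ^+ 2) `^ q <=
  average (fun e => `|\sum_i a i * row_sign (enum 'I_m) e i| `^ (2 * q)).
Proof.
move=> q1.
have e0 : signs := [ffun=> true].
have -> : \sum_i a i ^+ 2 =
    average (fun e => `|\sum_i a i * row_sign (enum 'I_m) e i| ^+ 2).
  have -> : (fun e => `|\sum_i a i * row_sign (enum 'I_m) e i| ^+ 2) = (fun e =>
    \sum_i \sum_k a i * a k * (row_sign (enum 'I_m) e i * row_sign (enum 'I_m) e k)).
    apply/funext => e; rewrite real_normK ?num_real // expr2 big_distrl /=.
    apply: eq_bigr => i _; rewrite big_distrr /=; apply: eq_bigr => k _; ring.
  rewrite average_sum; apply: eq_bigr => i _; rewrite average_sum (bigD1 i) //=.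
  rewrite big1 ?addr0 => [|k ki].
    rewrite averageZl; under [X in average X]eq_fun do rewrite row_sign_sq.
    by rewrite average_cst // mulr1 expr2.
  by rewrite averageZl average_row_sign_neq ?mulr0 // eq_sym.
apply: (le_trans (average_jensen e0 q1 _)); first by move=> e; exact: sqr_ge0.
by apply: le_average => e; rewrite -powR_mulrn // -powRrM.
Qed.

End RowSigns.

(** * Removing signs from the chaos *)

Section Desymmetrization.
Context (R : realType) (m n : nat) (d d' : measure_display)
  (Omega : measurableType d) (P : probability Omega R) (S : measurableType d')
  (X : 'I_m -> 'I_n -> {RV P >-> S}).
Hypothesis indep : mutually_independent P (fun jk : 'I_m * 'I_n => X jk.1 jk.2).

Local Notation T := (marray m n S).
Local Notation EX := (expect_cells X).
Local Notation full := [set: 'I_m * 'I_n]%SET.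
Local Notation signs := {ffun 'I_m * 'I_n -> bool}.

Lemma powR_norm_tangent (a b p : R) : 1 < p ->
  `|a| `^ p + p * (`|a| `^ (p - 2) * a) * b <= `|a + b| `^ p.
Proof.
move=> p1; have p0 : 0 < p by exact: lt_trans p1.
have ap : `|a| * `|a| `^ (p - 2) = `|a| `^ (p - 1).
  have -> : p - 2 = p - 1 - 1 by ring.
  by rewrite mulr_powRB1 // subr_gt0.
have := powR_tangent (ltW p1) (normr_ge0 (a + b)) (normr_ge0 a).
have h : p * (`|a| `^ (p - 2) * a) * (a + b) <= p * `|a| `^ (p - 1) * `|a + b|.
  rewrite (le_trans (ler_norm _)) // !normrM (ger0_norm (ltW p0)).
  by rewrite (ger0_norm (powR_ge0 _ _)) (mulrC (_ `^ (p - 2))) ap.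
have h2 : p * (`|a| `^ (p - 2) * a) * a = p * `|a| `^ p.
  rewrite -(mulr_powRB1 (normr_ge0 a) p0) -ap -!mulrA; congr (p * _).
  by rewrite -[a * a]expr2 -(real_normK (num_real a)) expr2 mulrC mulrA.
rewrite mulrDr h2 in h.
move=> H; have := le_trans h H; lra.
Qed.

Lemma powR_convex2 (a b p : R) : 1 <= p -> 0 <= a -> 0 <= b ->
  (a + b) `^ p <= 2 `^ p / 2 * (a `^ p + b `^ p).
Proof.
move=> p1 a0 b0.
have := @average_jensen R bool true (fun c => if c then a else b) p p1.
have g0 c : 0 <= (if c then a else b) by case: c.
move=> /(_ g0); rewrite /average card_bool !big_bool /=.
rewrite powRM ?addr_ge0 // => H.
have := ler_wpM2l (powR_ge0 2 p) H.
rewrite mulrA -powRM // mulfV // powR1 mul1r; lra.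
Qed.

Definition pos_part (F : T -> R) (x : T) : \bar R := (Num.max (F x) 0)%:E.
Definition neg_part (F : T -> R) (x : T) : \bar R := (Num.max (- F x) 0)%:E.

Lemma nnmeasurable_EFin (F : T -> R) : measurable_fun setT F ->
  (forall x, 0 <= F x) -> nnmeasurable (fun x => (F x)%:E).
Proof.
by move=> mF F0; split=> [|x]; [exact/measurable_EFinP|rewrite lee_fin].
Qed.

Lemma nnmeasurable_pos_part (F : T -> R) : measurable_fun setT F ->
  nnmeasurable (pos_part F).
Proof.
move=> mF; apply: nnmeasurable_EFin => [|x]; last by rewrite le_max lexx orbT.
by apply: measurable_maxr => //; exact: measurable_cst.
Qed.

Lemma nnmeasurable_neg_part (F : T -> R) : measurable_fun setT F ->
  nnmeasurable (neg_part F).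
Proof. by move=> mF; apply: nnmeasurable_pos_part; exact: measurable_funN. Qed.

(** A vanishing integral forces both parts to have finite integrals: if one of them were infinite,
    the difference would be infinite by the conventions of extended addition. *)
Lemma EX_pos_neg_part (A : {set 'I_m * 'I_n}) (F : T -> R) (x : T) :
  (\int[P]_w (F (mix A (sample X w) x))%:E = 0)%E ->
  EX A (pos_part F) x = EX A (neg_part F) x.
Proof.
have -> : EX A (pos_part F) x =
    (\int[P]_w ((fun w => (F (mix A (sample X w) x))%:E)^\+ w))%E.
  by apply: eq_integral => w _; rewrite funeposE /pos_part EFin_max.
have -> : EX A (neg_part F) x =
    (\int[P]_w ((fun w => (F (mix A (sample X w) x))%:E)^\- w))%E.
  by apply: eq_integral => w _; rewrite funenegE /neg_part EFin_max.
rewrite integralE.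
have : (0 <= \int[P]_w ((fun w => (F (mix A (sample X w) x))%:E)^\+ w))%E.
  by apply: integral_ge0.
have : (0 <= \int[P]_w ((fun w => (F (mix A (sample X w) x))%:E)^\- w))%E.
  by apply: integral_ge0.
case: (\int[P]_w _)%E => [b| |] //; case: (\int[P]_w _)%E => [a| |] //= _ _.
by rewrite -EFinB => -[] /eqP; rewrite subr_eq0 => /eqP ->.
Qed.

Variables (u : mindex m n -> T -> R) (p : R).
Hypothesis p2 : 2 <= p.
Hypothesis mu : forall i, measurable_fun setT (u i).
Hypothesis lu : forall j i x y, u i (mix (rows n [set j] :\ (j, i j)) y x) = u i x.
Hypothesis iu : forall i x, (EX full (fun y => (`|u i y| `^ p)%:E) x < +oo)%E.
Hypothesis cu : forall i j, {ae P, forall w,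
  (\int[P]_w' (u i (mix (rows n [set j]) (sample X w') (sample X w)))%:E = 0)%E}.

Let p0 : 0 < p. Proof. exact: lt_le_trans p2. Qed.
Let p1 : 1 < p. Proof. by apply: lt_le_trans p2; rewrite ltr1n. Qed.

Definition lincomb (a : mindex m n -> R) (x : T) : R := \sum_i a i * u i x.

Definition pmoment (F : T -> R) (x : T) : \bar R := EX full (fun y => (`|F y| `^ p)%:E) x.

Lemma measurable_lincomb a : measurable_fun setT (lincomb a).
Proof.
by apply: measurable_sum => i; exact: measurable_funM.
Qed.

Lemma nnmeasurable_norm_powR (F : T -> R) : measurable_fun setT F ->
  nnmeasurable (fun y => (`|F y| `^ p)%:E).
Proof.
move=> mF; apply: nnmeasurable_EFin => [|x]; last exact: powR_ge0.
apply: (measurableT_comp (measurable_powR p)).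
exact: measurableT_comp.
Qed.

Lemma pmoment_dominating_lty (a : mindex m n -> R) x :
  (forall i, 0 <= a i)%R ->
  (EX full (fun y => ((\sum_i a i * `|u i y|) `^ p)%:E) x < +oo)%E.
Proof.
move=> a0.
pose xi i (y : T) := (a i * `|u i y|)%:E.
have nxi i : nnmeasurable (xi i).
  apply: nnmeasurable_EFin => [|y]; last by rewrite mulr_ge0.
  apply: measurable_funM; first exact: measurable_cst.
  exact: measurableT_comp.
have := @EX_sum_poweR_lty _ _ _ _ _ _ P S X _ full xi nxi p p1 x.
have -> : (fun y => ((\sum_i xi i y) `^ p)%E) = (fun y => ((\sum_i a i * `|u i y|) `^ p)%:E).
  by apply/funext => y; rewrite sumEFin poweR_EFin.
apply; apply: lte_sum_pinfty => i _.
have -> : (fun y => (xi i y `^ p)%E) = (fun y => ((a i `^ p)%:E * (`|u i y| `^ p)%:E)%E).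
  by apply/funext => y; rewrite poweR_EFin powRM // EFinM.
rewrite EXZl ?lee_fin ?powR_ge0 //; last exact: nnmeasurable_norm_powR.
by rewrite lte_mul_pinfty ?lee_fin ?powR_ge0.
Qed.

Lemma pmoment_lincomb_lty a x : (pmoment (lincomb a) x < +oo)%E.
Proof.
apply: le_lt_trans (@pmoment_dominating_lty (fun i => `|a i|) x _) => //.
apply: le_EX => [||y].
- by apply: nnmeasurable_norm_powR; exact: measurable_lincomb.
- apply: nnmeasurable_EFin => [|y]; last exact: powR_ge0.
  apply: (measurableT_comp (measurable_powR p)).
  apply: measurable_sum => i; apply: measurable_funM; first exact: measurable_cst.
  exact: measurableT_comp.
- rewrite lee_fin; apply: le_powR_base; rewrite ?(ltW p0) //.
  by apply: (le_trans (ler_norm_sum _ _ _)); apply: ler_sum => i _; rewrite normrM.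
Qed.

(** Centering survives multiplication by a function that does not read the cell [(j, i j)]. The
    centering hypothesis integrates a whole row and holds only almost surely at sampled arrays,
    hence the passage from the cell to row [j] and the evaluation at [sample X w]. *)
Lemma EX_pos_neg_mul (j : 'I_m) (i : mindex m n) (c : T -> \bar R) (x : T) : nnmeasurable c ->
  independent_of [set (j, i j)]%SET c ->
  EX full (fun y => c y * pos_part (u i) y)%E x =
  EX full (fun y => c y * neg_part (u i) y)%E x.
Proof.
move=> nc ic.
have key F : nnmeasurable F -> independent_of (rows n [set j] :\ (j, i j)) F ->
   EX full (fun y => c y * F y)%E x =
   (\int[P]_w (c (sample X w) * EX (rows n [set j]) F (sample X w)))%E.
  move=> nF iF.
  have ncF := nnmeasurableM nc nF.
  have nE := nnmeasurableM nc (nnmeasurable_EX (X := X) (rows n [set j]) nF).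
  rewrite -(EX_setT _ (fun y => c y * EX (rows n [set j]) F y)%E x).
  have fullU A : full = full :|: A by rewrite finset.setTU.
  rewrite [in LHS](fullU [set (j, i j)]%SET) -EX_EXU //.
  congr (EX _ _ x); apply/funext => y; rewrite EXMl //; congr (_ * _)%E.
  rewrite -(@EXU_independent _ _ _ _ _ _ _ _ X indep _ (rows n [set j] :\ (j, i j))) //.
  by rewrite finset.setD1K // !finset.inE.
rewrite !key; first last.
- by move=> y z; rewrite /pos_part lu.
- exact: nnmeasurable_pos_part.
- by move=> y z; rewrite /neg_part lu.
- exact: nnmeasurable_neg_part.
have nX (G : T -> \bar R) : nnmeasurable G -> measurable_fun setT (fun w => G (sample X w)).
  move=> [mG _]; apply: (measurableT_comp mG).
  by apply: measurable_to_marray => a b; exact: measurable_funPT.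
have np := nnmeasurableM nc (nnmeasurable_EX (X := X) (rows n [set j]) (nnmeasurable_pos_part (mu i))).
have nn := nnmeasurableM nc (nnmeasurable_EX (X := X) (rows n [set j]) (nnmeasurable_neg_part (mu i))).
apply: ge0_ae_eq_integral => //.
- exact: (nX _ np).
- exact: (nX _ nn).
- by move=> w _; exact: np.2.
- by move=> w _; exact: nn.2.
- apply: filterS (cu i j) => w H _; congr (_ * _)%E.
  exact: EX_pos_neg_part.
Qed.

Lemma independent_cell (j : 'I_m) (c : 'I_n) (i : mindex m n) (x y : T) :
  c != i j -> u i (mix [set (j, c)]%SET y x) = u i x.
Proof.
move=> cij; apply: EFin_inj.
apply: (@independentS _ _ _ _ _ _ (rows n [set j] :\ (j, i j)) (fun x => (u i x)%:E)).
  by rewrite finset.sub1set !finset.inE /= xpair_eqE eqxx /= cij.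
by move=> z w; rewrite lu.
Qed.

Lemma pos_neg_part_mul (s t : R) :
  s * t = (Num.max s 0 * Num.max t 0 + Num.max (- s) 0 * Num.max (- t) 0) -
    (Num.max s 0 * Num.max (- t) 0 + Num.max (- s) 0 * Num.max t 0).
Proof.
have E (r : R) : r = Num.max r 0 - Num.max (- r) 0.
  have [r0|/ltW r0] := leP 0 r.
    have h : Num.max (- r) 0 = 0 by apply: max_r; rewrite oppr_le0.
    by rewrite h subr0.
  have h : Num.max (- r) 0 = - r by apply: max_l; rewrite oppr_ge0.
  by rewrite h sub0r opprK.
by rewrite {1}(E s) {1}(E t); ring.
Qed.

Definition mask (j : 'I_m) (D : pred 'I_n) (a : mindex m n -> R)
    (i : mindex m n) : R :=
  if D (i j) then a i else 0.

(* [|A|^p + c b <= |A + b|^p], where [c] is the derivative of [|.|^p] at the kept part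
   [A] and [b] the removed part, and [E (c b) = 0].  The products are split into
   positive and negative parts so that only nonnegative integrals occur. *)
Lemma pmoment_partial_sum (j : 'I_m) (D : pred 'I_n) (a : mindex m n -> R) (x : T) :
  (pmoment (lincomb (mask j D a)) x <=
   pmoment (lincomb a) x)%E.
Proof.
pose A := lincomb (mask j D a).
pose w (i : mindex m n) := if D (i j) then 0 else a i.
pose c (y : T) := p * (`|A y| `^ (p - 2) * A y).
pose ci i (y : T) := w i * c y.
have mA : measurable_fun setT A by exact: measurable_lincomb.
have mc : measurable_fun setT c.
  apply: measurable_funM; first exact: measurable_cst.
  apply: measurable_funM => //.
  apply: (measurableT_comp (measurable_powR (p - 2))).
  exact: measurableT_comp.
have mci i : measurable_fun setT (ci i).
  by apply: measurable_funM => //; exact: measurable_cst.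
pose L i (y : T) := (pos_part (ci i) y * pos_part (u i) y + neg_part (ci i) y * neg_part (u i) y)%E.
pose M i (y : T) := (pos_part (ci i) y * neg_part (u i) y + neg_part (ci i) y * pos_part (u i) y)%E.
(* For a removed index [i] with [D (i j)] false, no kept index has the same coordinate in row [j],
   so the kept part does not read the cell of [i]; for the other indices the weight [w i] is 0. *)
have ici (i : mindex m n) y z : ci i (mix [set (j, i j)]%SET y z) = ci i z.
  rewrite /ci /w; case: ifPn => [_|Di]; first by rewrite !mul0r.
  have -> // : forall z, c (mix [set (j, i j)]%SET y z) = c z.
  move=> {}z; rewrite /c; have -> // : A (mix [set (j, i j)]%SET y z) = A z.
  apply: eq_bigr => k _; rewrite /mask; case: ifP => Dk; last by rewrite !mul0r.
  by rewrite independent_cell //; apply: contraNneq Di => ->.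
have ipos (i : mindex m n) : independent_of [set (j, i j)]%SET (pos_part (ci i)).
  by move=> y z; rewrite /pos_part ici.
have ineg (i : mindex m n) : independent_of [set (j, i j)]%SET (neg_part (ci i)).
  by move=> y z; rewrite /neg_part ici.
have npc i := nnmeasurable_pos_part (mci i).
have nnc i := nnmeasurable_neg_part (mci i).
have npu i := nnmeasurable_pos_part (mu i).
have nnu i := nnmeasurable_neg_part (mu i).
have nL i : nnmeasurable (L i) by apply: nnmeasurableD; exact: nnmeasurableM.
have nM i : nnmeasurable (M i) by apply: nnmeasurableD; exact: nnmeasurableM.
have LM i : EX full (L i) x = EX full (M i) x.
  by rewrite !EXD; do ?exact: nnmeasurableM; rewrite !(@EX_pos_neg_mul j).
have Mfin : (\sum_i EX full (M i) x)%E \is a fin_num.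
  rewrite ge0_fin_numE; last by apply: sume_ge0 => i _; exact: (nnmeasurable_EX _ (nM i)).2.
  apply: lte_sum_pinfty => i _.
  (* The weights [1 + |a k|] make [s] dominate both [|u i|] and [|A|], hence also the cross terms up
     to a constant times [s^p]. *)
  pose s (y : T) := \sum_k (1 + `|a k|) * `|u k y|.
  have ms : measurable_fun setT s.
    apply: measurable_sum => k; apply: measurable_funM; first exact: measurable_cst.
    exact: measurableT_comp.
  have s0 y : 0 <= s y by apply: sumr_ge0 => k _; rewrite mulr_ge0 ?addr_ge0.
  have ns : nnmeasurable (fun y => (s y `^ p)%:E).
    apply: nnmeasurable_EFin => [|y]; last exact: powR_ge0.
    exact: (measurableT_comp (measurable_powR p)).
  have k0 : 0 <= 2 * (`|w i| * p) by rewrite !mulr_ge0 // ltW.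
  apply: (@le_lt_trans _ _ ((2 * (`|w i| * p))%:E * EX full (fun y => (s y `^ p)%:E) x)%E).
    rewrite -EXZl //; apply: le_EX => // [|y].
      by apply: nnmeasurableM => //; exact: nnmeasurable_cst.
    rewrite /M /pos_part /neg_part -!EFinM -EFinD lee_fin.
    have us : `|u i y| <= s y.
      rewrite /s (bigD1 i) //=; apply: ler_wpDr.
        by apply: sumr_ge0 => k _; rewrite mulr_ge0 ?addr_ge0.
      by rewrite mulrDl mul1r lerDl mulr_ge0.
    have As : `|A y| <= s y.
      apply: (le_trans (ler_norm_sum _ _ _)); apply: ler_sum => k _.
      rewrite normrM ler_wpM2r // /mask; case: ifP => _; rewrite ?normr0 ?addr_ge0 //.
      by rewrite lerDr.
    have cs : `|ci i y| * `|u i y| <= `|w i| * p * s y `^ p.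
      have -> : `|ci i y| = `|w i| * p * `|A y| `^ (p - 1).
        rewrite /ci /c !normrM (ger0_norm (ltW p0)) (ger0_norm (powR_ge0 _ _)) -mulrA.
        congr (_ * (_ * _)); have -> : p - 2 = p - 1 - 1 by ring.
        by rewrite mulrC mulr_powRB1 // subr_gt0.
      rewrite -mulrA ler_wpM2l ?mulr_ge0 ?(ltW p0) //.
      rewrite -(mulr_powRB1 (s0 y) p0) mulrC ler_pM ?powR_ge0 //.
      by apply: le_powR_base; rewrite ?subr_ge0 ?(ltW p1).
    have mx (r : R) : Num.max r 0 <= `|r| by rewrite ge_max ler_norm normr_ge0.
    have mxN (r : R) : Num.max (- r) 0 <= `|r| by rewrite -normrN; exact: mx.
    have mx0 (r : R) : 0 <= Num.max r 0 by rewrite le_max lexx orbT.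
    rewrite -mulrA mulr_natl mulr2n.
    by apply: lerD; apply: le_trans cs; rewrite ler_pM.
  by rewrite lte_mul_pinfty ?lee_fin // pmoment_dominating_lty.
have nA := nnmeasurable_norm_powR mA.
have nla := nnmeasurable_norm_powR (measurable_lincomb a).
(* The sums of [EX full (L i)] and of [EX full (M i)] are equal and finite. Adding one on each side
   moves the linear term of the tangent inequality into nonnegative integrands. *)
rewrite -(leeD2rE _ _ Mfin).
have SLM : (\sum_i EX full (M i) x = \sum_i EX full (L i) x)%E by apply: eq_bigr.
rewrite {1}SLM.
have nSL : nnmeasurable (fun y => \sum_i L i y)%E by exact: nnmeasurable_sum.
have nSM : nnmeasurable (fun y => \sum_i M i y)%E by exact: nnmeasurable_sum.
have EL := EXD (X := X) full x nA nSL; have EM := EXD (X := X) full x nla nSM.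
rewrite (EX_sum full _ _ x nL) in EL; rewrite (EX_sum full _ _ x nM) in EM.
rewrite -/(pmoment A x) in EL; rewrite -/(pmoment (lincomb a) x) in EM.
suff : (EX full (fun y => (`|A y| `^ p)%:E + \sum_i L i y)%E x <=
        EX full (fun y => (`|lincomb a y| `^ p)%:E + \sum_i M i y)%E x)%E.
  by rewrite EL EM.
apply: le_EX => [||y]; [exact: nnmeasurableD|exact: nnmeasurableD|].
rewrite /L /M /pos_part /neg_part.
under eq_bigr do rewrite -!EFinM -EFinD.
under [in leRHS]eq_bigr do rewrite -!EFinM -EFinD.
rewrite !sumEFin -!EFinD lee_fin.
have := powR_norm_tangent (A y) (lincomb w y) p1.
have -> : A y + lincomb w y = lincomb a y.
  rewrite /A /lincomb -big_split; apply: eq_bigr => i _; rewrite /= /w /mask.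
  by case: ifP => _; rewrite mul0r ?add0r ?addr0.
rewrite -/(c y).
have -> : c y * lincomb w y = \sum_i ci i y * u i y.
  by rewrite /lincomb big_distrr; apply: eq_bigr => i _; rewrite /ci /=; ring.
under eq_bigr do rewrite pos_neg_part_mul.
rewrite sumrB; lra.
Qed.

(** The signed sum is the difference of the partial sums over the two values of the sign; each has a
    moment at most that of the full sum, and convexity gives the factor [2^p]. *)
Lemma pmoment_flip_row (j : 'I_m) (de : {ffun 'I_n -> bool})
    (a : mindex m n -> R) (x : T) :
  (pmoment (lincomb (fun i => sign R (de (i j)) * a i)%R) x <=
   (2 `^ p)%:E * pmoment (lincomb a) x)%E.
Proof.
pose A := lincomb (mask j (fun c => ~~ de c) a).
pose B := lincomb (mask j (fun c => de c) a).
have nA := nnmeasurable_norm_powR (measurable_lincomb (mask j (fun c => ~~ de c) a)).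
have nB := nnmeasurable_norm_powR (measurable_lincomb (mask j (fun c => de c) a)).
have h0 : 0 <= 2 `^ p / 2 by rewrite divr_ge0 ?powR_ge0.
apply: (@le_trans _ _ ((2 `^ p / 2)%:E * (pmoment A x + pmoment B x))%E).
  rewrite -EXD // -EXZl //; last exact: nnmeasurableD.
  apply: le_EX => [||y].
  - by apply: nnmeasurable_norm_powR; exact: measurable_lincomb.
  - by apply: nnmeasurableM; [exact: nnmeasurable_cst|exact: nnmeasurableD].
  - have -> : lincomb (fun i => sign R (de (i j)) * a i) y = A y - B y.
      rewrite /A /B /lincomb -sumrB; apply: eq_bigr => i _; rewrite /mask /sign.
      by case: (de (i j)) => /=; rewrite ?expr1 ?expr0; ring.
    rewrite -EFinD -EFinM lee_fin.
    apply: le_trans (powR_convex2 (ltW p1) (normr_ge0 _) (normr_ge0 _)).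
    by apply: le_powR_base; rewrite ?(ltW p0) // ler_normB.
have hA := pmoment_partial_sum j (fun c => ~~ de c) a x.
have hB := pmoment_partial_sum j (fun c => de c) a x.
apply: (@le_trans _ _ ((2 `^ p / 2)%:E * (pmoment (lincomb a) x + pmoment (lincomb a) x))%E).
  by apply: lee_wpmul2l; [rewrite lee_fin|exact: (leeD hA hB)].
have n0 : (0 <= pmoment (lincomb a) x)%E by apply: EX_ge0 => y; rewrite lee_fin powR_ge0.
rewrite ge0_muleDr // -ge0_muleDl ?lee_fin // -EFinD.
by have -> // : 2 `^ p / 2 + 2 `^ p / 2 = 2 `^ p by field.
Qed.

Lemma pmoment_row_sign (s : seq 'I_m) (e : signs) (a : mindex m n -> R) (x : T) :
  (pmoment (lincomb (fun i => row_sign R s e i * a i)%R) x <=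
   ((2 `^ p) ^+ size s)%:E * pmoment (lincomb a) x)%E.
Proof.
elim: s a => [|j s IH] a.
  rewrite expr0 mul1e; have -> // : (fun i => row_sign R [::] e i * a i) = a.
  by apply/funext => i; rewrite /row_sign big_nil mul1r.
have -> : (fun i => row_sign R (j :: s) e i * a i) =
   (fun i => row_sign R s e i * (sign R ([ffun c => e (j, c)] (i j)) * a i)).
  by apply/funext => i; rewrite {1}/row_sign big_cons ffunE -/(row_sign R s e i); ring.
apply: (le_trans (IH _)); rewrite /= exprSr EFinM -muleA.
apply: lee_wpmul2l; first by rewrite lee_fin exprn_ge0 ?powR_ge0.
exact: pmoment_flip_row.
Qed.

Lemma pmoment_signed_le (e : signs) (x : T) :
  (pmoment (lincomb (row_sign R (enum 'I_m) e)) x <=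
   ((2 `^ p) ^+ m)%:E * pmoment (lincomb (fun=> 1%R)) x)%E.
Proof.
have := pmoment_row_sign (enum 'I_m) e (fun=> 1) x.
rewrite size_enum_ord.
have -> // : (fun i => row_sign R (enum 'I_m) e i * 1) = row_sign R (enum 'I_m) e.
by apply/funext => i; rewrite mulr1.
Qed.

(** Row signs are their own inverses, so the bound for inserting them also bounds their removal. *)
Lemma pmoment_unsigned_le (e : signs) (x : T) :
  (pmoment (lincomb (fun=> 1%R)) x <=
   ((2 `^ p) ^+ m)%:E * pmoment (lincomb (row_sign R (enum 'I_m) e)) x)%E.
Proof.
have := pmoment_row_sign (enum 'I_m) e (row_sign R (enum 'I_m) e) x.
rewrite size_enum_ord.
have -> // : (fun i => row_sign R (enum 'I_m) e i * row_sign R (enum 'I_m) e i) =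
  (fun=> 1).
by apply/funext => i; rewrite row_sign_sq.
Qed.

End Desymmetrization.

(** * Moments of the chaos and of its sum of squares *)

Section Chaos.
Context (R : realType) (m n : nat) (d d' : measure_display)
  (Omega : measurableType d) (P : probability Omega R) (S : measurableType d')
  (X : 'I_m -> 'I_n -> {RV P >-> S}).
Hypothesis indep : mutually_independent P (fun jk : 'I_m * 'I_n => X jk.1 jk.2).

Local Notation T := (marray m n S).
Local Notation EX := (expect_cells X).
Local Notation full := [set: 'I_m * 'I_n]%SET.
Local Notation signs := {ffun 'I_m * 'I_n -> bool}.

Lemma EX_jensen (A : {set 'I_m * 'I_n}) (G : T -> \bar R) (q : R) (x : T) :
  1 < q -> nnmeasurable G -> (EX A G x `^ q <= EX A (fun y => G y `^ q) x)%E.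
Proof.
move=> q1 nG; have q0 : 0 < q by exact: lt_trans q1.
have nGq := nnmeasurable_poweR q nG.
have := (nnmeasurable_EX (X := X) A nG).2 x.
case Eu : (EX A G x) => [v| |] // v0; last first.
  rewrite poweRyr ?gt_eqF //.
  (* The tangent at an infinite mean makes no sense; here [G <= 1 + G^q] shows that the right side
     is infinite too. *)
  have : (EX A G x <= EX A (fun y => 1 + G y `^ q) x)%E.
    apply: le_EX => // [|y]; first by apply: nnmeasurableD => //; exact: nnmeasurable_cst.
    have := nG.2 y; case: (G y) => [g g0|_|//].
      rewrite poweR_EFin -EFinD lee_fin.
      have [g1|g1] := leP g 1; first by rewrite (le_trans g1) // lerDl powR_ge0.
      by rewrite (le_trans (le1r_powR (ltW g1) (ltW q1))) // lerDr.
    by rewrite poweRyr ?gt_eqF.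
  rewrite EXD //.
  rewrite EX_cst Eu leye_eq; case: (EX A (fun y => (G y `^ q)%E) x) => //.
have c0 : 0 <= q * v `^ (q - 1) by rewrite mulr_ge0 ?powR_ge0 // ltW.
have d0 : 0 <= (q - 1) * v `^ q by rewrite mulr_ge0 ?powR_ge0 // subr_ge0 ltW.
have : (EX A (fun y => (q * v `^ (q - 1))%:E * G y) x <=
        EX A (fun y => G y `^ q + ((q - 1) * v `^ q)%:E) x)%E.
  apply: le_EX => [||y].
  - by apply: nnmeasurableM => //; exact: nnmeasurable_cst.
  - by apply: nnmeasurableD => //; exact: nnmeasurable_cst.
  - have := nG.2 y; case: (G y) => [g g0|_|//].
      rewrite poweR_EFin -EFinM -EFinD lee_fin.
      by apply: powR_tangent => //; exact: ltW.
    by rewrite poweRyr ?gt_eqF // addye // leey.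
rewrite EXZl // EXD //.
rewrite EX_cst Eu poweR_EFin.
have := (nnmeasurable_EX (X := X) A nGq).2 x.
case: (EX A (fun y => (G y `^ q)%E) x) => [w w0|_ _|//]; last by rewrite leey.
rewrite -EFinM -EFinD !lee_fin.
have -> : q * v `^ (q - 1) * v = q * (v * v `^ (q - 1)) by ring.
rewrite mulr_powRB1 //; lra.
Qed.

Lemma le_average_ereal (E : finType) (e0 : E) (a : \bar R) (F : E -> \bar R) :
  (0 <= a)%E -> (forall e, a <= F e)%E ->
  (a <= (#|E|%:R^-1)%:E * \sum_e F e)%E.
Proof.
move=> a0 aF.
have N0 : 0 < #|E|%:R :> R by rewrite ltr0n; apply/card_gt0P; exists e0.
apply: (@le_trans _ _ ((#|E|%:R^-1)%:E * \sum_(e : E) a)%E).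
  have -> : (\sum_(e : E) a = #|E|%:R%:E * a)%E.
    rewrite -sum1_card natr_sum -sumEFin ge0_sume_distrl //.
    by apply: eq_bigr => e _; rewrite mul1e.
  by rewrite muleA -EFinM mulVf ?gt_eqF // mul1e.
by apply: lee_wpmul2l; [rewrite lee_fin invr_ge0 ltW|exact: lee_sum].
Qed.

Lemma average_ereal_le (E : finType) (e0 : E) (b : \bar R) (F : E -> \bar R) :
  (0 <= b)%E -> (forall e, F e <= b)%E ->
  ((#|E|%:R^-1)%:E * \sum_e F e <= b)%E.
Proof.
move=> b0 Fb.
have N0 : 0 < #|E|%:R :> R by rewrite ltr0n; apply/card_gt0P; exists e0.
apply: (@le_trans _ _ ((#|E|%:R^-1)%:E * \sum_(e : E) b)%E).
  by apply: lee_wpmul2l; [rewrite lee_fin invr_ge0 ltW|exact: lee_sum].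
have -> : (\sum_(e : E) b = #|E|%:R%:E * b)%E.
  rewrite -sum1_card natr_sum -sumEFin ge0_sume_distrl //.
  by apply: eq_bigr => e _; rewrite mul1e.
by rewrite muleA -EFinM mulVf ?gt_eqF // mul1e.
Qed.

Variables (u : mindex m n -> T -> R).
Hypothesis mu : forall i, measurable_fun setT (u i).
Hypothesis lu : forall j i x y, u i (mix (rows n [set j] :\ (j, i j)) y x) = u i x.
Hypothesis cu : forall i j, {ae P, forall w,
  (\int[P]_w' (u i (mix (rows n [set j]) (sample X w') (sample X w)))%:E = 0)%E}.

Local Notation Z := (lincomb u (fun=> 1)).
Local Notation pm := (pmoment X).
Local Notation Zs e := (lincomb u (row_sign R (enum 'I_m) e)).

Definition squares (i : mindex m n) (x : T) : \bar R := (u i x ^+ 2)%:E.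

Definition square_sum (x : T) : R := \sum_i u i x ^+ 2.

Lemma measurable_square_sum : measurable_fun setT square_sum.
Proof. by apply: measurable_sum => i; exact: measurable_funX. Qed.

Lemma square_sum_ge0 x : 0 <= square_sum x.
Proof. by apply: sumr_ge0 => i _; exact: sqr_ge0. Qed.

Lemma nnmeasurable_square_sum (q : R) :
  nnmeasurable (fun y => (square_sum y `^ q)%:E).
Proof.
apply: nnmeasurable_EFin => [|y]; last exact: powR_ge0.
exact: (measurableT_comp (measurable_powR q) measurable_square_sum).
Qed.

Lemma EX_average_signs (r : R) (x : T) :
  ((#|{: signs}|%:R^-1)%:E * \sum_(e : signs) pm r (Zs e) x)%E =
  EX full (fun y => (average (fun e : signs => `|Zs e y| `^ r))%:E) x.
Proof.
have nZ (e : signs) : nnmeasurable (fun y => (`|Zs e y| `^ r)%:E).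
  by apply: nnmeasurable_norm_powR; exact: measurable_lincomb.
rewrite /pmoment -(EX_sum (X := X) full _ _ x nZ) -EXZl; first last.
- by rewrite lee_fin invr_ge0.
- exact: nnmeasurable_sum.
by congr (EX _ _ x); apply/funext => y; rewrite sumEFin -EFinM.
Qed.

Lemma row_sumE (a : mindex m n -> R) (y : T) :
  lincomb u a y = \sum_i u i y * a i.
Proof. by apply: eq_bigr => i _; rewrite mulrC. Qed.

Section Exponent.
Variable r : R.
Hypothesis r2 : 2 <= r.
Hypothesis iu : forall i x, (EX full (fun y => (`|u i y| `^ r)%:E) x < +oo)%E.

Let r0 : 0 < r. Proof. exact: lt_le_trans r2. Qed.

Lemma square_sum_le_pmoment (x : T) :
  (EX full (fun y => (square_sum y `^ (r / 2))%:E) x <=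
   ((2 `^ r) ^+ m)%:E * pm r Z x)%E.
Proof.
have c0 : 0 <= (2 `^ r) ^+ m by rewrite exprn_ge0 ?powR_ge0.
have nZ : nnmeasurable (fun y => (`|Z y| `^ r)%:E).
  by apply: nnmeasurable_norm_powR; exact: measurable_lincomb.
have b0 : (0 <= ((2 `^ r) ^+ m)%:E * pm r Z x)%E.
  by apply: mule_ge0; [rewrite lee_fin|exact: (nnmeasurable_EX _ nZ).2].
apply: le_trans (average_ereal_le (F := fun e : signs => pm r (Zs e) x)
  ([ffun=> true] : signs) b0 _); last first.
  by move=> e; exact: (pmoment_signed_le indep r2 mu lu iu cu).
rewrite EX_average_signs.
apply: le_EX => [||y]; first exact: nnmeasurable_square_sum.
  apply: nnmeasurable_EFin => [|y]; last by apply: average_ge0 => e; exact: powR_ge0.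
  apply: measurable_funM; first exact: measurable_cst.
  apply: measurable_sum => e; apply: (measurableT_comp (measurable_powR r)).
  by apply: measurableT_comp => //; exact: measurable_lincomb.
rewrite lee_fin /square_sum.
apply: (le_trans (rows_ge_l2 (fun i => u i y) _)); first by rewrite ler_pdivlMr // mul1r.
have -> : 2 * (r / 2) = r by field.
apply: le_average => e; by rewrite row_sumE.
Qed.

Lemma pmoment_le_square_sum (x : T) :
  (pm r Z x <= ((2 `^ r) ^+ m * (khinchine_const r ^+ m) `^ (r / 2))%:E *
     EX full (fun y => (square_sum y `^ (r / 2))%:E) x)%E.
Proof.
have c0 : 0 <= (2 `^ r) ^+ m by rewrite exprn_ge0 ?powR_ge0.
have nZ (a : mindex m n -> R) : nnmeasurable (fun y => (`|lincomb u a y| `^ r)%:E).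
  by apply: nnmeasurable_norm_powR; exact: measurable_lincomb.
have b0 : (0 <= pm r Z x)%E by exact: (nnmeasurable_EX _ (nZ _)).2.
apply: (le_trans (le_average_ereal (F := fun e : signs =>
   (((2 `^ r) ^+ m)%:E * pm r (Zs e) x)%E) ([ffun=> true] : signs) b0 _)).
  by move=> e; exact: (pmoment_unsigned_le indep r2 mu lu iu cu).
rewrite -ge0_sume_distrr; last by move=> e _; exact: (nnmeasurable_EX _ (nZ _)).2.
rewrite muleCA EX_average_signs EFinM -muleA; apply: lee_wpmul2l; first by rewrite lee_fin.
rewrite -EXZl; first last.
- by rewrite lee_fin powR_ge0.
- exact: nnmeasurable_square_sum.
apply: le_EX => [||y].
- apply: nnmeasurable_EFin => [|y]; last by apply: average_ge0 => e; exact: powR_ge0.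
  apply: measurable_funM; first exact: measurable_cst.
  apply: measurable_sum => e; apply: (measurableT_comp (measurable_powR r)).
  by apply: measurableT_comp => //; exact: measurable_lincomb.
- apply: nnmeasurableM; last exact: nnmeasurable_square_sum.
  by apply: nnmeasurable_cst; rewrite lee_fin powR_ge0.
rewrite -EFinM lee_fin -powRM ?square_sum_ge0 ?exprn_ge0 ?khinchine_const_ge0 ?(ltW r0) //.
have := @khinchine_rows R m n (enum 'I_m) predT (fun i => u i y) r r2 (enum_uniq _).
rewrite size_enum_ord => H.
apply: le_trans (H _); last first.
  by move=> i k _ _ ik; apply/ffunP => j; apply: ik; rewrite mem_enum.
by apply: le_average => e; rewrite row_sumE.
Qed.

End Exponent.

Lemma nnfamily_squares : nnfamily squares.
Proof.
move=> i; apply: nnmeasurable_EFin => [|y]; last exact: sqr_ge0.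
exact: measurable_funX.
Qed.

Lemma local_squares j : local_in j squares.
Proof. by move=> i x y; rewrite /squares lu. Qed.

Lemma fsum_setT (F : mindex m n -> T -> \bar R) i x :
  fsum [set: _]%SET F i x = (\sum_k F k x)%E.
Proof.
rewrite /fsum /sum_on; apply: eq_bigl => k.
by apply/agree_offP => j; rewrite finset.inE.
Qed.

Lemma fexp_square_sum (q : R) i x :
  fexp X [set: _]%SET (fpow q (fsum [set: _]%SET squares)) i x =
  EX full (fun y => (square_sum y `^ q)%:E) x.
Proof.
rewrite /fexp; have -> : rows n [set: 'I_m]%SET = full.
  by apply/setP => jk; rewrite !finset.inE.
congr (EX _ _ x); apply/funext => y.
by rewrite /fpow fsum_setT /squares sumEFin poweR_EFin.
Qed.

Definition mixed (q : R) (J : {set 'I_m}) : mindex m n -> T -> \bar R :=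
  fexp X J (fmax J (fpow q (marginal X squares J))).

Lemma nnfamily_mixed q J : nnfamily (mixed q J).
Proof. exact/nnfamily_fexp/nnfamily_fmax/nnfamily_fpow/nnfamily_marginal/nnfamily_squares. Qed.

(** The maximum of powers is at most their sum, the sum of powers at most the power of the sum, and
    Jensen's inequality takes the inner expectation over the rows outside [J] out of the power. *)
Lemma mixed_le_square_sum (q : R) J i x : 1 < q ->
  (mixed q J i x <= EX full (fun y => (square_sum y `^ q)%:E) x)%E.
Proof.
move=> q1; have q0 : 0 < q by exact: lt_trans q1.
have gs := nnfamily_squares; have gm : nnfamily (marginal X squares J) by exact: nnfamily_marginal.
rewrite -(fexp_square_sum q i x) /mixed.
have -> : [set: 'I_m]%SET = J :|: ~: J by rewrite finset.setUCr.
have dJ : {in J, forall k, k \notin (~: J)%SET} by move=> k kJ; rewrite finset.inE kJ.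
have gF : nnfamily (fpow q (fsum (J :|: ~: J) squares)) by exact/nnfamily_fpow/nnfamily_fsum.
rewrite -(fexp_fexp indep) //.
apply: le_fexp => [||y]; [exact/nnfamily_fmax/nnfamily_fpow|exact: nnfamily_fexp|].
apply: (le_trans (fmax_le_fsum _ _ _ _)); first exact: nnfamily_fpow.
apply: (le_trans (fsum_fpow_le _ _ _ q1 gm)).
rewrite /marginal /fpow -(fsumU _ dJ) -fexp_fsum //.
by apply: EX_jensen => //; exact: nnfamily_fsum.
Qed.

(** Per row, a factor [2] for removing the signs and [2 e^2], the square root of [khinchine_const]
    without its [p]; the last factor belongs to the nonnegative moments. *)
Definition chaos_const : R := (2 * (2 * expR 2)) ^+ m * nonneg_const R m.

Lemma chaos_const_ge1 : 1 <= chaos_const.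
Proof.
rewrite mulr_ege1 ?nonneg_const_ge1 // exprn_ege1 //.
have := expR_ge1Dx (2 : R); lra.
Qed.

(** Of the exponent [(m + #|J|) r / 2], the part [m r / 2] comes from Khinchine's inequality in [m]
    rows, the part [#|J| r / 2] from the nonnegative moments at exponent [r / 2]. *)
Lemma pmoment_le_mixed (r : R) (i : mindex m n) (x : T) : 2 < r ->
  (forall i x, (EX full (fun y => (`|u i y| `^ r)%:E) x < +oo)%E) ->
  (pm r Z x <= (chaos_const `^ r)%:E *
    \sum_(J : {set 'I_m}) (r `^ ((m + #|J|)%:R * r / 2))%:E * mixed (r / 2) J i x)%E.
Proof.
move=> r2 iu; have r0 : 0 < r by exact: lt_trans r2.
have q1 : 1 < r / 2 by rewrite ltr_pdivlMr // mul1r.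
apply: (le_trans (pmoment_le_square_sum (ltW r2) iu x)).
pose N := (\sum_(J : {set 'I_m}) (r `^ (#|J|%:R * (r / 2)))%:E * mixed (r / 2) J i x)%E.
have t0 (J : {set 'I_m}) : (0 <= (r `^ (#|J|%:R * (r / 2)))%:E * mixed (r / 2) J i x)%E.
  by apply: mule_ge0; [rewrite lee_fin powR_ge0|exact: nnfamily_ge0 (nnfamily_mixed _ _)].
have N0 : (0 <= N)%E by apply: sume_ge0 => J _; exact: t0.
have HS : (EX full (fun y => (square_sum y `^ (r / 2))%:E) x <=
    (nonneg_const R m `^ (r / 2))%:E * N)%E.
  rewrite -(fexp_square_sum _ i).
  apply: (nonneg_moment_bound indep q1 nnfamily_squares local_squares N0) => J.
  apply: (@le_trans _ _ ((r `^ (#|J|%:R * (r / 2)))%:E * mixed (r / 2) J i x)%E).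
    apply: lee_wpmul2r; first exact: nnfamily_ge0 (nnfamily_mixed _ _).
    rewrite lee_fin; apply: le_powR_base.
    - by rewrite mulr_ge0 // divr_ge0 // ltW.
    - by rewrite divr_ge0 // ltW.
    - by rewrite ler_pdivrMr // ler_peMr ?(ltW r0) // ler1n.
  rewrite /N (bigD1 J) //=; apply: leeDl; apply: sume_ge0 => J' _; exact: t0.
apply: (le_trans (lee_wpmul2l _ HS)).
  by rewrite lee_fin mulr_ge0 ?powR_ge0 // exprn_ge0 // powR_ge0.
have k0 : 0 <= khinchine_const r by rewrite khinchine_const_ge0 // ltW.
have n1 := nonneg_const_ge1 R m.
have n0 : 0 <= nonneg_const R m by exact: le_trans n1.
apply: (@le_trans _ _ ((chaos_const `^ r * r `^ (m%:R * (r / 2)))%:E * N)%E).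
  rewrite muleA -EFinM; apply: lee_wpmul2r => //; rewrite lee_fin.
  have -> : (khinchine_const r ^+ m) `^ (r / 2) =
      ((2 * expR 2) ^+ m) `^ r * r `^ (m%:R * (r / 2)).
    rewrite /khinchine_const exprMn powRM ?exprn_ge0 ?sqr_ge0 ?(ltW r0) //.
    have b0 : 0 <= (2 * expR 2 : R) ^+ m by rewrite exprn_ge0 // mulr_ge0 ?expR_ge0.
    rewrite exprAC -(powR_mulrn 2 b0) -powRrM.
    have -> : 2 * (r / 2) = r by field.
    by rewrite -(powR_mulrn m (ltW r0)) -powRrM.
  have a0 : 0 <= (2 : R) ^+ m by rewrite exprn_ge0.
  have b0 : 0 <= (2 * expR 2 : R) ^+ m by rewrite exprn_ge0 // mulr_ge0 ?expR_ge0.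
  rewrite powR_exprn // /chaos_const [(2 * (2 * expR 2)) ^+ m]exprMn.
  move: (2 ^+ m) ((2 * expR 2) ^+ m) (nonneg_const R m) a0 b0 n0 n1 => a b c a0 b0 c0 c1.
  rewrite !powRM ?mulr_ge0 // -!mulrA ler_wpM2l ?powR_ge0 // ler_wpM2l ?powR_ge0 //.
  rewrite mulrC ler_wpM2r ?powR_ge0 // ler_powR //.
  by rewrite ler_pdivrMr // ler_peMr ?(ltW r0) // ler1n.
rewrite EFinM -muleA; apply: lee_wpmul2l; first by rewrite lee_fin powR_ge0.
rewrite /N ge0_sume_distrr; last by move=> J _; exact: t0.
apply: lee_sum => J _; rewrite muleA -EFinM -powRD; last by rewrite (gt_eqF r0) implybT.
by rewrite -mulrDl -natrD mulrA.
Qed.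

End Chaos.

(** * The quantile and the final constants *)

Section Quantile.
Context (R : realType) (d : measure_display) (Omega : measurableType d)
  (P : probability Omega R) (Z : Omega -> R).
Hypothesis mZ : measurable_fun setT Z.
Implicit Types (c p r s t Q B eta : R).

Local Notation tail t := [set w | t < `|Z w|].
Local Notation moment p := (\int[P]_w (`|Z w| `^ p)%:E)%E.

Lemma measurable_tail t : measurable (tail t).
Proof.
have -> : tail t = (fun w => `|Z w|) @^-1` `]t, +oo[%classic.
  by apply/seteqP; split=> w /=; rewrite in_itv /= andbT.
rewrite -[X in measurable X]setTI.
have mn : measurable_fun setT (fun w => `|Z w|) by exact: measurableT_comp.
exact: mn.
Qed.

Lemma measurable_moment p : measurable_fun setT (fun w => (`|Z w| `^ p)%:E).
Proof.
apply/measurable_EFinP; apply: (measurableT_comp (measurable_powR p)).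
exact: measurableT_comp.
Qed.

Lemma integral_tail t : (\int[P]_w ((\1_(tail t) w)%:E))%E = P (tail t).
Proof. by rewrite integral_indic ?setIT //; exact: measurable_tail. Qed.

Lemma nnmeasurable_tail t : nnmeasurable (fun w => (\1_(tail t) w)%:E : \bar R).
Proof.
split=> [|w]; last by rewrite lee_fin.
by apply/measurable_EFinP; apply: measurable_indic; exact: measurable_tail.
Qed.

Lemma tail_markov t p : 0 < t -> 0 < p ->
  ((t `^ p)%:E * P (tail t) <= moment p)%E.
Proof.
move=> t0 p0; have [mt nt] := nnmeasurable_tail t.
rewrite -integral_tail -ge0_integralZl //; last by rewrite lee_fin powR_ge0.
apply: ge0_le_integral => //.
- by move=> w _; rewrite mule_ge0 // lee_fin powR_ge0.
- by apply: emeasurable_funM => //; exact: measurable_cst.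
- exact: measurable_moment.
move=> w _; rewrite -EFinM lee_fin indicE.
have [|_] := boolP (w \in tail t); last by rewrite mulr0 powR_ge0.
by rewrite mulr1 inE /= => tw; apply: le_powR_base; rewrite ?(ltW p0) ?(ltW t0) ?(ltW tw).
Qed.

(** The slack [eta] keeps the point positive when [Q = 0]. The result serves twice: it shows that
    the set defining the quantile is nonempty and, as [eta] tends to 0, it bounds the quantile. *)
Lemma tail_quantile_markov p c Q eta : 0 < p -> 0 < c -> 0 <= Q -> 0 < eta ->
  moment p = Q%:E ->
  0 <= ((Q + eta) / c) `^ p^-1 /\ (P (tail (((Q + eta) / c) `^ p^-1)%R) <= c%:E)%E.
Proof.
move=> p0 c0 Q0 eta0 HQ; split; first exact: powR_ge0.
set t := _ `^ _.
have Qe : 0 < Q + eta by exact: ltr_wpDl.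
have t0 : 0 < t by rewrite powR_gt0 // divr_gt0.
have tp : t `^ p = (Q + eta) / c.
  by rewrite -powRrM mulVf ?gt_eqF // powRr1 // divr_ge0 ?ltW.
have := tail_markov t0 p0; rewrite HQ tp.
have : (P (tail t) <= 1)%E by apply: probability_le1; exact: measurable_tail.
have : (0 <= P (tail t))%E by [].
case: (P (tail t)) => [u| |] //= u0 u1; rewrite -EFinM !lee_fin => H.
rewrite -(ler_pM2l (divr_gt0 Qe c0)); apply: (le_trans H).
by rewrite mulfVK ?gt_eqF // lerDl ltW.
Qed.

Lemma tail_quantile_le p c Q : 0 < p -> 0 < c -> 0 <= Q ->
  moment p = Q%:E -> c * tail_quantile P Z c `^ p <= Q.
Proof.
move=> p0 c0 Q0 HQ; apply/ler_addgt0Pr => eta eta0.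
have Qe : 0 < Q + eta by exact: ltr_wpDl.
have t0 : tail_quantile P Z c <= ((Q + eta) / c) `^ p^-1.
  apply: ge_inf; last exact: tail_quantile_markov.
  by exists 0 => t [].
have t1 : 0 <= tail_quantile P Z c.
  apply: lb_le_inf; last by move=> t [].
  exists (((Q + eta) / c) `^ p^-1); exact: tail_quantile_markov.
rewrite -ler_pdivlMl // mulrC.
apply: (le_trans (le_powR_base (ltW p0) t1 t0)).
by rewrite -powRrM mulVf ?gt_eqF // powRr1 // divr_ge0 ?ltW.
Qed.

(** The finite moment guarantees a nonempty set: the infimum of the empty set is 0 by convention,
    which would spoil a lower bound. *)
Lemma tail_quantile_ge p c Q s : 0 < p -> 0 < c -> 0 <= Q ->
  moment p = Q%:E -> (c%:E < P (tail s))%E -> s <= tail_quantile P Z c.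
Proof.
move=> p0 c0 Q0 HQ cs; apply: lb_le_inf.
  by exists (((Q + 1) / c) `^ p^-1); exact: tail_quantile_markov.
move=> t [t0 tc]; rewrite leNgt; apply/negP => ts.
have : (P (tail s) <= P (tail t))%E.
  apply: le_measure; rewrite ?inE; [exact: measurable_tail..|].
  by move=> w /=; exact: lt_trans.
by move=> /(lt_le_trans cs) /lt_le_trans /(_ tc); rewrite ltxx.
Qed.

(** [Z^2] is split at [|Z| = s / 2] and [|Z| = N] with [N = nu * s]. The lowest part contributes at
    most [s^2 / 4], the highest at most [N^(2 - r) E|Z|^r], which the choice [nu^(r - 2) = 4 B^r]
    makes at most [s^2 / 4]; the middle part, at most [N^2] times the tail, must supply the rest. *)
Lemma paley_zygmund r s B : 2 < r -> 0 < s -> 0 < B ->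
  moment 2 = (s ^+ 2)%:E -> (moment r <= ((B * s) `^ r)%:E)%E ->
  ((2 * ((4 * B `^ r) `^ (r - 2)^-1) ^+ 2)^-1%R%:E <= P (tail (s / 2)%R))%E.
Proof.
move=> r2 s0 B0 H2 Hr.
set nu := _ `^ (r - 2)^-1.
have rr : 0 < r - 2 by rewrite subr_gt0.
have r0 : 0 < r by exact: lt_trans r2.
have X0 : 0 < 4 * B `^ r by rewrite mulr_gt0 // powR_gt0.
have nu0 : 0 < nu by rewrite powR_gt0.
have nur : nu `^ (r - 2) = 4 * B `^ r.
  by rewrite -powRrM mulVf ?gt_eqF // powRr1 // ltW.
pose N := nu * s; have N0 : 0 < N by rewrite mulr_gt0.
have [mt nt] := nnmeasurable_tail (s / 2).
have mm := measurable_moment.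
pose b := N `^ (r - 2).
have b0 : 0 < b by rewrite powR_gt0.
have key : (moment 2 <= \int[P]_w ((s ^+ 2 / 4)%:E +
   ((N ^+ 2)%:E * (\1_(tail (s / 2)%R) w)%:E + (b^-1)%:E * (`|Z w| `^ r)%:E)))%E.
  apply: ge0_le_integral => //.
  - apply: emeasurable_funD; first exact: measurable_cst.
    by apply: emeasurable_funD; apply: emeasurable_funM => //; exact: measurable_cst.
  move=> w _; rewrite -!EFinM -!EFinD lee_fin (powR_mulrn 2) // indicE.
  have T0 : 0 <= b^-1 * `|Z w| `^ r by rewrite mulr_ge0 ?powR_ge0 // invr_ge0 ltW.
  have [_|] := boolP (w \in tail (s / 2)).
    have [zN|Nz] := leP `|Z w| N.
      have : `|Z w| ^+ 2 <= N ^+ 2 by rewrite lerXn2r ?nnegrE // ltW.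
      have : 0 <= s ^+ 2 / 4 by rewrite divr_ge0 // sqr_ge0.
      rewrite mulr1; lra.
    have z0 : 0 < `|Z w| by exact: lt_trans Nz.
    have : `|Z w| ^+ 2 <= b^-1 * `|Z w| `^ r.
      rewrite ler_pdivlMl // mulrC -powR_mulrn //.
      have -> : `|Z w| `^ r = `|Z w| `^ 2 * `|Z w| `^ (r - 2).
        by rewrite -powRD; [rewrite addrC subrK|rewrite (gt_eqF z0) implybT].
      by rewrite ler_wpM2l ?powR_ge0 // le_powR_base // ltW.
    have : 0 <= s ^+ 2 / 4 by rewrite divr_ge0 // sqr_ge0.
    have : 0 <= N ^+ 2 by rewrite sqr_ge0.
    rewrite mulr1; lra.
  rewrite notin_setE /= => /negP; rewrite -leNgt => zs.
  have : `|Z w| ^+ 2 <= (s / 2) ^+ 2 by rewrite lerXn2r ?nnegrE // divr_ge0 // ltW.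
  have -> : (s / 2) ^+ 2 = s ^+ 2 / 4 by field.
  rewrite mulr0; lra.
have Nn0 : (0 <= (N ^+ 2)%:E :> \bar R)%E by rewrite lee_fin sqr_ge0.
have bn0 : (0 <= (b^-1)%:E :> \bar R)%E by rewrite lee_fin invr_ge0 ltW.
have mo0 w : (0 <= (`|Z w| `^ r)%:E :> \bar R)%E by rewrite lee_fin powR_ge0.
rewrite ge0_integralD // in key; first last.
- by apply: emeasurable_funD; apply: emeasurable_funM => //; exact: measurable_cst.
- by move=> w _; apply: adde_ge0; exact: mule_ge0.
- by move=> w _; rewrite lee_fin divr_ge0 // sqr_ge0.
rewrite ge0_integralD // in key; first last.
- by apply: emeasurable_funM => //; exact: measurable_cst.
- by move=> w _; exact: mule_ge0.
- by apply: emeasurable_funM => //; exact: measurable_cst.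
- by move=> w _; exact: mule_ge0.
rewrite !ge0_integralZl // in key.
have cstE : (\int[P]_w (s ^+ 2 / 4)%:E = (s ^+ 2 / 4)%:E)%E.
  transitivity ((s ^+ 2 / 4)%:E * P setT)%E; first exact: integral_cst.
  by rewrite probability_setT mule1.
rewrite integral_tail cstE H2 in key.
have bs : b^-1 * (B * s) `^ r = s ^+ 2 / 4.
  rewrite /b /N powRM ?(ltW nu0) ?(ltW s0) // nur powRM ?(ltW B0) ?(ltW s0) //.
  rewrite powRB; last by rewrite (gt_eqF s0) implybT.
  rewrite (powR_mulrn 2 (ltW s0)).
  have : B `^ r != 0 by rewrite gt_eqF // powR_gt0.
  have : s `^ r != 0 by rewrite gt_eqF // powR_gt0.
  have : s != 0 by rewrite gt_eqF.
  by move=> h1 h2 h3; field; rewrite h1 h2 h3.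
have {}key : ((s ^+ 2)%:E <= (s ^+ 2 / 4)%:E + ((N ^+ 2)%:E * P (tail (s / 2)%R) + (s ^+ 2 / 4)%:E))%E.
  apply: (le_trans key); apply: leeD => //; apply: leeD => //.
  by rewrite -bs EFinM lee_wpmul2l.
have : (P (tail (s / 2)%R) <= 1)%E by apply: probability_le1; exact: measurable_tail.
have : (0 <= P (tail (s / 2)%R))%E by [].
move: key; case: (P (tail (s / 2))) => [v| |] //= + v0 v1.
rewrite -EFinM -!EFinD !lee_fin /N exprMn => H.
have nn0 : 0 < nu ^+ 2 by rewrite exprn_gt0.
have ss0 : 0 < s ^+ 2 by rewrite exprn_gt0.
rewrite -[_^-1]mul1r ler_pdivrMr ?mulr_gt0 //.
rewrite -(ler_pM2l ss0); nra.
Qed.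

End Quantile.

(** * Comparison of the level of the quantile with explicit probabilities *)

Section QuantileConstants.
Context (R : realType).
Implicit Types (B K p : R).

Lemma powR_le1 (a q : R) : 0 <= a -> a <= 1 -> 0 <= q -> a `^ q <= 1.
Proof. by move=> a0 a1 q0; have := le_powR_base q0 a0 a1; rewrite powR1. Qed.

Definition quantile_level (m : nat) K p : R :=
  (3 / 4) `^ (p / (p - 2)) / (2 * K `^ p * p `^ (m%:R * p / 2)) `^ (1 / (p - 2)).

Lemma quantile_level_gt0 m K p : 0 < K -> 0 < p -> 0 < quantile_level m K p.
Proof.
by move=> K0 p0; rewrite divr_gt0 ?powR_gt0 ?mulr_gt0 ?powR_gt0 ?divr_gt0.
Qed.

(** Both sides are powers with exponent [1 / (p - 2)]; since [3/4 * 4 = 3], the comparison of the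
    bases reduces to [2 <= 3^p]. *)
Lemma quantile_level_ge m K p : 0 < K -> 2 < p ->
  1 / (4 * K * p `^ (m%:R / 2)) `^ (p / (p - 2)) <= quantile_level m K p.
Proof.
move=> K0 p2; have p0 : 0 < p by exact: lt_trans p2.
have r0 : 0 < p - 2 by rewrite subr_gt0.
have X0 : 0 < 2 * K `^ p * p `^ (m%:R * p / 2) by rewrite !mulr_gt0 ?powR_gt0.
have W0 : 0 < 4 * K * p `^ (m%:R / 2) by rewrite !mulr_gt0 ?powR_gt0.
rewrite /quantile_level ler_pdivrMr; last exact: powR_gt0.
rewrite mulrAC ler_pdivlMr; last exact: powR_gt0.
rewrite !mul1r.
rewrite -powRM ?divr_ge0 ?(ltW W0) // [leRHS]powRrM.
apply: le_powR_base; rewrite ?invr_ge0 ?(ltW r0) ?(ltW X0) //.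
have -> : 3 / 4 * (4 * K * p `^ (m%:R / 2)) = 3 * (K * p `^ (m%:R / 2)) by field.
rewrite [leRHS]powRM ?mulr_ge0 ?powR_ge0 ?(ltW K0) //.
rewrite [(K * _) `^ p]powRM ?powR_ge0 ?(ltW K0) // -powRrM.
have -> : m%:R / 2 * p = m%:R * p / 2 by field.
rewrite -mulrA ler_wpM2r ?mulr_ge0 ?powR_ge0 //.
apply: (@le_trans _ _ 3); first by lra.
by apply: le1r_powR; lra.
Qed.

(** For [p >= 4] the right side is [1 / (8 B^4)], while the level is at most the inverse of
    [K = 32 B^4] because [(K^p)^(1 / (p - 2)) >= K]. For [p < 4] both sides are written with the
    exponent [1 / (p - 2)] and the bases are compared; there [K^p] contains [B^(4 p)], which beats
    the [B^(2 p)] of Paley-Zygmund. *)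
Lemma quantile_level_lt m B p : 1 <= B -> 2 < p ->
  quantile_level m (32 * B ^+ 4) p <
  (2 * ((4 * B `^ Num.min p 4) `^ (Num.min p 4 - 2)^-1) ^+ 2)^-1.
Proof.
move=> B1 p2; have p0 : 0 < p by exact: lt_trans p2.
have r0 : 0 < p - 2 by rewrite subr_gt0.
have B0 : 0 < B by exact: lt_le_trans B1.
have B4 : 1 <= B ^+ 4 by exact: exprn_ege1.
have K0 : 0 < 32 * B ^+ 4 by rewrite mulr_gt0 ?exprn_gt0.
have X0 : 0 < 2 * (32 * B ^+ 4) `^ p * p `^ (m%:R * p / 2).
  by rewrite !mulr_gt0 ?powR_gt0.
have pp : 1 <= p `^ (m%:R * p / 2).
  by rewrite le1_powR ?divr_ge0 ?mulr_ge0 ?(ltW p0) //; lra.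
have [p4|p4] := ltP p 4.
  set nu := _ `^ (p - 2)^-1.
  have Bp : 1 <= B `^ p by rewrite le1_powR // ltW.
  have nu0 : 0 < nu by rewrite powR_gt0 // mulr_gt0 // powR_gt0.
  rewrite /quantile_level -[ltRHS]mul1r ltr_pdivlMr ?mulr_gt0 ?exprn_gt0 //.
  rewrite mulrAC ltr_pdivrMr ?powR_gt0 // !mul1r -[(p - 2)^-1 in ltRHS]div1r.
  have -> : (3 / 4) `^ (p / (p - 2)) * (2 * nu ^+ 2) =
     ((3 / 4) `^ p * (2 `^ (p - 2) * (4 * B `^ p) ^+ 2)) `^ (1 / (p - 2)).
    have Q0 : 0 <= 4 * B `^ p by rewrite mulr_ge0 ?powR_ge0.
    have e0 : p - 2 != 0 by rewrite gt_eqF.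
    rewrite div1r /nu; move: (3 / 4) (4 * B `^ p) Q0 => a Q Q0.
    rewrite [RHS]powRM ?mulr_ge0 ?powR_ge0 ?sqr_ge0 // -powRrM; congr (_ * _).
    rewrite [RHS]powRM ?powR_ge0 ?sqr_ge0 // -powRrM mulfV // powRr1 //.
    by rewrite powR_exprn.
  have H : (3 / 4) `^ p * (2 `^ (p - 2) * (4 * B `^ p) ^+ 2) <
     2 * (32 * B ^+ 4) `^ p * p `^ (m%:R * p / 2).
    apply: (@le_lt_trans _ _ (2 `^ (p - 2) * (4 * B `^ p) ^+ 2)).
      rewrite ler_piMl ?mulr_ge0 ?powR_ge0 ?sqr_ge0 //.
      by apply: powR_le1; [lra|lra|exact: ltW].
    apply: (@lt_le_trans _ _ (2 * (32 * B ^+ 4) `^ p)); last first.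
      by rewrite ler_peMr // mulr_ge0 ?powR_ge0.
    rewrite powRM ?exprn_ge0 ?(ltW B0) // -powR_exprn ?(ltW B0) //.
    have -> : (32 : R) = 2 * 16 by ring.
    rewrite powRM // powRB; last by rewrite (gt_eqF (ltr0n _ 2)) implybT.
    rewrite (powR_mulrn 2) //.
    have t2 : 0 < 2 `^ p :> R by rewrite powR_gt0.
    have t16 : 16 <= 16 `^ p :> R by apply: le1r_powR; lra.
    move: (B `^ p) (2 `^ p) (16 `^ p) Bp t2 t16 => b t s b1 t0 s0.
    apply: (@lt_le_trans _ _ (2 * (t * 16 * b ^+ 4))); last first.
      by rewrite ler_wpM2l // ler_wpM2r ?exprn_ge0 ?ler_wpM2l ?(ltW t0) //; lra.
    have -> : t / 2 ^+ 2 * (4 * b) ^+ 2 = t * (4 * b ^+ 2) by field.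
    have -> : 2 * (t * 16 * b ^+ 4) = t * (32 * (b ^+ 2 * b ^+ 2)) by ring.
    rewrite ltr_pM2l //.
    have b2 : 1 <= b ^+ 2 by rewrite exprn_ege1.
    nra.
  rewrite gt0_ltr_powR ?nnegrE ?(ltW X0) ?divr_gt0 //.
  by rewrite !mulr_ge0 ?powR_ge0 ?sqr_ge0.
have -> : (4 - 2 : R)^-1 = 2^-1 by congr (_^-1); ring.
have -> : (4 * B `^ 4) `^ 2^-1 ^+ 2 = 4 * B ^+ 4.
  rewrite powR_exprn ?mulr_ge0 ?powR_ge0 // -(powR_mulrn 2) ?mulr_ge0 ?powR_ge0 //.
  rewrite -powRrM mulfV // powRr1 ?mulr_ge0 ?powR_ge0 //.
  by rewrite (powR_mulrn 4) // ltW.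
apply: (@le_lt_trans _ _ (32 * B ^+ 4)^-1); last first.
  rewrite ltf_pV2 ?posrE ?mulr_gt0 ?exprn_gt0 // mulrA ltr_pM2r ?exprn_gt0 //; lra.
rewrite /quantile_level -[leRHS]mul1r ler_pM ?invr_ge0 ?powR_ge0 //.
  by apply: powR_le1; [lra|lra|rewrite divr_ge0 ?(ltW p0) ?(ltW r0)].
rewrite lef_pV2 ?posrE ?powR_gt0 //.
apply: (@le_trans _ _ (((32 * B ^+ 4) `^ p) `^ (1 / (p - 2)))).
  rewrite -powRrM div1r; apply: le1r_powR; first by lra.
  by rewrite ler_pdivlMr // mul1r gerBl.
apply: le_powR_base; rewrite ?divr_ge0 ?powR_ge0 ?(ltW r0) //.
have := powR_ge0 (32 * B ^+ 4) p.
move: ((32 * B ^+ 4) `^ p) (p `^ (m%:R * p / 2)) pp => v t t1 v0.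
have : 0 <= v * (t - 1) by rewrite mulr_ge0 // subr_ge0.
nra.
Qed.

End QuantileConstants.

Lemma poweR_interpolation (R : realType) (v : \bar R) (D a b : R) :
  0 < D -> 0 < a -> a <= b -> (0 <= v)%E ->
  (v `^ a <= (D `^ a)%:E + (D `^ (a - b))%:E * v `^ b)%E.
Proof.
move=> D0 a0 ab; have b0 : 0 < b by exact: lt_le_trans ab.
case: v => [v v0|_|//]; last first.
  rewrite !poweRyr ?gt_eqF // gt0_muley ?lte_fin ?powR_gt0 //.
rewrite !poweR_EFin -EFinM -EFinD lee_fin.
have [vD|Dv] := leP v D.
  by rewrite ler_wpDr ?mulr_ge0 ?powR_ge0 // le_powR_base // ltW.
have vp : 0 < v by exact: lt_trans Dv.
rewrite ler_wpDl ?powR_ge0 //.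
have -> : v `^ b = v `^ a * v `^ (b - a).
  by rewrite -powRD ?[a + _]addrC ?subrK // (gt_eqF vp) implybT.
rewrite mulrCA ler_peMr ?powR_ge0 // -opprB powRN ler_pdivlMl ?powR_gt0 // mulr1.
by apply: le_powR_base; rewrite ?subr_ge0 // ltW.
Qed.

(** * The kernel as a function of the array, and lower exponents *)

Section Kernel.
Context (R : realType) (m n : nat) (d d' : measure_display)
  (Omega : measurableType d) (P : probability Omega R) (S : measurableType d')
  (X : 'I_m -> 'I_n -> {RV P >-> S}) (h : mindex m n -> m.-tuple S -> R).
Hypothesis indep : mutually_independent P (fun jk : 'I_m * 'I_n => X jk.1 jk.2).
Hypothesis mh : forall i, measurable_fun [set: m.-tuple S] (h i).

Local Notation T := (marray m n S).
Local Notation EX := (expect_cells X).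
Local Notation full := [set: 'I_m * 'I_n]%SET.

Definition kernel_fun (i : mindex m n) (x : T) : R := h i (coords i x).

Local Notation Z := (fun w : Omega => hsum h (sample X w)).
Local Notation chaos := (lincomb kernel_fun (fun=> 1)).
Local Notation moment p := (\int[P]_w (`|Z w| `^ p)%:E)%E.

Lemma measurable_kernel_fun i : measurable_fun setT (kernel_fun i).
Proof.
have mc : measurable_fun setT (fun x : T => coords i x).
  apply/measurable_fun_tnthP => j.
  have -> : (fun t => tnth t j) \o (fun x : T => coords i x) = (fun x : T => x j (i j)).
    by apply/funext => x /=; rewrite tnth_mktuple.
  exact: measurable_coord.
exact: (measurableT_comp (mh i) mc).
Qed.

Lemma kernel_local j i x y :
  kernel_fun i (mix (rows n [set j] :\ (j, i j)) y x) = kernel_fun i x.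
Proof.
rewrite /kernel_fun; congr (h i _); apply: eq_from_tnth => k; rewrite !tnth_mktuple /mix.
by rewrite !finset.inE /=; case: (eqVneq k j) => [->|kj]; rewrite ?eqxx ?andbF.
Qed.

Lemma chaosE x : chaos x = hsum h x.
Proof. by apply: eq_bigr => i _; rewrite mul1r. Qed.

Lemma measurable_sample : measurable_fun setT (fun w => sample X w : T).
Proof. by apply: measurable_to_marray => j k; exact: measurable_funPT. Qed.

Lemma measurable_Z : measurable_fun setT Z.
Proof.
have -> : Z = (fun w => chaos (sample X w)) by apply/funext => w; rewrite chaosE.
apply: (measurableT_comp _ measurable_sample).
exact: (measurable_lincomb measurable_kernel_fun).
Qed.

Lemma pmomentE r x : pmoment X r chaos x = moment r.
Proof.
by rewrite /pmoment EX_setT; apply: eq_integral => w _; rewrite chaosE.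
Qed.

Lemma mixed_termE p J x i : mixed_term P X h p J x i = mixed X kernel_fun (p / 2) J i x.
Proof.
rewrite /mixed_term expect_onE /mixed /fexp; congr (expect_cells _ _ _ x).
apply/funext => y; rewrite /fmax; congr (max_on J _ i); apply/funext => k.
rewrite /fpow /marginal /fsum; congr (_ `^ _)%E; congr (sum_on _ _ k).
by apply/funext => l; rewrite expect_onE.
Qed.

Hypothesis cu : forall (i : mindex m n) (j : 'I_m), {ae P, forall w : Omega,
  expect_on P X [set j]%SET
    (fun x : array m n S => (h i (coords i x))%:E) (sample X w) = 0%E}.

Lemma kernel_centered i j : {ae P, forall w,
  (\int[P]_w' (kernel_fun i (mix (rows n [set j]) (sample X w') (sample X w)))%:E = 0)%E}.
Proof. by apply: filterS (cu i j) => w; rewrite expect_onE. Qed.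

Variable p : R.
Hypothesis p2 : 2 < p.
Hypothesis ip : forall i : mindex m n, P.-integrable [set: Omega]
  (fun w : Omega => (`|h i (coords i (sample X w))| `^ p)%:E).

Let p0 : 0 < p. Proof. exact: lt_trans p2. Qed.

Lemma kernel_moment_lty r : 0 < r -> r <= p -> forall i x,
  (EX full (fun y => (`|kernel_fun i y| `^ r)%:E) x < +oo)%E.
Proof.
move=> r0 rp i x; have nk q := nnmeasurable_norm_powR q (measurable_kernel_fun i).
have fin : (EX full (fun y => (`|kernel_fun i y| `^ p)%:E) x < +oo)%E.
  rewrite EX_setT; have /integrableP[_] := ip i; apply: le_lt_trans.
  by rewrite le_eqVlt; apply/orP; left; apply/eqP; apply: eq_integral => w _;
    rewrite gee0_abs // lee_fin powR_ge0.
apply: (@le_lt_trans _ _ (EX full (fun y => 1 + (`|kernel_fun i y| `^ p)%:E) x)%E).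
  apply: le_EX => // [|y]; first by apply: nnmeasurableD => //; exact: nnmeasurable_cst.
  rewrite -EFinD lee_fin; have [k1|k1] := leP `|kernel_fun i y| 1.
    rewrite ler_wpDr ?powR_ge0 //; apply: powR_le1 => //; exact: ltW.
  by rewrite ler_wpDl // ler_powR // ltW.
rewrite EXD //.
by rewrite EX_cst lte_add_pinfty // ltry.
Qed.

Lemma moment_lty r : 2 <= r -> r <= p -> (moment r < +oo)%E.
Proof.
move=> r2 rp; have r0 : 0 < r by exact: lt_le_trans r2.
rewrite -(pmomentE r (fun _ _ => point)).
apply: (pmoment_lincomb_lty r2 measurable_kernel_fun).
exact: kernel_moment_lty.
Qed.

(** Smallness at exponent [p] passes to [r]: the interpolation holds pointwise under the maximum and
    the expectation, and with the threshold [D] each of its two terms contributes [D^(r / 2)]. *)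
Lemma mixed_lower_exponent (r D : R) J i x : 2 < r -> r <= p -> 0 < D ->
  (mixed X kernel_fun (p / 2) J i x <= (D `^ (p / 2))%:E)%E ->
  (mixed X kernel_fun (r / 2) J i x <= (2 * D `^ (r / 2))%:E)%E.
Proof.
move=> r2 rp D0 H.
have gs := nnfamily_squares measurable_kernel_fun.
have gm : nnfamily (marginal X (squares kernel_fun) J) by exact: nnfamily_marginal.
have gF q : nnfamily (fmax J (fpow q (marginal X (squares kernel_fun) J))) by exact/nnfamily_fmax/nnfamily_fpow.
have c0 : 0 <= D `^ (r / 2 - p / 2) by exact: powR_ge0.
have D1 : (0 <= (D `^ (r / 2))%:E :> \bar R)%E by rewrite lee_fin powR_ge0.
apply: (@le_trans _ _ (EX (rows n J) (fun y => (D `^ (r / 2))%:E +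
   (D `^ (r / 2 - p / 2))%:E * fmax J (fpow (p / 2) (marginal X (squares kernel_fun) J)) i y) x)%E).
  apply: le_EX => [||y]; first exact: gF.
    apply: nnmeasurableD; first exact: nnmeasurable_cst.
    by apply: nnmeasurableM; [exact: nnmeasurable_cst|exact: gF].
  apply: bigmax_le; first by rewrite leNye.
  move=> k ki.
  have g0 := nnfamily_ge0 k y gm.
  apply: (le_trans (poweR_interpolation (b := p / 2) D0 _ _ g0)).
  - by rewrite divr_gt0 // (lt_trans _ r2).
  - by rewrite ler_pM2r ?invr_gt0.
  rewrite leeD2l //; apply: lee_wpmul2l; first by rewrite lee_fin.
  exact: (@le_bigmax_cond _ _ _ _ _ _
    (fun k => fpow (p / 2) (marginal X (squares kernel_fun) J) k y)).
rewrite EXD; first last.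
- by apply: nnmeasurableM; [exact: nnmeasurable_cst|exact: gF].
- exact: nnmeasurable_cst.
rewrite EX_cst EXZl //; last exact: gF.
apply: (@le_trans _ _ ((D `^ (r / 2))%:E + (D `^ (r / 2 - p / 2))%:E * (D `^ (p / 2))%:E)%E).
  by rewrite leeD2l //; apply: lee_wpmul2l; [rewrite lee_fin|exact: H].
rewrite -EFinM -EFinD lee_fin -powRD; last by rewrite (gt_eqF D0) implybT.
by rewrite subrK; lra.
Qed.

Lemma mixed_set0 q i x : mixed X kernel_fun q finset.set0 i x =
  (EX full (fun y => (square_sum kernel_fun y)%:E) x `^ q)%E.
Proof.
have gs := nnfamily_squares measurable_kernel_fun.
rewrite /mixed fmax0 /fexp EX_independent; last first.
  move=> y z; congr (fpow _ _ _ _); apply/funext => a; apply/funext => b.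
  by rewrite /mix !finset.inE.
rewrite /fpow /marginal finset.setC0 fsum_setT; congr (_ `^ _)%E.
have -> : (fun y => (square_sum kernel_fun y)%:E) = (fun y => \sum_k squares kernel_fun k y)%E.
  by apply/funext => y; rewrite sumEFin.
rewrite EX_sum //; apply: eq_bigr => k _; rewrite /fexp.
have -> // : rows n [set: 'I_m]%SET = full.
by apply/setP => jk; rewrite !finset.inE.
Qed.

End Kernel.

Section FinalConstants.
Context (R : realType) (m : nat).

(** Beside [chaos_const], the factors are those of [lower_exponent_moment]: [2^(m+1)] for the number
    of sets [J] and the [2] of the interpolation, [4^m] for the powers of [r <= 4], and [2^m] for
    [D <= 4^m s^2]. *)
Definition moment_const : R :=
  chaos_const R m * 2 ^+ m.+1 * 4 ^+ m * 2 ^+ m.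

(** The shape [32 B^4] is the one that [quantile_level_lt] requires. *)
Definition final_const : R := 32 * moment_const ^+ 4.

Lemma moment_const_ge1 : 1 <= moment_const.
Proof.
have c1 := chaos_const_ge1 R m.
have two k : 1 <= 2 ^+ k :> R by rewrite exprn_ege1 // ler1n.
have four : 1 <= 4 ^+ m :> R by rewrite exprn_ege1 // ler1n.
by rewrite /moment_const mulr_ege1 // mulr_ege1 // mulr_ege1.
Qed.

Lemma final_const_gt0 : 0 < final_const.
Proof.
by rewrite mulr_gt0 // exprn_gt0 // (lt_le_trans _ moment_const_ge1).
Qed.

Lemma chaos_const_le_final : chaos_const R m * 2 ^+ m <= final_const.
Proof.
have B1 := moment_const_ge1; have c1 := chaos_const_ge1 R m.
have t1 : 1 <= 2 ^+ m :> R by rewrite exprn_ege1 // ler1n.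
have h : chaos_const R m * 2 ^+ m <= moment_const.
  have -> : moment_const = chaos_const R m * 2 ^+ m * (2 ^+ m.+1 * 4 ^+ m).
    by rewrite /moment_const; ring.
  have two : 1 <= 2 ^+ m.+1 :> R by rewrite exprn_ege1 // ler1n.
  have four : 1 <= 4 ^+ m :> R by rewrite exprn_ege1 // ler1n.
  have cm : 1 <= chaos_const R m * 2 ^+ m by rewrite mulr_ege1.
  by rewrite ler_peMr ?(le_trans ler01 cm) // mulr_ege1.
apply: (le_trans h); rewrite /final_const.
have b4 : moment_const <= moment_const ^+ 4 by rewrite ler_eXnr.
have : 0 <= moment_const ^+ 4 by rewrite exprn_ge0 // (le_trans _ B1).
lra.
Qed.

End FinalConstants.

(** * The upper bound and the bound of the mixed terms *)

Section UpperBound.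
Context (R : realType) (m n : nat) (d d' : measure_display)
  (Omega : measurableType d) (P : probability Omega R) (S : measurableType d')
  (X : 'I_m -> 'I_n -> {RV P >-> S}) (h : mindex m n -> m.-tuple S -> R).
Hypothesis indep : mutually_independent P (fun jk : 'I_m * 'I_n => X jk.1 jk.2).
Hypothesis mh : forall i, measurable_fun [set: m.-tuple S] (h i).
Hypothesis cu : forall (i : mindex m n) (j : 'I_m), {ae P, forall w : Omega,
  expect_on P X [set j]%SET
    (fun x : array m n S => (h i (coords i x))%:E) (sample X w) = 0%E}.
Variable p : R.
Hypothesis p2 : 2 < p.
Hypothesis ip : forall i : mindex m n, P.-integrable [set: Omega]
  (fun w : Omega => (`|h i (coords i (sample X w))| `^ p)%:E).

Local Notation T := (marray m n S).
Local Notation EX := (expect_cells X).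
Local Notation full := [set: 'I_m * 'I_n]%SET.
Local Notation Z := (fun w : Omega => hsum h (sample X w)).
Local Notation moment p := (\int[P]_w (`|Z w| `^ p)%:E)%E.
Local Notation K := (final_const R m).
Local Notation B := (moment_const R m).
Local Notation mixed := (mixed X (kernel_fun h)).

Let p0 : 0 < p. Proof. exact: lt_trans p2. Qed.
Let mk := measurable_kernel_fun mh.
Let lk := @kernel_local R m n _ S h.
Let ck := kernel_centered cu.

Definition second_moment (x : T) : \bar R :=
  EX full (fun y => (square_sum (kernel_fun h) y)%:E) x.

Lemma second_moment_le x : (second_moment x <= (4 ^+ m)%:E * moment 2)%E.
Proof.
have := square_sum_le_pmoment indep mk lk ck (lexx 2)
  (kernel_moment_lty mh ip (ltr0n _ 2) (ltW p2)) x.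
rewrite (pmomentE _ _ _ x) divff //.
have -> : (2 : R) `^ 2 = 4 by rewrite (powR_mulrn 2) //; ring.
apply: le_trans; apply: le_EX => [||y].
- apply: nnmeasurable_EFin; first exact: measurable_square_sum.
  exact: square_sum_ge0.
- exact: nnmeasurable_square_sum.
- by rewrite powRr1 // square_sum_ge0.
Qed.

(** Capping the exponent at 4 bounds the weights [r^((m + #|J|) r / 2)] by [4^(m r)], which is why
    [B] depends on [m] only and not on [p]. *)
Lemma lower_exponent_moment (D : R) i x : 0 < D -> second_moment x = D%:E ->
  (forall J, J != finset.set0 -> mixed (p / 2) J i x <= (D `^ (p / 2))%:E)%E ->
  forall s, 0 <= s -> D <= 4 ^+ m * s ^+ 2 ->
  (moment (Num.min p 4) <= ((B * s) `^ Num.min p 4)%:E)%E.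
Proof.
move=> D0 HD HJ s s0 Ds; set r := Num.min p 4.
have r2 : 2 < r by rewrite lt_min p2 ltr_nat.
have rp : r <= p by rewrite ge_min lexx.
have r4 : r <= 4 by rewrite ge_min lexx orbT.
have r0 : 0 < r by exact: lt_trans r2.
have c1 := chaos_const_ge1 R m; have c0 : 0 <= chaos_const R m by exact: le_trans c1.
rewrite -(pmomentE _ _ _ x).
apply: (le_trans (pmoment_le_mixed indep mk lk ck i x r2
  (kernel_moment_lty mh ip r0 rp))).
have term (J : {set 'I_m}) : ((r `^ ((m + #|J|)%:R * r / 2))%:E * mixed (r / 2) J i x <=
    ((4 ^+ m) `^ r * (2 * D `^ (r / 2)))%:E)%E.
  rewrite EFinM; apply: lee_pmul.
  - by rewrite lee_fin powR_ge0.
  - by apply: nnfamily_ge0; exact: nnfamily_mixed.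
  - rewrite lee_fin -(powR_mulrn m) // -powRrM.
    apply: (@le_trans _ _ (4 `^ ((m + #|J|)%:R * r / 2))).
      by apply: le_powR_base; rewrite ?divr_ge0 ?mulr_ge0 // ltW.
    rewrite ler_powR ?ler1n // -mulrA.
    have -> : m%:R * r = (m + m)%:R * (r / 2) by rewrite natrD; field.
    rewrite ler_wpM2r ?divr_ge0 ?(ltW r0) // ler_nat leq_add2l.
    by rewrite -[X in (_ <= X)%N](card_ord m) max_card.
  - have [->|J0] := eqVneq J finset.set0.
      rewrite mixed_set0 // -/(second_moment x) HD poweR_EFin lee_fin.
      have := powR_ge0 D (r / 2); lra.
    exact: (mixed_lower_exponent mh r2 rp D0 (HJ J J0)).
apply: (@le_trans _ _ ((chaos_const R m `^ r)%:E *
   \sum_(J : {set 'I_m}) ((4 ^+ m) `^ r * (2 * D `^ (r / 2)))%:E)%E).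
  by apply: lee_wpmul2l; [rewrite lee_fin powR_ge0|exact: lee_sum].
rewrite sumEFin -EFinM lee_fin sumr_const -[_ *+ #|_|]mulr_natl.
have -> : #|{: {set 'I_m}}| = (2 ^ m)%N by rewrite -cardsT -powersetT card_powerset cardsT card_ord.
rewrite natrX.
have Dr : D `^ (r / 2) <= (2 ^+ m * s) `^ r.
  apply: (@le_trans _ _ ((4 ^+ m * s ^+ 2) `^ (r / 2))).
    by apply: le_powR_base; rewrite ?divr_ge0 // ltW.
  have -> : 4 ^+ m * s ^+ 2 = (2 ^+ m * s) ^+ 2 :> R.
    by rewrite exprMn exprAC; congr (_ ^+ _ * _); ring.
  have ms : 0 <= 2 ^+ m * s by rewrite mulr_ge0 ?exprn_ge0.
  by rewrite -(powR_mulrn 2 ms) -powRrM [2 * (_ / 2)]mulrC divfK.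
have t1 : 1 <= 2 ^+ m.+1 :> R by rewrite exprn_ege1 // ler1n.
have tr : 2 ^+ m.+1 <= (2 ^+ m.+1) `^ r :> R by apply: le1r_powR => //; lra.
have t0 : 0 <= 2 ^+ m.+1 :> R by exact: le_trans t1.
have f0 : 0 <= 4 ^+ m :> R by exact: exprn_ge0.
have ms : 0 <= 2 ^+ m * s by rewrite mulr_ge0 ?exprn_ge0.
have -> : B * s = chaos_const R m * 2 ^+ m.+1 * 4 ^+ m * (2 ^+ m * s).
  by rewrite /moment_const; ring.
have -> : 2 ^+ m * ((4 ^+ m) `^ r * (2 * D `^ (r / 2))) =
    2 ^+ m.+1 * (4 ^+ m) `^ r * D `^ (r / 2) by rewrite exprS; ring.
move: (chaos_const R m) (2 ^+ m.+1) (4 ^+ m) (2 ^+ m * s) (D `^ (r / 2)) c0 t0 tr f0 ms Dr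
  (powR_ge0 D (r / 2)) => a b c e f a0 b0 br e0 c0' fe f0'.
rewrite !powRM ?mulr_ge0 // mulrA; apply: ler_pM => //.
  by rewrite !mulr_ge0 ?powR_ge0.
by rewrite mulrA ler_wpM2r ?powR_ge0 // ler_wpM2l ?powR_ge0.
Qed.

Lemma quantile_controls_second_moment (D Q : R) i x : 0 < D ->
  second_moment x = D%:E -> moment p = Q%:E -> 0 <= Q ->
  (forall J, J != finset.set0 -> mixed (p / 2) J i x <= (D `^ (p / 2))%:E)%E ->
  D <= (2 ^+ m * (2 * tail_quantile P Z (quantile_level m K p))) ^+ 2.
Proof.
move=> D0 HD HQ Q0 HJ; have mZ := measurable_Z X mh.
have m2fin := moment_lty mh ip (lexx 2) (ltW p2).
have m20 : (0 <= moment 2)%E by apply: integral_ge0 => w _; rewrite lee_fin powR_ge0.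
(* [s] is the [L^2] norm of [Z]: Paley-Zygmund at [s / 2] gives a probability above the level, hence
   [s / 2] is at most the quantile. *)
pose s := Num.sqrt (fine (moment 2)).
have s2 : s ^+ 2 = fine (moment 2) by rewrite sqr_sqrtr // fine_ge0.
have H2 : moment 2 = (s ^+ 2)%:E by rewrite s2 fineK // ge0_fin_numE.
have Ds : D <= 4 ^+ m * s ^+ 2.
  by have := second_moment_le x; rewrite HD H2 -EFinM lee_fin.
have s0 : 0 <= s by exact: sqrtr_ge0.
have sp : 0 < s.
  rewrite lt_neqAle s0 andbT; apply/eqP => sz; move: Ds.
  by rewrite -sz expr0n mulr0 leNgt D0.
have B1 := moment_const_ge1 R m; have B0 : 0 < B by exact: lt_le_trans B1.
have r2 : 2 < Num.min p 4 by rewrite lt_min p2 ltr_nat.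
have Hr := lower_exponent_moment D0 HD HJ s0 Ds.
have PZ := paley_zygmund mZ r2 sp B0 H2 Hr.
have cl : ((quantile_level m K p)%:E < P [set w | (s / 2 < `|Z w|)%R])%E.
  by apply: lt_le_trans PZ; rewrite lte_fin; exact: quantile_level_lt.
have c0 := quantile_level_gt0 m (final_const_gt0 R m) p0.
have st := tail_quantile_ge mZ p0 c0 Q0 HQ cl.
apply: (le_trans Ds).
have -> : 4 ^+ m * s ^+ 2 = (2 ^+ m * s) ^+ 2 :> R.
  by rewrite exprMn exprAC; congr (_ ^+ _ * _); ring.
have t0 : 0 <= 2 ^+ m :> R by exact: exprn_ge0.
have sq : s <= 2 * tail_quantile P Z (quantile_level m K p) by lra.
have st0 := le_trans s0 sq.
have a0 : 0 <= 2 ^+ m * s by exact: mulr_ge0.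
have b0 := mulr_ge0 t0 st0.
by rewrite lerXn2r ?nnegrE //; exact: ler_wpM2l.
Qed.

Lemma upper_bound (Q : R) i x : moment p = Q%:E -> 0 <= Q ->
  (Q%:E <= (2 * K `^ p)%:E *
    (((2 * p `^ (m%:R / 2)) `^ p *
      tail_quantile P Z (quantile_level m K p) `^ p)%:E +
     \sum_(J : {set 'I_m} | J != finset.set0)
       (p `^ ((m + #|J|)%:R * p / 2))%:E * mixed (p / 2) J i x))%E.
Proof.
move=> HQ Q0; set t0 := tail_quantile _ _ _; set Rest := (\sum_(J | _) _)%E.
have K0 := final_const_gt0 R m.
have c1 := chaos_const_ge1 R m; have c0 : 0 <= chaos_const R m by exact: le_trans c1.
have term0 (J : {set 'I_m}) : (0 <= (p `^ ((m + #|J|)%:R * p / 2))%:E * mixed (p / 2) J i x)%E.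
  by apply: mule_ge0; [rewrite lee_fin powR_ge0|apply: nnfamily_ge0; exact: nnfamily_mixed].
have R0 : (0 <= Rest)%E by apply: sume_ge0 => J _; exact: term0.
have cK : chaos_const R m `^ p <= K `^ p.
  apply: le_powR_base; rewrite ?(ltW p0) //.
  apply: le_trans (chaos_const_le_final R m).
  by rewrite ler_peMr // exprn_ege1 // ler1n.
have t0p : (0 <= ((2 * p `^ (m%:R / 2)) `^ p * t0 `^ p)%:E :> \bar R)%E.
  by rewrite lee_fin mulr_ge0 ?powR_ge0.
have m2fin := moment_lty mh ip (lexx 2) (ltW p2).
have m20 : (0 <= moment 2)%E by apply: integral_ge0 => w _; rewrite lee_fin powR_ge0.
have sm0 : (0 <= second_moment x)%E.
  by apply: EX_ge0 => y; rewrite lee_fin; exact: square_sum_ge0.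
have smfin : second_moment x \is a fin_num.
  rewrite ge0_fin_numE //; apply: (le_lt_trans (second_moment_le x)).
  by rewrite lte_mul_pinfty // lee_fin exprn_ge0.
pose D := fine (second_moment x).
have HD : second_moment x = D%:E by rewrite fineK.
have D0 : 0 <= D by exact: fine_ge0.
pose v := p `^ (m%:R * p / 2) * D `^ (p / 2).
have v0 : 0 <= v by rewrite mulr_ge0 ?powR_ge0.
have HZ : (Q%:E <= (chaos_const R m `^ p)%:E * (v%:E + Rest))%E.
  rewrite -HQ -(pmomentE _ _ _ x).
  apply: (le_trans (pmoment_le_mixed indep mk lk ck i x p2
    (kernel_moment_lty mh ip p0 (lexx p)))).
  rewrite (bigD1 finset.set0) //= cards0 addn0 mixed_set0 // -/(second_moment x) HD.
  by rewrite poweR_EFin -EFinM.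
(* [v] is the term of the empty set. In both cases the sum is at most twice its larger part, and
   this is the [2] in [2 * K^p]. *)
have [vR|Rv] := leP v%:E Rest.
  apply: (le_trans HZ).
  apply: (@le_trans _ _ ((chaos_const R m `^ p)%:E * (Rest + Rest))%E).
    by apply: lee_wpmul2l; [rewrite lee_fin powR_ge0|rewrite leeD2r].
  have -> : (Rest + Rest = 2%:E * Rest)%E.
    by rewrite -[(2 : R)]/(1 + 1)%R EFinD ge0_muleDl // mul1e.
  rewrite muleA -EFinM; apply: lee_pmul => //.
  - by rewrite lee_fin mulr_ge0 ?powR_ge0.
  - by rewrite lee_fin mulrC ler_wpM2l.
  - by rewrite leeDr.
have Dp : 0 < D.
  rewrite lt_neqAle D0 andbT; apply/eqP => Dz; move: (le_lt_trans R0 Rv).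
  by rewrite /v -Dz powR0 ?mulr0 ?ltxx // gt_eqF // divr_gt0.
have HJ J : J != finset.set0 -> (mixed (p / 2) J i x <= (D `^ (p / 2))%:E)%E.
  move=> J0; have m0 : (0 <= mixed (p / 2) J i x)%E by apply: nnfamily_ge0; exact: nnfamily_mixed.
  have a0 : 0 < p `^ (m%:R * p / 2) by rewrite powR_gt0.
  (* Every other term carries at least the weight [p^(m p / 2)] of the empty set, so the comparison
     with [v] survives division by this common weight. *)
  have H : ((p `^ (m%:R * p / 2))%:E * mixed (p / 2) J i x <= v%:E)%E.
    apply: le_trans (ltW Rv).
    apply: (@le_trans _ _ ((p `^ ((m + #|J|)%:R * p / 2))%:E * mixed (p / 2) J i x)%E).
      apply: lee_wpmul2r => //; rewrite lee_fin ler_powR //; first by apply: le_trans (ltW p2); rewrite ler1n.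
      by rewrite ler_pM2r ?invr_gt0 // ler_pM2r // ler_nat leq_addr.
    by rewrite /Rest (bigD1 J) //= leeDl // sume_ge0.
  by move: H; rewrite /v EFinM lee_pmul2l ?lte_fin.
have Dt := quantile_controls_second_moment Dp HD HQ Q0 HJ.
rewrite -/t0 in Dt.
have t00 : 0 <= t0.
  apply: lb_le_inf; last by move=> t [].
  have mZ := measurable_Z X mh.
  exists (((Q + 1) / quantile_level m K p) `^ p^-1).
  exact: (tail_quantile_markov mZ p0 (quantile_level_gt0 m K0 p0) Q0 ltr01 HQ).
apply: (le_trans HZ).
apply: (@le_trans _ _ ((chaos_const R m `^ p)%:E * (v%:E + v%:E))%E).
  by apply: lee_wpmul2l; [rewrite lee_fin powR_ge0|apply: leeD2l; exact: ltW].
apply: (@le_trans _ _ ((2 * K `^ p)%:E * ((2 * p `^ (m%:R / 2)) `^ p * t0 `^ p)%:E)%E); last first.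
  by apply: lee_wpmul2l; [rewrite lee_fin mulr_ge0 ?powR_ge0|rewrite leeDl].
rewrite -EFinD -!EFinM lee_fin.
have ms : 0 <= 2 ^+ m * (2 * t0) by rewrite !mulr_ge0 ?exprn_ge0.
(* The factor [2] beside [t0] is kept for [(2 p^(m/2))^p] in the statement; [2^m] goes into [K]
   through [chaos_const_le_final]. *)
have Dpow : D `^ (p / 2) <= (2 ^+ m * (2 * t0)) `^ p.
  apply: (@le_trans _ _ (((2 ^+ m * (2 * t0)) ^+ 2) `^ (p / 2))).
    by apply: le_powR_base; rewrite ?divr_ge0 ?(ltW p0).
  by rewrite -(powR_mulrn 2 ms) -powRrM [2 * (_ / 2)]mulrC divfK.
have a0 : 0 <= p `^ (m%:R / 2) by exact: powR_ge0.
have -> : (2 * K `^ p) * ((2 * p `^ (m%:R / 2)) `^ p * t0 `^ p) =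
    2 * ((K `^ p * (2 * t0) `^ p) * p `^ (m%:R * p / 2)).
  move: (K `^ p) => k.
  rewrite [(2 * p `^ _) `^ p]powRM // [(2 * t0) `^ p]powRM // -powRrM.
  by have -> : m%:R / 2 * p = m%:R * p / 2; [field|ring].
have -> : chaos_const R m `^ p * (v + v) =
    2 * ((chaos_const R m `^ p * D `^ (p / 2)) * p `^ (m%:R * p / 2)) by rewrite /v; ring.
rewrite ler_wpM2l // ler_wpM2r ?powR_ge0 //.
apply: (@le_trans _ _ (chaos_const R m `^ p * (2 ^+ m * (2 * t0)) `^ p)).
  by rewrite ler_wpM2l ?powR_ge0.
have tt : 0 <= 2 * t0 by exact: mulr_ge0.
have p2m : 0 <= 2 ^+ m :> R by exact: exprn_ge0.
have cm0 : 0 <= chaos_const R m * 2 ^+ m by exact: mulr_ge0.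
rewrite -powRM // mulrA [leLHS]powRM //; apply: ler_wpM2r; first exact: powR_ge0.
exact: le_powR_base (ltW p0) cm0 (chaos_const_le_final R m).
Qed.

Lemma lower_bound (Q : R) i x J : moment p = Q%:E ->
  (mixed (p / 2) J i x <= ((2 `^ p) ^+ m * Q)%:E)%E.
Proof.
move=> HQ; have q1 : 1 < p / 2 by rewrite ltr_pdivlMr // mul1r.
apply: (le_trans (mixed_le_square_sum indep mk J i x q1)).
rewrite EFinM -HQ -(pmomentE _ _ _ x).
apply: (square_sum_le_pmoment indep mk lk ck (ltW p2)).
exact: (kernel_moment_lty mh ip p0 (lexx p)).
Qed.

End UpperBound.

Theorem theorem2p5 (R : realType) (m : nat) (hm : (0 < m)%N) :
  exists K : R, 0 < K /\
  forall (d d' : measure_display) (Omega : measurableType d)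
    (P : probability Omega R) (S : measurableType d') (n : nat)
    (X : 'I_m -> 'I_n -> {RV P >-> S})
    (h : mindex m n -> m.-tuple S -> R) (p : R),
  (m <= n)%N ->
  2 < p ->
  mutually_independent P (fun jk : 'I_m * 'I_n => X jk.1 jk.2) ->
  (forall i : mindex m n, measurable_fun [set: m.-tuple S] (h i)) ->
  (forall i : mindex m n,
    P.-integrable [set: Omega]
      (fun w : Omega => (`|h i (coords i (sample X w))| `^ p)%:E)) ->
  (forall (i : mindex m n) (j : 'I_m),
    {ae P, forall w : Omega,
      expect_on P X [set j]%SET
        (fun x : array m n S => (h i (coords i x))%:E) (sample X w) = 0%E}) ->
  let Z := fun w : Omega => hsum h (sample X w) in
  let t0 := tail_quantile P Z
    ((3 / 4) `^ (p / (p - 2)) /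
     (2 * K `^ p * p `^ (m%:R * p / 2)) `^ (1 / (p - 2))) in
  forall (x : array m n S) (i : mindex m n),
  (maxe
     (1 / (4 * K * p `^ (m%:R / 2)) `^ (p / (p - 2)) * t0 `^ p)%:E
     ((2 `^ (- (m%:R * p)))%:E *
      \big[maxe/-oo]_(J : {set 'I_m} | J != finset.set0)
        mixed_term P X h p J x i)
   <= 'E_P[fun w : Omega => (`|Z w| `^ p)%R])%E /\
  ('E_P[fun w : Omega => (`|Z w| `^ p)%R]
   <= (2 * K `^ p)%:E *
      (((2 * p `^ (m%:R / 2)) `^ p * t0 `^ p)%:E +
       \sum_(J : {set 'I_m} | J != finset.set0)
         (p `^ ((m + #|J|)%:R * p / 2))%:E * mixed_term P X h p J x i))%E.
Proof.
exists (final_const R m); split; first exact: final_const_gt0.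
move=> d d' Omega P S n X h p mn p2 indep mh ip cu Z t0 x i.
have p0 : 0 < p by exact: lt_trans p2.
have K0 := final_const_gt0 R m.
have EZ : ('E_P[fun w : Omega => (`|Z w| `^ p)%R])%E = (\int[P]_w (`|Z w| `^ p)%:E)%E.
  by rewrite unlock.
have fin := moment_lty mh ip (ltW p2) (lexx p).
have m0 : (0 <= \int[P]_w (`|Z w| `^ p)%:E)%E.
  by apply: integral_ge0 => w _; rewrite lee_fin powR_ge0.
pose Q := fine (\int[P]_w (`|Z w| `^ p)%:E)%E.
have HQ : (\int[P]_w (`|Z w| `^ p)%:E)%E = Q%:E by rewrite fineK // ge0_fin_numE.
have Q0 : 0 <= Q by exact: fine_ge0.
rewrite EZ HQ; split; last first.
  under eq_bigr do rewrite mixed_termE.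
  exact: (upper_bound indep mh cu p2 ip i x HQ Q0).
rewrite ge_max; apply/andP; split.
  rewrite lee_fin.
  have c0 := quantile_level_gt0 m K0 p0.
  have Ht := tail_quantile_le (measurable_Z X mh) p0 c0 Q0 HQ.
  apply: le_trans Ht; apply: ler_wpM2r; first exact: powR_ge0.
  exact: quantile_level_ge.
have twoE : 2 `^ (- (m%:R * p)) * (2 `^ p) ^+ m = 1 :> R.
  rewrite -powR_mulrn ?powR_ge0 // -powRrM [p * _]mulrC -powRD ?addNr ?powRr0 //.
  by rewrite pnatr_eq0 implybT.
apply: (@le_trans _ _ ((2 `^ (- (m%:R * p)))%:E * ((2 `^ p) ^+ m * Q)%:E)%E).
  apply: lee_wpmul2l; first by rewrite lee_fin powR_ge0.
  apply: bigmax_le; first by rewrite leNye.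
  move=> J _; rewrite mixed_termE.
  exact: (lower_bound indep mh cu p2 ip i x J HQ).
by rewrite -EFinM mulrA twoE mul1r.
Qed.
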